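(* Let a countable group $G$ act by homeomorphisms on a metrizable compact space $X$. The identity $$\Phi(f\otimes a)=\varphi(f\,j(a))\quad\text{for } f\in C(X),\ a\in C^*(G),$$ defines a bijection between states $\varphi$ on $C(X)\rtimes G$ whose centralizer contains $C(X)$ and states $\Phi=\int_X^{\oplus}\varphi_x\,d\nu(x)$ on $C(X)\otimes C^*(G)$ such that $\varphi_x(\lambda_g)=0$ for $\nu$-a.e. $x\in X$ and every $g\notin G_x$.
   Context: $G$ is a countable discrete group acting by homeomorphisms on a metrizable compact space $X$; $C(X)\rtimes G$ is the full crossed product C$^*$-algebra, with canonical unitaries $u_g$, $g\in G$, implementing the action: $u_gfu_g^*=f(g^{-1}\cdot)$ for $f\in C(X)$. $C^*(G)$ is the full group C$^*$-algebra with canonical unitary generators $\lambda_g$, $g\in G$, and $j\colon C^*(G)\to C(X)\rtimes G$ is the canonical homomorphism with $j(\lambda_g)=u_g$. $G_x=\{g\in G\mid gx=x\}$ is the stabilizer of $x\in X$. The centralizer of a state $\varphi$ on a C$^*$-algebra $A$ is the set of $a\in A$ such that $\varphi(ab)=\varphi(ba)$ for all $b\in A$. For a state $\Phi$ on $C(X)\otimes C^*(G)$, the notation $\Phi=\int_X^{\oplus}\varphi_x\,d\nu(x)$ means the disintegration of $\Phi$ with respect to $C(X)$: $\nu$ is the Borel probability measure on $X$ with $\Phi(f\otimes 1)=\int_X f\,d\nu$, and $x\mapsto\varphi_x$ is the ($\nu$-a.e. unique) weakly$^*$ measurable field of states on $C^*(G)$ such that $\Phi(f\otimes a)=\int_X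 f(x)\varphi_x(a)\,d\nu(x)$ for $f\in C(X)$, $a\in C^*(G)$. *)

(* Defs.v *)
(* MathComp-Analysis; the scalars are R[i] for an arbitrary R : realType. *)
From HB Require Import structures.
From mathcomp Require Import all_boot all_order all_algebra.
From mathcomp Require Import all_classical all_reals all_analysis.
From mathcomp Require Import complex.

Set Implicit Arguments.
Unset Strict Implicit.
Unset Printing Implicit Defensive.

Import Order.TTheory GRing.Theory Num.Theory.
Import numFieldNormedType.Exports.

Local Open Scope classical_set_scope.
Local Open Scope ring_scope.

(* As the library's rings are nonzero, so are the C*-algebras below, and
   compact spaces are taken pointed, i.e. nonempty (the zero algebra has no
   states). *)
HB.mixin Record hasStar (R : realType) A & GRing.Algebra R[i] A := {
  star : A -> A;
  starK : involutive star;
  starD : {morph star : a b / a + b};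
  starZ : forall (c : R[i]) a, star (c *: a) = conjc c *: star a;
  starM : forall a b, star (a * b) = star b * star a
}.

#[short(type="starAlgType")]
HB.structure Definition StarAlgebra (R : realType) :=
  {A of GRing.Algebra R[i] A & hasStar R A}.

(* The norm is a separate real-valued field: Hierarchy Builder rejects a join
   of the ring and normed-module hierarchies above numDomainType. *)
HB.mixin Record isCStar (R : realType) A & StarAlgebra R A := {
  cnorm : A -> R;
  cnormD : forall a b, cnorm (a + b) <= cnorm a + cnorm b;
  cnormZ : forall (c : R[i]) a,
    cnorm (c *: a) = ComplexField.Normc.normc c * cnorm a;
  cnorm0_eq0 : forall a, cnorm a = 0 -> a = 0;
  cnormM : forall a b, cnorm (a * b) <= cnorm a * cnorm b;
  cnorm_star : forall a, cnorm (star a * a) = cnorm a ^+ 2;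
  cnorm_complete : forall s : nat -> A,
    (forall e : R, 0 < e -> exists N : nat, forall m n : nat,
       (N <= m)%N -> (N <= n)%N -> cnorm (s m - s n) < e) ->
    exists l : A, cnorm (s n - l) @[n --> \oo] --> (0 : R)
}.

#[short(type="cstarAlgType")]
HB.structure Definition CStarAlgebra (R : realType) :=
  {A of StarAlgebra R A & isCStar R A}.

(* {lrmorphism A -> B} is the type of unital algebra homomorphisms. *)
Definition is_star_hom (R : realType) (A B : starAlgType R)
    (f : {lrmorphism A -> B}) :=
  {morph f : a / star a}.

Definition linear_span (R : realType) (A : cstarAlgType R) (S : set A) :
    set A :=
  [set a | exists (n : nat) (c : 'I_n -> R[i]) (s : 'I_n -> A),
     (forall i, S (s i)) /\ a = \sum_(i < n) c i *: s i].

Definition norm_dense (R : realType) (A : cstarAlgType R) (S : set A) :=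
  forall (a : A) (e : R), 0 < e -> exists2 s, S s & cnorm (a - s) < e.

(* On a unital C*-algebra, a positive functional has norm 1 iff it is 1 at 1.
   In R[i], [0 <= z] says that z is real and nonnegative. *)
Definition is_state (R : realType) (A : starAlgType R) (phi : {scalar A}) :=
  (forall a, 0 <= phi (star a * a)) /\ phi 1 = 1.

Definition centralizer (R : realType) (A : starAlgType R) (phi : {scalar A}) :
    set A :=
  [set a | forall b, phi (a * b) = phi (b * a)].

(* The star-algebra C(X). Its norm is not needed below: only its
   star-homomorphisms into C*-algebras matter, and these are automatically
   contractive. *)
Definition CX (R : realType) (X : ptopologicalType) : Type :=
  continuousType X R[i]^o.

Section CX_star_algebra.
Variables (R : realType) (X : ptopologicalType).
Implicit Types (f g : CX R X) (c : R[i]).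

HB.instance Definition _ := Choice.on (CX R X).

Definition CX_fun f : X -> R[i]^o := f : continuousType X R[i]^o.
Coercion CX_fun : CX >-> Funclass.

Lemma CX_continuous f : continuous (CX_fun f).
Proof. exact: cts_fun. Qed.

Definition toCX (f : X -> R[i]^o) (cf : continuous f) : CX R X :=
  (mkcts cf : continuousType X R[i]^o).

Lemma CX_eqP f g : (forall x, f x = g x) -> f = g.
Proof. by move=> fg; apply/continuousEP. Qed.

Lemma conjc_continuous : continuous (@conjc R : R[i]^o -> R[i]^o).
Proof.
move=> z; have zz : t @[t --> (z : R[i]^o)] --> (z : R[i]^o) by exact: cvg_id.
have FF : Filter (nbhs (z : R[i]^o)) by exact: nbhs_filter.
apply/(@cvgrPdist_lt R[i] R[i]^o _ _ FF) => e e0.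
move/(@cvgrPdist_lt R[i] R[i]^o _ _ FF): zz => /(_ e e0); apply: filterS => t.
by rewrite /= -(rmorphB (@conjc R)) normcJ.
Qed.

Lemma CX_add_subproof f g : continuous (fun x => f x + g x).
Proof. by move=> x; apply: cvgD; apply: CX_continuous. Qed.
Lemma CX_opp_subproof f : continuous (fun x => - f x).
Proof. by move=> x; apply: cvgN; apply: CX_continuous. Qed.
Lemma CX_mul_subproof f g : continuous (fun x => f x * g x : R[i]^o).
Proof. by move=> x; apply: (@cvgM R[i]); apply: CX_continuous. Qed.
Lemma CX_cst_subproof c : continuous (fun _ : X => c : R[i]^o).
Proof. by move=> x; apply: cvg_cst. Qed.
Lemma CX_scale_subproof c f : continuous (fun x => c * f x : R[i]^o).
Proof.
by move=> x; apply: (@cvgM R[i]); [exact: cvg_cst|exact: CX_continuous].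
Qed.
Lemma CX_star_subproof f : continuous (fun x => conjc (f x) : R[i]^o).
Proof.
move=> x; apply: continuous_comp; first exact: CX_continuous.
exact: conjc_continuous.
Qed.

Definition CX_add f g := toCX (@CX_add_subproof f g).
Definition CX_opp f := toCX (@CX_opp_subproof f).
Definition CX_mul f g := toCX (@CX_mul_subproof f g).
Definition CX_cst c := toCX (@CX_cst_subproof c).
Definition CX_scale c f := toCX (@CX_scale_subproof c f).
Definition CX_star f := toCX (@CX_star_subproof f).

Fact CX_addA : associative CX_add.
Proof. by move=> f g h; apply: CX_eqP => x; apply: addrA. Qed.
Fact CX_addC : commutative CX_add.
Proof. by move=> f g; apply: CX_eqP => x; apply: addrC. Qed.
Fact CX_add0 : left_id (CX_cst 0) CX_add.
Proof. by move=> f; apply: CX_eqP => x; apply: add0r. Qed.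
Fact CX_addN : left_inverse (CX_cst 0) CX_opp CX_add.
Proof. by move=> f; apply: CX_eqP => x; apply: addNr. Qed.

HB.instance Definition _ :=
  GRing.isZmodule.Build (CX R X) CX_addA CX_addC CX_add0 CX_addN.

Fact CX_mulA : associative CX_mul.
Proof. by move=> f g h; apply: CX_eqP => x; apply: mulrA. Qed.
Fact CX_mul1l : left_id (CX_cst 1) CX_mul.
Proof. by move=> f; apply: CX_eqP => x; apply: mul1r. Qed.
Fact CX_mul1r : right_id (CX_cst 1) CX_mul.
Proof. by move=> f; apply: CX_eqP => x; apply: mulr1. Qed.
Fact CX_mulDl : left_distributive CX_mul +%R.
Proof. by move=> f g h; apply: CX_eqP => x; apply: mulrDl. Qed.
Fact CX_mulDr : right_distributive CX_mul +%R.
Proof. by move=> f g h; apply: CX_eqP => x; apply: mulrDr. Qed.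

Fact CX_oner_neq0 : CX_cst 1 != 0.
Proof.
apply/eqP => /continuousEP /(_ point) /eqP; apply/negP; exact: oner_neq0.
Qed.

HB.instance Definition _ := GRing.Zmodule_isNzRing.Build (CX R X)
  CX_mulA CX_mul1l CX_mul1r CX_mulDl CX_mulDr CX_oner_neq0.

Fact CX_scaleA c d f : CX_scale c (CX_scale d f) = CX_scale (c * d) f.
Proof. by apply: CX_eqP => x; apply: mulrA. Qed.
Fact CX_scale1 : left_id 1 CX_scale.
Proof. by move=> f; apply: CX_eqP => x; apply: mul1r. Qed.
Fact CX_scaleDr : right_distributive CX_scale +%R.
Proof. by move=> c f g; apply: CX_eqP => x; apply: mulrDr. Qed.
Fact CX_scaleDl f : {morph CX_scale^~ f : c d / c + d}.
Proof. by move=> c d; apply: CX_eqP => x; apply: mulrDl. Qed.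

HB.instance Definition _ := GRing.Zmodule_isLmodule.Build R[i] (CX R X)
  CX_scaleA CX_scale1 CX_scaleDr CX_scaleDl.

Fact CX_scaleAl c f g : c *: (f * g) = (c *: f) * g.
Proof. by apply: CX_eqP => x; apply: mulrA. Qed.
HB.instance Definition _ :=
  GRing.Lmodule_isLalgebra.Build R[i] (CX R X) CX_scaleAl.

Fact CX_scaleAr c f g : c *: (f * g) = f * (c *: g).
Proof. by apply: CX_eqP => x; apply: mulrCA. Qed.
HB.instance Definition _ :=
  GRing.Lalgebra_isAlgebra.Build R[i] (CX R X) CX_scaleAr.

Fact CX_starK : involutive CX_star.
Proof. by move=> f; apply: CX_eqP => x; apply: conjcK. Qed.
Fact CX_starD : {morph CX_star : f g / f + g}.
Proof. by move=> f g; apply: CX_eqP => x; apply: (rmorphD (@conjc R)). Qed.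
Fact CX_starZ c f : CX_star (c *: f) = conjc c *: CX_star f.
Proof. by apply: CX_eqP => x; apply: (rmorphM (@conjc R)). Qed.
Fact CX_starM f g : CX_star (f * g) = CX_star g * CX_star f.
Proof.
apply: CX_eqP => x; rewrite [RHS]mulrC.
exact: (rmorphM (@conjc R)).
Qed.
HB.instance Definition _ :=
  hasStar.Build R (CX R X) CX_starK CX_starD CX_starZ CX_starM.

End CX_star_algebra.

#[short(type="pmetricType")]
HB.structure Definition PointedMetric (K : numDomainType) :=
  {M of Metric K M & isPointed M}.

(* Each [act g] is a homeomorphism, with inverse [act g^-1]. *)
Record caction (G : groupType) (X : topologicalType) := CAction {
  act :> G -> X -> X;
  act1 : forall x, act 1%g x = x;
  actM : forall g h x, act (g * h)%g x = act g (act h x);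
  act_continuous : forall g, continuous (act g)
}.

Definition stabilizer (G : groupType) (X : ptopologicalType)
    (al : caction G X) (x : X) : set G :=
  [set g | al g x = x].

Section crossed_products.
Variables (R : realType) (G : groupType).

Definition unitary_rep (D : cstarAlgType R) (v : G -> D) :=
  [/\ v 1%g = 1,
      forall g h, v (g * h)%g = v g * v h,
      forall g, star (v g) * v g = 1
    & forall g, v g * star (v g) = 1].

(* A, with the unitaries [lam g], is the full group C*-algebra of the discrete
   group G; this determines it up to a unique isomorphism. *)
Definition is_full_group_cstar (A : cstarAlgType R) (lam : G -> A) :=
  [/\ unitary_rep lam,
      norm_dense (linear_span (range lam))
    & forall (D : cstarAlgType R) (v : G -> D), unitary_rep v ->
        exists pi : {lrmorphism A -> D},
          is_star_hom pi /\ forall g, pi (lam g) = v g].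

Variables (X : ptopologicalType) (al : caction G X).

Lemma translate_subproof (g : G) (f : CX R X) :
  continuous (fun x => f (al g^-1%g x)).
Proof.
move=> x; apply: continuous_comp; first exact: act_continuous.
exact: CX_continuous.
Qed.

Definition translate (g : G) (f : CX R X) : CX R X :=
  toCX (@translate_subproof g f).

Definition covariant_rep (D : cstarAlgType R) (rho : {lrmorphism CX R X -> D})
    (v : G -> D) :=
  [/\ is_star_hom rho, unitary_rep v
    & forall g f, v g * rho f * star (v g) = rho (translate g f)].

(* B is the full crossed product of C(X) by G, with the canonical embedding
   [iota] of C(X) and the canonical unitaries [u g]. *)
Definition is_full_crossed_product (B : cstarAlgType R)
    (iota : {lrmorphism CX R X -> B}) (u : G -> B) :=
  [/\ covariant_rep iota u,
      norm_dense (linear_span [set b | exists f g, b = iota f * u g])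
    & forall (D : cstarAlgType R) (rho : {lrmorphism CX R X -> D}) (v : G -> D),
        covariant_rep rho v ->
        exists pi : {lrmorphism B -> D},
          [/\ is_star_hom pi, forall f, pi (iota f) = rho f
            & forall g, pi (u g) = v g]].

End crossed_products.

(* T is the C*-tensor product of A and B, with elementary tensors
   [i1 a * i2 b]. The universal property below is that of the maximal tensor
   product; for A = C(X), which is nuclear, there is only one C*-tensor
   product. *)
Definition is_tensor_product (R : realType) (A : starAlgType R)
    (B T : cstarAlgType R)
    (i1 : {lrmorphism A -> T}) (i2 : {lrmorphism B -> T}) :=
  [/\ is_star_hom i1 /\ is_star_hom i2,
      forall a b, i1 a * i2 b = i2 b * i1 a,
      norm_dense (linear_span [set t | exists a b, t = i1 a * i2 b])
    & forall (D : cstarAlgType R) (r1 : {lrmorphism A -> D})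
             (r2 : {lrmorphism B -> D}),
        is_star_hom r1 -> is_star_hom r2 ->
        (forall a b, r1 a * r2 b = r2 b * r1 a) ->
        exists pi : {lrmorphism T -> D},
          [/\ is_star_hom pi, forall a, pi (i1 a) = r1 a
            & forall b, pi (i2 b) = r2 b]].

(* X with its Borel sigma-algebra. *)
Notation borel X := (g_sigma_algebraType (@open X)).

Definition complex_integral (R : realType) (X : ptopologicalType)
    (nu : probability (borel X) R) (f : X -> R[i]) : R[i] :=
  Complex (Rintegral nu setT (fun x => complex.Re (f x)))
          (Rintegral nu setT (fun x => complex.Im (f x))).

(* Phi is the integral over X of the field of states phi with respect to nu. *)
Definition disintegrates (R : realType) (X : ptopologicalType)
    (A T : cstarAlgType R)
    (i1 : {lrmorphism CX R X -> T}) (i2 : {lrmorphism A -> T})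
    (Phi : {scalar T}) (nu : probability (borel X) R)
    (phi : X -> {scalar A}) :=
  [/\ forall f : CX R X, Phi (i1 f) = complex_integral nu f,
      forall x, is_state (phi x),
      forall a, measurable_fun [set: borel X] (fun x => complex.Re (phi x a))
             /\ measurable_fun [set: borel X] (fun x => complex.Im (phi x a))
    & forall (f : CX R X) a,
        Phi (i1 f * i2 a) = complex_integral nu (fun x => f x * phi x a)].

Definition central_states (R : realType) (X : ptopologicalType)
    (B : cstarAlgType R) (iota : {lrmorphism CX R X -> B}) : set {scalar B} :=
  [set phi | is_state phi /\ range iota `<=` centralizer phi].

Definition stabilizer_supported_states (R : realType) (G : groupType)
    (X : ptopologicalType) (al : caction G X)
    (A : cstarAlgType R) (lam : G -> A) (T : cstarAlgType R)
    (i1 : {lrmorphism CX R X -> T}) (i2 : {lrmorphism A -> T}) :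
    set {scalar T} :=
  [set Phi | is_state Phi /\
     exists (nu : probability (borel X) R) (phi : X -> {scalar A}),
       disintegrates i1 i2 Phi nu phi /\
       {ae nu, forall x, forall g, ~ stabilizer al x g -> phi x (lam g) = 0}].

(* Main.v *)
(** A central state phi gives the positive forms (f, a) |-> phi (f j(a)).  For
    fixed a >= 0 this is a positive functional on C(X), bounded by a multiple
    of the one at a = 1, so Riesz and Radon-Nikodym yield densities of the
    lam g with respect to nu.  For a.e. x these are the values of a positive
    definite function on G, hence of a state phi_x of C*(G), and Phi is the
    integral of the states phi_x o (ev_x (x) id).  Centrality says that
    (k x - k (g^-1 x)) phi_x (lam g) vanishes a.e. for all k in C(X); countably
    many k separate points, whence the support condition.

    Conversely, if g |-> phi_x (lam g) is supported on the stabilizer of x, its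
    GNS representation extends to a covariant representation in which f in C(X)
    multiplies by s |-> f (s x); the vector state maps f u_g to
    f(x) phi_x(lam g), and phi is the integral of these states over X. *)
Require Import Defs.
From HB Require Import structures.
From mathcomp Require Import all_boot all_order all_algebra.
From mathcomp Require Import all_classical all_reals all_analysis.
From mathcomp Require Import complex measurable_realfun ring lra.

Set Implicit Arguments.
Unset Strict Implicit.
Unset Printing Implicit Defensive.

Import Order.TTheory GRing.Theory Num.Theory.
Import numFieldNormedType.Exports.

Local Open Scope classical_set_scope.
Local Open Scope ring_scope.

(** * Complex numbers and states on C*-algebras *)

(** A density of [lam g] is determined only up to a null set depending on g, while positive
    definiteness must hold at a fixed x for all combinations at once; rational coefficients and an
    enumeration of G leave countably many conditions. The universal properties speak of
    homomorphisms into C*-algebras, so a positive definite p has to act inside one. It acts on the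
    reproducing kernel space of p(s^-1 t), whose elements are honest functions on G, translated by
    G. If p lives on the stabilizer of x, the kernel vanishes unless s x = t x; multiplication by s
    |-> f(s x) then maps combinations of kernel functions to such combinations, which makes it
    bounded and adjointable. All identities are checked on generators and extended by continuity.
    The continuity of positive functionals rests on one fact: 1 - x is the square of a self-adjoint
    element when x is self-adjoint of norm less than 1. *)

Section complex_numbers.
Variable R : realType.
Implicit Types z w : R[i].
Local Notation normc := (@ComplexField.Normc.normc R).

Lemma ReD z w : complex.Re (z + w) = complex.Re z + complex.Re w.
Proof. by case: z w => ? ? []. Qed.
Lemma ImD z w : complex.Im (z + w) = complex.Im z + complex.Im w.
Proof. by case: z w => ? ? []. Qed.
Lemma ReN z : complex.Re (- z) = - complex.Re z.
Proof. by case: z. Qed.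
Lemma ImN z : complex.Im (- z) = - complex.Im z.
Proof. by case: z. Qed.
Lemma ReM z w : complex.Re (z * w) = complex.Re z * complex.Re w - complex.Im z * complex.Im w.
Proof. by case: z w => ? ? []. Qed.
Lemma ImM z w : complex.Im (z * w) = complex.Re z * complex.Im w + complex.Im z * complex.Re w.
Proof. by case: z w => ? ? []. Qed.
Lemma ReJ z : complex.Re (conjc z) = complex.Re z.
Proof. by case: z. Qed.
Lemma ImJ z : complex.Im (conjc z) = - complex.Im z.
Proof. by case: z. Qed.
Lemma ReRM (t : R) z : complex.Re (t%:C%C * z) = t * complex.Re z.
Proof. by rewrite ReM /= mul0r subr0. Qed.
Lemma ImRM (t : R) z : complex.Im (t%:C%C * z) = t * complex.Im z.
Proof. by rewrite ImM /= mul0r addr0. Qed.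
Lemma conjcM z w : conjc (z * w) = conjc z * conjc w.
Proof. exact: rmorphM. Qed.
Lemma conjc_sum (I : Type) (r : seq I) (F : I -> R[i]) :
  conjc (\sum_(i <- r) F i) = \sum_(i <- r) conjc (F i).
Proof. exact: (rmorph_sum (@conjc R)). Qed.
Definition ReImE := (ReM, ImM, ReD, ImD, ReN, ImN, ReJ, ImJ).
Lemma complex_eq z w : complex.Re z = complex.Re w -> complex.Im z = complex.Im w -> z = w.
Proof. by case: z w => ? ? [? ?] /= -> ->. Qed.
Lemma ge0C z : (0 <= z) = (complex.Im z == 0) && (0 <= complex.Re z).
Proof. by rewrite lecE. Qed.
Lemma normcEE z : normc z = Num.sqrt (complex.Re z ^+ 2 + complex.Im z ^+ 2).
Proof. by case: z. Qed.
Lemma normc_ge0 z : 0 <= normc z.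
Proof. by rewrite normcEE sqrtr_ge0. Qed.
Lemma normc_sqrE z : normc z ^+ 2 = complex.Re z ^+ 2 + complex.Im z ^+ 2.
Proof. by rewrite normcEE sqr_sqrtr // addr_ge0 ?sqr_ge0. Qed.
Lemma Re_le_normc z : `|complex.Re z| <= normc z.
Proof. by rewrite normcEE -sqrtr_sqr ler_wsqrtr // lerDl sqr_ge0. Qed.
Lemma Im_le_normc z : `|complex.Im z| <= normc z.
Proof. by rewrite normcEE -sqrtr_sqr ler_wsqrtr // lerDr sqr_ge0. Qed.
Lemma normc_le z : normc z <= `|complex.Re z| + `|complex.Im z|.
Proof.
rewrite -(@ler_pXn2r _ 2) ?nnegrE ?normc_ge0 ?addr_ge0 // normc_sqrE sqrrD.
by rewrite !real_normK ?num_real // -addrA [_ *+ 2 + _]addrC addrA lerDl mulrn_wge0 // mulr_ge0.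
Qed.
Lemma normcR (t : R) : normc t%:C%C = `|t|.
Proof. by rewrite normcEE /= expr0n addr0 sqrtr_sqr. Qed.
Lemma normcJ z : normc (conjc z) = normc z.
Proof. by rewrite !normcEE ReJ ImJ sqrrN. Qed.
End complex_numbers.

Lemma star1 (R : realType) (A : starAlgType R) : star (1 : A) = 1.
Proof. by rewrite -[LHS]mulr1 -[X in _ * X]starK -starM mulr1 starK. Qed.

Section cstar_norm.
Variables (R : realType) (A : cstarAlgType R).
Implicit Types a b x y : A.
Local Notation normc := (@ComplexField.Normc.normc R).

Lemma star0 : star (0 : A) = 0.
Proof. by apply: (addrI (star (0 : A))); rewrite -starD !addr0. Qed.
Lemma starN a : star (- a) = - star a.
Proof. by apply: (addrI (star a)); rewrite -starD !subrr star0. Qed.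
Lemma starB a b : star (a - b) = star a - star b.
Proof. by rewrite starD starN. Qed.
Lemma star_sum (I : Type) (r : seq I) (F : I -> A) :
  star (\sum_(i <- r) F i) = \sum_(i <- r) star (F i).
Proof. by apply: (big_morph star starD star0). Qed.

Lemma cnorm0 : cnorm (0 : A) = 0.
Proof. by rewrite -(scale0r 0) cnormZ ComplexField.Normc.normc0 mul0r. Qed.
Lemma cnormN a : cnorm (- a) = cnorm a.
Proof.
by rewrite -scaleN1r cnormZ normcN ComplexField.Normc.normc1 mul1r.
Qed.
Lemma cnorm_ge0 a : 0 <= cnorm a.
Proof. by have := cnormD a (- a); rewrite subrr cnorm0 cnormN; lra. Qed.
Lemma cnormB a b : cnorm (a - b) <= cnorm a + cnorm b.
Proof. by rewrite -(cnormN b) cnormD. Qed.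
Lemma cnorm_distC a b : cnorm (a - b) = cnorm (b - a).
Proof. by rewrite -cnormN opprB. Qed.

(** Cancelling one factor in the C*-identity gives one inequality; applied to [a] and to [star a] it
    gives both. *)
Lemma cnorm_starE a : cnorm (star a) = cnorm a.
Proof.
have h b : cnorm b <= cnorm (star b).
  have := cnormM (star b) b; rewrite cnorm_star expr2.
  have [->|b0] := eqVneq (cnorm b) 0; first by rewrite cnorm_ge0.
  by rewrite ler_pM2r // lt_neqAle eq_sym b0 cnorm_ge0.
by apply/eqP; rewrite eq_le h andbT -{2}(starK a) h.
Qed.

Lemma cnorm_small_eq0 a (C : R) : (forall e, 0 < e -> cnorm a <= C * e) -> a = 0.
Proof.
move=> h; apply: cnorm0_eq0; apply/eqP; rewrite eq_le cnorm_ge0 andbT.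
apply/ler_addgt0Pr => e e0; rewrite add0r.
have C0 : 0 < `|C| + 1 by rewrite ltr_wpDl.
apply: (le_trans (h (e / (`|C| + 1)) _)); first by rewrite divr_gt0.
rewrite mulrCA ler_piMr ?(ltW e0) // ler_pdivrMr // mul1r.
by rewrite (le_trans (ler_norm _)) // lerDl.
Qed.

(* y = 1 - z, where z is the fixed point of z |-> (x + z^2) / 2, a contraction
   on the ball of radius 1 - sqrt (1 - |x|). *)
Lemma self_adjoint_sqrt x : star x = x -> cnorm x < 1 ->
  exists2 y, star y = y & y * y = 1 - x.
Proof.
move=> sx x1; set q := cnorm x in x1.
have q0 : 0 <= q := cnorm_ge0 x.
pose s := Num.sqrt (1 - q); have s0 : 0 < s by rewrite sqrtr_gt0 subr_gt0.
have s2 : s ^+ 2 = 1 - q by rewrite sqr_sqrtr // subr_ge0 ltW.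
have s1 : s <= 1 by nra.
pose r := 1 - s.
have r0 : 0 <= r by rewrite subr_ge0.
have r1 : r < 1 by rewrite ltrBlDr ltrDl.
(* [r] is the smaller root of r = (q + r^2) / 2, so [f] preserves the ball of radius [r], and by
   [fB] it contracts there with factor [r]. *)
have rE : 2^-1 * (q + r ^+ 2) = r by rewrite /r; nra.
pose h : R[i] := (2^-1)%:C%C.
have nh : normc h = 2^-1 by rewrite normcR ger0_norm // invr_ge0.
pose f y : A := h *: (x + y * y).
pose Y n := iter n f 0.
have fB y z : cnorm (f y - f z) <= 2^-1 * ((cnorm y + cnorm z) * cnorm (y - z)).
  rewrite -scalerBr cnormZ nh ler_pM2l ?invr_gt0 //.
  have -> : x + y * y - (x + z * z) = y * (y - z) + (y - z) * z.
    by rewrite mulrBr mulrBl addrA subrK opprD addrACA subrr add0r.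
  apply: le_trans (cnormD _ _) _; rewrite [leRHS]mulrDl lerD // ?cnormM //.
  by rewrite [leRHS]mulrC cnormM.
have Yr n : cnorm (Y n) <= r.
  elim: n => [|n ih]; first by rewrite cnorm0.
  rewrite /= cnormZ nh -[leRHS]rE ler_pM2l ?invr_gt0 //.
  rewrite (le_trans (cnormD _ _)) // lerD2l (le_trans (cnormM _ _)) //.
  by rewrite expr2 ler_pM // cnorm_ge0.
have Yc n k : cnorm (Y (n + k)%N - Y n) <= r ^+ n.
  elim: n => [|n ih]; first by rewrite add0n subr0 expr0 (le_trans (Yr _)) // ltW.
  apply: le_trans (fB _ _) _; rewrite exprS mulrA ler_pM ?cnorm_ge0 //.
    by rewrite mulr_ge0 ?addr_ge0 ?cnorm_ge0 // invr_ge0.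
  by rewrite -/(Y n) -/(Y (n + k)%N); have := Yr n; have := Yr (n + k)%N; lra.
have rn (e : R) : 0 < e -> exists N, forall n, (N <= n)%N -> r ^+ n < e.
  move=> e0; have rr : `|r| < 1 by rewrite ger0_norm.
  have /cvgrPdist_lt/(_ _ e0)[N _ hN] := cvg_expr rr.
  exists N => n Nn; have := hN n Nn.
  by rewrite /= sub0r normrN ger0_norm // exprn_ge0.
have cY (e : R) : 0 < e -> exists N : nat, forall m n : nat,
    (N <= m)%N -> (N <= n)%N -> cnorm (Y m - Y n) < e.
  move=> e0; have [|N hN] := rn (e / 2); first by rewrite divr_gt0.
  exists N => m n Nm Nn.
  rewrite -(subnKC Nm) -(subnKC Nn).
  have -> a b : a - b = a - Y N - (b - Y N) by rewrite opprB addrA subrK.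
  apply: (le_lt_trans (cnormB _ _)).
  have := Yc N (m - N)%N; have := Yc N (n - N)%N; have := hN N (leqnn N).
  by move=> a1 a2 a3; apply: (le_lt_trans (lerD a3 a2)); rewrite [ltRHS](splitr e) ltrD.
have [y yl] := cnorm_complete Y cY.
have yl' (e : R) : 0 < e -> exists n, cnorm (Y n - y) <= e /\ cnorm (Y n.+1 - y) <= e.
  move=> e0; have /cvgrPdist_lt/(_ _ e0)[N _ hN] := yl.
  have hh m : (N <= m)%N -> cnorm (Y m - y) <= e.
    by move=> /hN /=; rewrite sub0r normrN ger0_norm ?cnorm_ge0 // => /ltW.
  by exists N; split; apply: hh.
have sY n : star (Y n) = Y n.
  elim: n => [|n ih]; first exact: star0.
  rewrite /= /f starZ starD starM sx -/(Y n) ih; congr (_ *: _).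
  by rewrite conjc_real.
have sy : star y = y.
  apply/eqP; rewrite -subr_eq0; apply/eqP.
  apply: (@cnorm_small_eq0 _ 2) => e /yl'[n [hn _]].
  have -> : star y - y = star (y - Y n) + (Y n - y) by rewrite starB sY addrA subrK.
  rewrite (le_trans (cnormD _ _)) // cnorm_starE cnorm_distC.
  by rewrite mulr_natl mulr2n lerD.
have fy : y = f y.
  apply/eqP; rewrite -subr_eq0; apply/eqP.
  apply: (@cnorm_small_eq0 _ (1 + 2^-1 * (r + cnorm y))) => e /yl'[n [hn hn1]].
  have -> : y - f y = (y - Y n.+1) + (f (Y n) - f y) by rewrite addrA subrK.
  rewrite (le_trans (cnormD _ _)) // mulrDl mul1r lerD // 1?cnorm_distC //.
  rewrite (le_trans (fB _ _)) // -mulrA ler_pM2l ?invr_gt0 //.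
  by rewrite addrC cnorm_distC ler_pM ?cnorm_ge0 ?addr_ge0 ?cnorm_ge0 // lerD2r.
exists (1 - y); first by rewrite starB star1 sy.
have y2 : y + y = x + y * y.
  rewrite {1 2}fy /f -scalerDl.
  suff -> : h + h = 1 by rewrite scale1r.
  by apply: complex_eq; rewrite ?ReD ?ImD /=; lra.
have -> : x = y + y - y * y by rewrite y2 addrK.
rewrite mulrBr mulr1 mulrBl mul1r !opprB opprD.
by rewrite -addrA; congr (1 + _); rewrite addrCA.
Qed.

Implicit Types w : {scalar A}.

Lemma positive_one w : (forall a, 0 <= w (star a * a)) -> 0 <= w 1.
Proof. by move=> /(_ 1); rewrite star1 mulr1. Qed.

(** Both 1 - x and 1 + x are squares of self-adjoint elements, so [w] is nonnegative, in particular
    real, on each of them. *)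
Lemma positive_self_adjoint_lt1 w x : (forall a, 0 <= w (star a * a)) ->
  star x = x -> cnorm x < 1 ->
  complex.Im (w x) = 0 /\ `|complex.Re (w x)| <= complex.Re (w 1).
Proof.
move=> w0 sx x1; have := positive_one w0; rewrite ge0C => /andP[/eqP i1 _].
have [y sy yy] := self_adjoint_sqrt sx x1.
have [z sz zz] : exists2 z, star z = z & z * z = 1 - - x.
  by apply: self_adjoint_sqrt; rewrite ?starN ?sx ?cnormN.
have := w0 y; rewrite sy yy linearB ge0C ReD ImD ReN ImN => /andP[/eqP h1 h2].
have := w0 z; rewrite sz zz opprK linearD ge0C ReD ImD => /andP[/eqP h3 h4].
by split; [lra | rewrite ler_norml; apply/andP; split; lra].
Qed.

Lemma positive_self_adjoint w x : (forall a, 0 <= w (star a * a)) ->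
  star x = x ->
  complex.Im (w x) = 0 /\ `|complex.Re (w x)| <= complex.Re (w 1) * cnorm x.
Proof.
move=> w0 sx.
(* Any t strictly above the norm rescales x into the open unit ball; t then decreases to the
   norm. *)
have h (t : R) : cnorm x < t ->
    complex.Im (w x) = 0 /\ `|complex.Re (w x)| <= complex.Re (w 1) * t.
  move=> xt; have t0 : 0 < t := le_lt_trans (cnorm_ge0 x) xt.
  have [] := @positive_self_adjoint_lt1 w (t^-1%:C%C *: x) w0.
  - by rewrite starZ conjc_real sx.
  - by rewrite cnormZ normcR gtr0_norm ?invr_gt0 // mulrC ltr_pdivrMr // mul1r.
  rewrite linearZ /= ImM ReM /= !mul0r subr0 addr0 => /eqP.
  rewrite mulf_eq0 invr_eq0 gt_eqF //= => /eqP -> ; split=> //; move: b.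
  by rewrite normrM gtr0_norm ?invr_gt0 // mulrC ler_pdivrMr.
split; first by have [] := h (cnorm x + 1) (ltr_pwDr ltr01 (lexx _)).
apply/ler_addgt0Pr => e e0.
have := positive_one w0; rewrite ge0C => /andP[_ w1].
have C0 : 0 < complex.Re (w 1) + 1 by rewrite ltr_wpDl.
have [_ h1] := h (cnorm x + e / (complex.Re (w 1) + 1)) (ltr_pwDr (divr_gt0 e0 C0) (lexx _)).
apply: (le_trans h1); rewrite mulrDr lerD2l mulrA ler_pdivrMr // mulrC.
by rewrite ler_pM2l // lerDl.
Qed.

(** The elements a + star a and i (a - star a) are self-adjoint, hence have real values; these two
    equations are the real and imaginary parts of the claim. *)
Lemma positive_star w a : (forall a, 0 <= w (star a * a)) ->
  w (star a) = conjc (w a).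
Proof.
move=> w0.
have [|h1 _] := @positive_self_adjoint w (a + star a) w0.
  by rewrite starD starK addrC.
have [|h2 _] := @positive_self_adjoint w ('i%C *: (a - star a)) w0.
  rewrite starZ starB starK.
  have -> : (conjc 'i)%C = - 'i%C :> R[i] by apply: complex_eq => /=; rewrite ?oppr0.
  by rewrite scaleNr -scalerN opprB.
move: h1 h2; rewrite linearD linearZ linearB /= !ReImE /= => h1 h2.
by apply: complex_eq; rewrite ?ReJ ?ImJ; lra.
Qed.

(** A unimodular scalar rotates [w a] to a nonnegative real number; the self-adjoint part of the
    rotated element has the same value and no larger norm, which reduces the bound to the
    self-adjoint case. *)
Lemma positive_bound w a : (forall a, 0 <= w (star a * a)) ->
  normc (w a) <= complex.Re (w 1) * cnorm a.
Proof.
move=> w0; have [w1 _] : 0 <= complex.Re (w 1) /\ True.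
  by have := positive_one w0; rewrite ge0C => /andP[].
have [n0|n0] := eqVneq (normc (w a)) 0; first by rewrite n0 mulr_ge0 ?cnorm_ge0.
have ngt : 0 < normc (w a) by rewrite lt_neqAle eq_sym n0 normc_ge0.
pose c : R[i] := conjc (w a) * ((normc (w a))^-1)%:C%C.
have nc : normc c = 1.
  by rewrite ComplexField.Normc.normcM normcJ normcR gtr0_norm ?invr_gt0 // divff.
have cw : w (c *: a) = (normc (w a))%:C%C.
  rewrite linearZ /= /c; have := normc_sqrE (w a).
  move: n0; set n := normc (w a); case: (w a) => p q /= nn e.
  apply: complex_eq; rewrite !ReImE /= ?mulr0 ?subr0 ?addr0; last by ring.
  by apply: (mulIf nn); rewrite -expr2 e; field.
pose x := (2^-1)%:C%C *: (c *: a + star (c *: a)).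
have [|_ hx] := @positive_self_adjoint w x w0.
  by rewrite /x starZ conjc_real starD starK addrC.
have wx : w x = (normc (w a))%:C%C.
  rewrite /x linearZ linearD /= positive_star // cw conjc_real.
  by apply: complex_eq; rewrite !ReImE /=; lra.
move: hx; rewrite wx /= ger0_norm ?normc_ge0 // => /le_trans; apply.
rewrite ler_wpM2l // /x cnormZ normcR ger0_norm ?invr_ge0 //.
have := cnormD (c *: a) (star (c *: a)).
by rewrite cnorm_starE cnormZ nc mul1r; lra.
Qed.

Lemma state_bound w a : is_state w -> normc (w a) <= cnorm a.
Proof. by move=> [w0 w1]; have := positive_bound a w0; rewrite w1 mul1r. Qed.

(** Only Lipschitz bounds are asked of the two maps, so that integrals of fields of states, or b |->
    phi (k b), qualify without being packed as linear functionals. *)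
Lemma norm_dense_eq (S : set A) (w w' : A -> R[i]) (C : R) :
  norm_dense (linear_span S) ->
  (forall a b, normc (w a - w b) <= C * cnorm (a - b)) ->
  (forall a b, normc (w' a - w' b) <= C * cnorm (a - b)) ->
  (forall a, linear_span S a -> w a = w' a) -> w =1 w'.
Proof.
move=> dS wC wC' ww a; apply/eqP; rewrite -subr_eq0; apply/eqP.
apply: ComplexField.Normc.eq0_normc; apply/eqP; rewrite eq_le normc_ge0 andbT.
apply/ler_addgt0Pr => e e0; rewrite add0r.
have C1 : 0 < `|C| + 1 by rewrite ltr_wpDl.
have [s Ss as_] := dS a (e / 2 / (`|C| + 1)) (divr_gt0 (divr_gt0 e0 (ltr0n _ 2)) C1).
have h v : (forall a b, normc (v a - v b) <= C * cnorm (a - b)) -> normc (v a - v s) <= e / 2.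
  move=> vC; apply: (le_trans (vC _ _)).
  apply: (@le_trans _ _ ((`|C| + 1) * cnorm (a - s))).
    by rewrite ler_wpM2r ?cnorm_ge0 // (le_trans (ler_norm _)) // lerDl.
  by rewrite mulrC -ler_pdivlMr // ltW.
have -> : w a - w' a = (w a - w s) + - (w' a - w' s) by rewrite (ww s) // opprB addrA subrK.
rewrite (le_trans (le_normcD _ _)) // normcN [leRHS]splitr.
by rewrite lerD ?h.
Qed.

Lemma positive_dist w a b : (forall a, 0 <= w (star a * a)) ->
  normc (w a - w b) <= complex.Re (w 1) * cnorm (a - b).
Proof. by move=> w0; rewrite -linearB positive_bound. Qed.

Lemma eq_on_span (S : set A) w w' :
  (forall a, S a -> w a = w' a) -> forall a, linear_span S a -> w a = w' a.
Proof.
move=> ww a [n [c [s [Ss ->]]]]; rewrite !linear_sum /=; apply: eq_bigr => i _.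
by rewrite !linearZ /= ww.
Qed.

(** Equal values at 1 give the two functionals a common Lipschitz constant. *)
Lemma eq_positive (S : set A) w w' : norm_dense (linear_span S) ->
  (forall a, 0 <= w (star a * a)) -> (forall a, 0 <= w' (star a * a)) ->
  w 1 = w' 1 -> (forall a, S a -> w a = w' a) -> w =1 w'.
Proof.
move=> dS w0 w0' w1 /eq_on_span; apply: (norm_dense_eq dS) => a b; first exact: positive_dist.
by rewrite w1; exact: positive_dist.
Qed.
End cstar_norm.

(** * The C*-algebra of operators on a Hilbert space *)

(* A complex Hilbert space, encoded by the real part [hdot] of its inner product;
   [hdotZl] makes [hdot] the real part of a sesquilinear form. *)
Record hilbert (R : realType) := Hilbert {
  hilbert_sort :> lmodType R[i];
  hdot : hilbert_sort -> hilbert_sort -> R;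
  hdotC : forall x y, hdot x y = hdot y x;
  hdotDl : forall x y z, hdot (x + y) z = hdot x z + hdot y z;
  hdotRl : forall (t : R) x y, hdot (t%:C%C *: x) y = t * hdot x y;
  hdotZl : forall c x y, hdot (c *: x) y = hdot x (conjc c *: y);
  hdot_ge0 : forall x, 0 <= hdot x x;
  hdot_eq0 : forall x, hdot x x = 0 -> x = 0;
  hilbert_complete : forall s : nat -> hilbert_sort,
    (forall e : R, 0 < e -> exists N, forall m n, (N <= m)%N -> (N <= n)%N ->
       hdot (s m - s n) (s m - s n) < e) ->
    exists l, forall e : R, 0 < e -> exists N, forall n, (N <= n)%N ->
       hdot (s n - l) (s n - l) < e;
  hilbert_nontrivial : exists x : hilbert_sort, x <> 0
}.

Section hilbert_theory.
Variables (R : realType) (H : hilbert R).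
Implicit Types (x y z : H) (c : R[i]).
Local Notation normc := (@ComplexField.Normc.normc R).

Lemma hdotDr x y z : hdot x (y + z) = hdot x y + hdot x z.
Proof. by rewrite hdotC hdotDl !(hdotC x). Qed.
Lemma hdotRr (t : R) x y : hdot x (t%:C%C *: y) = t * hdot x y.
Proof. by rewrite hdotC hdotRl hdotC. Qed.
Lemma hdotNl x y : hdot (- x) y = - hdot x y.
Proof.
have -> : - x = (- 1)%:C%C *: x.
  have -> : ((- 1 : R))%:C%C = - 1 by apply: complex_eq => /=; rewrite ?oppr0.
  by rewrite scaleN1r.
by rewrite hdotRl mulN1r.
Qed.
Lemma hdotNr x y : hdot x (- y) = - hdot x y.
Proof. by rewrite hdotC hdotNl hdotC. Qed.
Lemma hdot0l y : hdot 0 y = 0.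
Proof. by rewrite -(subrr (0 : H)) hdotDl hdotNl subrr. Qed.
Lemma hdotBl x y z : hdot (x - y) z = hdot x z - hdot y z.
Proof. by rewrite hdotDl hdotNl. Qed.
Lemma hdotBr x y z : hdot x (y - z) = hdot x y - hdot x z.
Proof. by rewrite hdotDr hdotNr. Qed.

Lemma hdot_inj x y : (forall z, hdot x z = hdot y z) -> x = y.
Proof.
move=> h; apply/eqP; rewrite -subr_eq0; apply/eqP/hdot_eq0.
by rewrite hdotBl h subrr.
Qed.

Definition hnorm x := Num.sqrt (hdot x x).

Lemma hnorm_ge0 x : 0 <= hnorm x. Proof. exact: sqrtr_ge0. Qed.
Lemma sqr_hnorm x : hnorm x ^+ 2 = hdot x x.
Proof. by rewrite sqr_sqrtr ?hdot_ge0. Qed.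
Lemma hnorm0 : hnorm 0 = 0. Proof. by rewrite /hnorm hdot0l sqrtr0. Qed.
Lemma hnorm_eq0 x : hnorm x = 0 -> x = 0.
Proof. by move=> h; apply: hdot_eq0; rewrite -sqr_hnorm h expr0n. Qed.
Lemma hnormZ c x : hnorm (c *: x) = normc c * hnorm x.
Proof.
rewrite -[normc c]ger0_norm ?normc_ge0 // -sqrtr_sqr -sqrtrM ?sqr_ge0 //.
rewrite /hnorm hdotZl scalerA.
have -> : conjc c * c = (normc c ^+ 2)%:C%C.
  by rewrite normc_sqrE; apply: complex_eq; rewrite !ReImE /=; ring.
by rewrite hdotRr.
Qed.
Lemma hnormN x : hnorm (- x) = hnorm x.
Proof. by rewrite /hnorm hdotNl hdotNr opprK. Qed.

Lemma cauchy_schwarz x y : `|hdot x y| <= hnorm x * hnorm y.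
Proof.
rewrite -(@ler_pXn2r _ 2) ?nnegrE ?mulr_ge0 ?hnorm_ge0 // real_normK ?num_real //.
rewrite exprMn !sqr_hnorm.
have [y0|y0] := eqVneq (hdot y y) 0.
  by rewrite (hdot_eq0 y0) hdotC hdot0l expr0n mulr_ge0 ?hdot_ge0.
have yp : 0 < hdot y y by rewrite lt_neqAle eq_sym y0 hdot_ge0.
(* The component of x orthogonal to y, multiplied by the squared norm of y to avoid a division. *)
have := hdot_ge0 ((hdot y y)%:C%C *: x - (hdot x y)%:C%C *: y).
rewrite hdotBl !hdotBr !hdotRl !hdotRr (hdotC y x).
set a := hdot x y; set b := hdot y y in yp *; set d := hdot x x.
have -> : b * (b * d) - b * (a * a) - (a * (b * a) - a * (a * b)) = b * (d * b - a ^+ 2).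
  by ring.
by rewrite pmulr_rge0 // subr_ge0.
Qed.

Lemma hnormD x y : hnorm (x + y) <= hnorm x + hnorm y.
Proof.
rewrite -(@ler_pXn2r _ 2) ?nnegrE ?addr_ge0 ?hnorm_ge0 // sqrrD !sqr_hnorm.
rewrite hdotDl !hdotDr (hdotC y x).
have := le_trans (ler_norm _) (cauchy_schwarz x y).
by rewrite mulr2n; lra.
Qed.

Definition hcvg (s : nat -> H) l :=
  forall e : R, 0 < e -> exists N, forall n, (N <= n)%N -> hnorm (s n - l) < e.

Lemma hnorm_complete (s : nat -> H) :
  (forall e : R, 0 < e -> exists N, forall m n, (N <= m)%N -> (N <= n)%N ->
     hnorm (s m - s n) < e) -> exists l, hcvg s l.
Proof.
move=> cs; have [e e0|l hl] := @hilbert_complete _ H s.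
  have [|N hN] := cs (Num.sqrt e); first by rewrite sqrtr_gt0.
  by exists N => m n Nm Nn; rewrite -ltr_sqrt // hN.
exists l => e e0; have [|N hN] := hl (e ^+ 2); first by rewrite exprn_gt0.
exists N => n Nn; rewrite -[e]gtr0_norm // -sqrtr_sqr /hnorm.
by rewrite ltr_sqrt ?exprn_gt0 // hN.
Qed.

Lemma hnorm_small_eq x y (C : R) :
  (forall e, 0 < e -> hnorm (x - y) <= C * e) -> x = y.
Proof.
move=> h; apply/eqP; rewrite -subr_eq0; apply/eqP/hnorm_eq0/eqP.
rewrite eq_le hnorm_ge0 andbT; apply/ler_addgt0Pr => e e0; rewrite add0r.
have C0 : 0 < `|C| + 1 by rewrite ltr_wpDl.
apply: (le_trans (h (e / (`|C| + 1)) _)); first by rewrite divr_gt0.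
rewrite mulrCA ler_piMr ?(ltW e0) // ler_pdivrMr // mul1r.
by rewrite (le_trans (ler_norm _)) // lerDl.
Qed.

(** Adjointness for the real form [hdot] yields additivity ([operatorD]) but only real homogeneity,
    hence the separate clause for complex scalars. *)
Definition is_operator (f f' : H -> H) :=
  [/\ forall x y, hdot (f x) y = hdot x (f' y),
      forall c x, f (c *: x) = c *: f x
    & exists C, forall x, hnorm (f x) <= C * hnorm x].

Lemma operator_bound_ge0 f f' : is_operator f f' ->
  exists2 C, 0 <= C & forall x, hnorm (f x) <= C * hnorm x.
Proof.
move=> [_ _ [C hC]]; exists `|C| => // x; rewrite (le_trans (hC x)) //.
by rewrite ler_wpM2r ?hnorm_ge0 // ler_norm.
Qed.

(** The bound follows from |f' x|^2 = <x, f (f' x)> <= C |x| |f' x|; homogeneity is obtained by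
    pairing with an arbitrary vector and using that of [f]. *)
Lemma operator_adj f f' : is_operator f f' -> is_operator f' f.
Proof.
move=> opf; have [C C0 hC] := operator_bound_ge0 opf; case: opf => adj lin _.
have adj' x y : hdot (f' x) y = hdot x (f y) by rewrite hdotC -adj hdotC.
split=> //.
  by move=> c x; apply: hdot_inj => z; rewrite adj' hdotZl -lin hdotZl adj'.
exists C => x; have [->|n0] := eqVneq (hnorm (f' x)) 0; first by rewrite mulr_ge0 ?hnorm_ge0.
have np : 0 < hnorm (f' x) by rewrite lt_neqAle eq_sym n0 hnorm_ge0.
rewrite -(ler_pM2r np) -expr2 sqr_hnorm adj'.
rewrite (le_trans (ler_norm _)) // (le_trans (cauchy_schwarz _ _)) //.
by rewrite [leRHS]mulrAC mulrC ler_wpM2r ?hnorm_ge0.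
Qed.

Lemma operatorD f f' : is_operator f f' -> {morph f : x y / x + y}.
Proof.
by move=> [adj _ _] x y; apply: hdot_inj => z; rewrite adj !hdotDl !adj.
Qed.
End hilbert_theory.

(* The adjoint is part of the data, so that the Riesz lemma for Hilbert spaces is
   not needed. *)
Record operator (R : realType) (H : hilbert R) := Operator {
  op_fun :> H -> H;
  op_adj : H -> H;
  op_axiom : is_operator op_fun op_adj }.

Section operator_algebra.
Variables (R : realType) (H : hilbert R).
Local Notation L := (operator H).
Implicit Types (S T U : operator H) (x y z : H) (c : R[i]).
Local Notation normc := (@ComplexField.Normc.normc R).

HB.instance Definition _ := gen_eqMixin (operator H).
HB.instance Definition _ := gen_choiceMixin (operator H).

(** The form [hdot] separates vectors, so the map determines the adjoint stored with it. *)
Lemma op_eqP S T : (forall x, S x = T x) -> S = T.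
Proof.
move=> ST; case: S T ST => f f' hf [g g' hg] /= /funext fg.
move: hf; rewrite {f}fg => hf.
have fg' : f' = g'.
  apply/funext => y; apply: hdot_inj => x; rewrite hdotC (hdotC (g' y)).
  by case: hf hg => <- _ _ [<- _ _].
by move: hf; rewrite fg' => hf; congr Operator; exact: Prop_irrelevance.
Qed.

Lemma op_adjE S x y : hdot (S x) y = hdot x (op_adj S y).
Proof. by case: (op_axiom S). Qed.
Lemma opZ S c x : S (c *: x) = c *: S x.
Proof. by case: (op_axiom S). Qed.
Lemma opD S : {morph S : x y / x + y}.
Proof. exact: operatorD (op_axiom S). Qed.

Lemma op_zero_subproof : is_operator (fun _ : H => 0) (fun _ : H => 0).
Proof.
split=> [x y|c x|]; first by rewrite hdot0l hdotC hdot0l.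
  by rewrite scaler0.
by exists 0 => x; rewrite hnorm0 mul0r.
Qed.
Lemma op_one_subproof : is_operator (id : H -> H) id.
Proof. by split=> //; exists 1 => x; rewrite mul1r. Qed.
Lemma op_add_subproof S T : is_operator (fun x => S x + T x) (fun x => op_adj S x + op_adj T x).
Proof.
have [C C0 hC] := operator_bound_ge0 (op_axiom S).
have [D D0 hD] := operator_bound_ge0 (op_axiom T).
split=> [x y|c x|]; first by rewrite hdotDl hdotDr !op_adjE.
  by rewrite scalerDr !opZ.
by exists (C + D) => x; rewrite mulrDl (le_trans (hnormD _ _)) // lerD.
Qed.
Lemma op_scale_subproof c S : is_operator (fun x => c *: S x) (fun x => conjc c *: op_adj S x).
Proof.
have [C C0 hC] := operator_bound_ge0 (op_axiom S).
have [_ az _] := operator_adj (op_axiom S).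
split=> [x y|d x|]; first by rewrite hdotZl op_adjE az.
  by rewrite opZ !scalerA mulrC.
by exists (normc c * C) => x; rewrite hnormZ -mulrA ler_wpM2l ?normc_ge0.
Qed.
Lemma op_mul_subproof S T : is_operator (fun x => S (T x)) (fun x => op_adj T (op_adj S x)).
Proof.
have [C C0 hC] := operator_bound_ge0 (op_axiom S).
have [D D0 hD] := operator_bound_ge0 (op_axiom T).
split=> [x y|d x|]; first by rewrite !op_adjE.
  by rewrite !opZ.
by exists (C * D) => x; rewrite (le_trans (hC _)) // -mulrA ler_wpM2l.
Qed.

Definition op_zero := Operator op_zero_subproof.
Definition op_one := Operator op_one_subproof.
Definition op_add S T := Operator (op_add_subproof S T).
Definition op_scale c S := Operator (op_scale_subproof c S).
Definition op_opp S := op_scale (-1) S.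
Definition op_mul S T := Operator (op_mul_subproof S T).
Definition op_star S := Operator (operator_adj (op_axiom S)).

Fact op_addA : associative op_add.
Proof. by move=> S T U; apply: op_eqP => x; apply: addrA. Qed.
Fact op_addC : commutative op_add.
Proof. by move=> S T; apply: op_eqP => x; apply: addrC. Qed.
Fact op_add0 : left_id op_zero op_add.
Proof. by move=> S; apply: op_eqP => x; apply: add0r. Qed.
Fact op_addN : left_inverse op_zero op_opp op_add.
Proof. by move=> S; apply: op_eqP => x /=; rewrite scaleN1r addNr. Qed.
HB.instance Definition _ :=
  GRing.isZmodule.Build (operator H) op_addA op_addC op_add0 op_addN.

Fact op_mulA : associative op_mul.
Proof. by move=> S T U; apply: op_eqP. Qed.
Fact op_mul1l : left_id op_one op_mul.
Proof. by move=> S; apply: op_eqP. Qed.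
Fact op_mul1r : right_id op_one op_mul.
Proof. by move=> S; apply: op_eqP. Qed.
Fact op_mulDl : left_distributive op_mul +%R.
Proof. by move=> S T U; apply: op_eqP. Qed.
Fact op_mulDr : right_distributive op_mul +%R.
Proof. by move=> S T U; apply: op_eqP => x; apply: opD. Qed.
Fact op_oner_neq0 : op_one != 0.
Proof.
have [x x0] := hilbert_nontrivial H; apply/eqP => /(congr1 (fun S : L => S x)).
exact: x0.
Qed.
HB.instance Definition _ := GRing.Zmodule_isNzRing.Build (operator H)
  op_mulA op_mul1l op_mul1r op_mulDl op_mulDr op_oner_neq0.

Fact op_scaleA c d S : op_scale c (op_scale d S) = op_scale (c * d) S.
Proof. by apply: op_eqP => x; apply: scalerA. Qed.
Fact op_scale1 : left_id 1 op_scale.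
Proof. by move=> S; apply: op_eqP => x; apply: scale1r. Qed.
Fact op_scaleDr : right_distributive op_scale +%R.
Proof. by move=> c S T; apply: op_eqP => x; apply: scalerDr. Qed.
Fact op_scaleDl S : {morph op_scale^~ S : c d / c + d}.
Proof. by move=> c d; apply: op_eqP => x; apply: scalerDl. Qed.
HB.instance Definition _ := GRing.Zmodule_isLmodule.Build R[i] (operator H)
  op_scaleA op_scale1 op_scaleDr op_scaleDl.
Fact op_scaleAl c S T : c *: (S * T) = (c *: S) * T.
Proof. by apply: op_eqP. Qed.
HB.instance Definition _ :=
  GRing.Lmodule_isLalgebra.Build R[i] (operator H) op_scaleAl.
Fact op_scaleAr c S T : c *: (S * T) = S * (c *: T).
Proof. by apply: op_eqP => x /=; rewrite -opZ. Qed.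
HB.instance Definition _ :=
  GRing.Lalgebra_isAlgebra.Build R[i] (operator H) op_scaleAr.

Fact op_starK : involutive op_star.
Proof. by move=> S; apply: op_eqP. Qed.
Fact op_starD : {morph op_star : S T / S + T}.
Proof. by move=> S T; apply: op_eqP. Qed.
Fact op_starZ c S : op_star (c *: S) = conjc c *: op_star S.
Proof. by apply: op_eqP. Qed.
Fact op_starM S T : op_star (S * T) = op_star T * op_star S.
Proof. by apply: op_eqP. Qed.
HB.instance Definition _ :=
  hasStar.Build R (operator H) op_starK op_starD op_starZ op_starM.

Definition op_norm S := sup [set hnorm (S x) | x in [set x | hnorm x <= 1]].

Lemma op_norm_le S C : 0 <= C -> (forall x, hnorm (S x) <= C * hnorm x) -> op_norm S <= C.
Proof.
move=> C0 hC; apply: ge_sup.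
  by exists (hnorm (S 0)); exists 0 => //=; rewrite hnorm0.
move=> _ [x /= x1 <-]; rewrite (le_trans (hC _)) //.
by rewrite -[leRHS]mulr1 ler_wpM2l.
Qed.

Lemma op_norm_ub S x : hnorm x <= 1 -> hnorm (S x) <= op_norm S.
Proof.
have [C C0 hC] := operator_bound_ge0 (op_axiom S).
move=> x1; apply: ub_le_sup; last by exists x.
exists C => _ [y /= y1 <-]; rewrite (le_trans (hC _)) //.
by rewrite -[leRHS]mulr1 ler_wpM2l.
Qed.

Lemma op_norm_ge0 S : 0 <= op_norm S.
Proof. by rewrite (le_trans (hnorm_ge0 _) (@op_norm_ub S 0 _)) // hnorm0. Qed.

Lemma op_normP S x : hnorm (S x) <= op_norm S * hnorm x.
Proof.
have [/hnorm_eq0 ->|n0] := eqVneq (hnorm x) 0.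
  have -> : S 0 = 0 by have := opZ S 0 0; rewrite !scale0r.
  by rewrite hnorm0 mulr0.
have np : 0 < hnorm x by rewrite lt_neqAle eq_sym n0 hnorm_ge0.
have := @op_norm_ub S ((hnorm x)^-1%:C%C *: x).
rewrite opZ !hnormZ normcR gtr0_norm ?invr_gt0 // mulVf // => /(_ (lexx _)).
by rewrite mulrC ler_pdivrMr.
Qed.

Fact op_normD S T : op_norm (S + T) <= op_norm S + op_norm T.
Proof.
apply: op_norm_le => [|x]; first by rewrite addr_ge0 ?op_norm_ge0.
by rewrite mulrDl (le_trans (hnormD _ _)) // lerD ?op_normP.
Qed.

Fact op_norm_star_le S : op_norm (op_star S) <= op_norm S.
Proof.
apply: op_norm_le => [|x]; first exact: op_norm_ge0.
set y := op_star S x.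
have [->|n0] := eqVneq (hnorm y) 0; first by rewrite mulr_ge0 ?hnorm_ge0 ?op_norm_ge0.
have np : 0 < hnorm y by rewrite lt_neqAle eq_sym n0 hnorm_ge0.
have yy : hdot y y = hdot (S y) x by rewrite op_adjE.
rewrite -(ler_pM2r np) -expr2 sqr_hnorm yy.
rewrite (le_trans (ler_norm _)) // (le_trans (cauchy_schwarz _ _)) //.
by rewrite [leRHS]mulrAC ler_wpM2r ?hnorm_ge0 ?op_normP.
Qed.

Fact op_normM S T : op_norm (S * T) <= op_norm S * op_norm T.
Proof.
apply: op_norm_le => [|x]; first by rewrite mulr_ge0 ?op_norm_ge0.
by rewrite (le_trans (op_normP S (T x))) // -mulrA ler_wpM2l ?op_normP ?op_norm_ge0.
Qed.

Fact op_normZ c S : op_norm (c *: S) = normc c * op_norm S.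
Proof.
have le d T : op_norm (d *: T) <= normc d * op_norm T.
  apply: op_norm_le => [|x]; first by rewrite mulr_ge0 ?op_norm_ge0 ?normc_ge0.
  by rewrite hnormZ -mulrA ler_wpM2l ?normc_ge0 ?op_normP.
apply/eqP; rewrite eq_le le /=; have [->|c0] := eqVneq c 0.
  by rewrite ComplexField.Normc.normc0 mul0r op_norm_ge0.
have := le c^-1 (c *: S); rewrite scalerA mulVf // scale1r ComplexField.Normc.normcV.
have n0 : 0 < normc c.
  rewrite lt_neqAle normc_ge0 andbT eq_sym; apply: contra c0 => /eqP h.
  by apply/eqP/ComplexField.Normc.eq0_normc.
by rewrite [X in _ <= X -> _]mulrC ler_pdivlMr // mulrC.
Qed.

Fact op_norm_eq0 S : op_norm S = 0 -> S = 0.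
Proof.
move=> S0; apply: op_eqP => x; apply: hnorm_eq0; apply/eqP.
by rewrite eq_le hnorm_ge0 andbT (le_trans (op_normP _ _)) // S0 mul0r.
Qed.

(** The nontrivial inequality comes from |S x|^2 = <x, star S (S x)> and Cauchy-Schwarz. *)
Fact op_norm_starM S : op_norm (star S * S) = op_norm S ^+ 2.
Proof.
apply/eqP; rewrite eq_le; apply/andP; split.
  by rewrite (le_trans (op_normM _ _)) // expr2 ler_wpM2r ?op_norm_ge0 ?op_norm_star_le.
rewrite -ler_sqrt ?op_norm_ge0 // sqrtr_sqr ger0_norm ?op_norm_ge0 //.
apply: op_norm_le => [|x]; first exact: sqrtr_ge0.
rewrite -(@ler_pXn2r _ 2) ?nnegrE ?mulr_ge0 ?hnorm_ge0 ?sqrtr_ge0 //.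
rewrite sqr_hnorm exprMn (sqr_sqrtr (op_norm_ge0 _)) op_adjE.
rewrite (le_trans (ler_norm _)) // (le_trans (cauchy_schwarz _ _)) //.
rewrite expr2 mulrA mulrC ler_wpM2r ?hnorm_ge0 //.
exact: (op_normP (star S * S) x).
Qed.

Fact op_norm_complete (s : nat -> operator H) :
  (forall e : R, 0 < e -> exists N : nat, forall m n : nat,
     (N <= m)%N -> (N <= n)%N -> op_norm (s m - s n) < e) ->
  exists l, op_norm (s n - l) @[n --> \oo] --> (0 : R).
Proof.
move=> cs.
have lim (t : nat -> operator H) : (forall e : R, 0 < e -> exists N : nat, forall m n : nat,
    (N <= m)%N -> (N <= n)%N -> op_norm (t m - t n) < e) ->
    {l | forall x, hcvg (fun n => t n x) (l x)}.
  move=> ct; apply: cid.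
  have h x : exists l, hcvg (fun n => t n x) l.
    apply: hnorm_complete => e e0.
    have n0 : 0 < hnorm x + 1 by rewrite ltr_wpDl ?hnorm_ge0.
    have [|N hN] := ct (e / (hnorm x + 1)); first by rewrite divr_gt0.
    exists N => m n Nm Nn.
    have -> : t m x - t n x = (t m - t n) x by rewrite /= scaleN1r.
    apply: (le_lt_trans (op_normP _ _)).
    have := hN m n Nm Nn; rewrite ltr_pdivlMr //; apply: le_lt_trans.
    by rewrite ler_wpM2l ?op_norm_ge0 // lerDl.
  by exists (fun x => sval (cid (h x))) => x; case: cid.
have [l hl] := lim s cs.
(* Taking adjoints does not increase the norm, so the adjoints form a Cauchy sequence as well; its
   pointwise limit is the adjoint to be stored with [l]. *)
have [|l' hl'] := lim (fun n => op_star (s n)).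
  move=> e /cs[N hN]; exists N => m n Nm Nn.
  have -> : op_star (s m) - op_star (s n) = op_star (s m - s n) by apply: op_eqP => z /=; congr (_ + _ *: _); apply: complex_eq; rewrite /= ?oppr0.
  exact: le_lt_trans (op_norm_star_le _) (hN _ _ Nm Nn).
(* The Cauchy estimate controls s n - s k uniformly in x, and k is pushed out until s k x - l x is
   negligible at the given x. *)
have close e : 0 < e -> exists N, forall n, (N <= n)%N -> forall x, hnorm (s n x - l x) <= e * hnorm x.
  move=> e0; have [N hN] := cs e e0; exists N => n Nn x.
  apply/ler_addgt0Pr => d d0; have [M hM] := hl x d d0.
  have := hM (maxn M N) (leq_maxl _ _); have := hN _ _ Nn (leq_maxr M N).
  set k := maxn M N => h1 h2.
  have -> : s n x - l x = (s n - s k) x + (s k x - l x).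
    by rewrite /= scaleN1r addrA subrK.
  rewrite (le_trans (hnormD _ _)) // lerD ?(ltW h2) // (le_trans (op_normP _ _)) //.
  by rewrite ler_wpM2r ?hnorm_ge0 // ltW.
have opl : is_operator l l'.
  split=> [x y|c x|].
  - apply/eqP; rewrite -subr_eq0 -normr_eq0 eq_le normr_ge0 andbT.
    apply/ler_addgt0Pr => e e0; rewrite add0r.
    have C0 : 0 < hnorm x + hnorm y + 1 by rewrite ltr_wpDl ?addr_ge0 ?hnorm_ge0.
    pose d := e / (hnorm x + hnorm y + 1); have d0 : 0 < d by rewrite divr_gt0.
    have [M hM] := hl x d d0; have [N hN] := hl' y d d0.
    have := hM _ (leq_maxl M N); have := hN _ (leq_maxr M N).
    set k := maxn M N => h1 h2.
    have -> : hdot (l x) y - hdot x (l' y) =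
        hdot x (op_star (s k) y - l' y) - hdot (s k x - l x) y.
      by rewrite hdotBr hdotBl (op_adjE (s k)) /=; ring.
    rewrite (le_trans (ler_normB _ _)) //.
    apply: (@le_trans _ _ (hnorm x * d + d * hnorm y)).
      rewrite lerD // (le_trans (cauchy_schwarz _ _)) //.
        by rewrite ler_wpM2l ?hnorm_ge0 // ltW.
      by rewrite ler_wpM2r ?hnorm_ge0 // ltW.
    rewrite mulrC -mulrDr /d mulrAC ler_pdivrMr // ler_wpM2l ?(ltW e0) //.
    by rewrite lerDl.
  - apply: (@hnorm_small_eq _ _ _ _ (1 + normc c)) => e e0.
    have [M hM] := hl x e e0; have [N hN] := hl (c *: x) e e0.
    have := hM _ (leq_maxl M N); have := hN _ (leq_maxr M N).
    set k := maxn M N => h1 h2.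
    have -> : l (c *: x) - c *: l x = c *: (s k x - l x) - (s k (c *: x) - l (c *: x)).
      by rewrite scalerBr opZ opprB [RHS]addrC addrA subrK.
    rewrite (le_trans (hnormD _ _)) // hnormN hnormZ mulrDl mul1r addrC lerD ?(ltW h1) //.
    by rewrite ler_wpM2l ?normc_ge0 // ltW.
  - have [N hN] := close 1 ltr01; exists (op_norm (s N) + 1) => x.
    have -> : l x = s N x - (s N x - l x) by rewrite opprB addrC subrK.
    rewrite (le_trans (hnormD _ _)) // hnormN mulrDl lerD ?op_normP //.
    exact: hN.
exists (Operator opl); apply/cvgrPdist_le => e e0.
have [N hN] := close e e0; exists N => // n Nn.
rewrite /= sub0r normrN ger0_norm ?op_norm_ge0 //.
apply: op_norm_le => [|x]; first exact: ltW.
by rewrite /= scaleN1r hN.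
Qed.

HB.instance Definition _ := isCStar.Build R (operator H) op_normD op_normZ
  op_norm_eq0 op_normM op_norm_starM op_norm_complete.
End operator_algebra.

(** * Reproducing kernel Hilbert spaces *)

Section jordan_von_neumann.
Variables (R : realType) (V : lmodType R[i]) (Q : V -> R).
Local Notation normc := (@ComplexField.Normc.normc R).
Hypothesis Q_ge0 : forall x, 0 <= Q x.
Hypothesis QZ : forall c x, Q (c *: x) = normc c ^+ 2 * Q x.
Hypothesis Q_par : forall x y, Q (x + y) + Q (x - y) = 2 * Q x + 2 * Q y.
Implicit Types x y z : V.

(** The real part of the inner product with squared norm [Q]. The norm of the kernel space below is
    a supremum, for which the parallelogram law is within reach while bilinearity is not directly
    visible. *)
Definition polar x y := 4^-1 * (Q (x + y) - Q (x - y)).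

Lemma QN x : Q (- x) = Q x.
Proof.
by rewrite -scaleN1r QZ normcN ComplexField.Normc.normc1 expr1n mul1r.
Qed.

Lemma polarC x y : polar x y = polar y x.
Proof. by rewrite /polar (addrC x y) -(QN (x - y)) opprB. Qed.

(** A linear combination of four parallelogram identities, for the pairs x + z, y and y + z, x and
    the same pairs with -z. *)
Lemma polarDl x y z : polar (x + y) z = polar x z + polar y z.
Proof.
have h1 := Q_par (x + z) y; have h2 := Q_par (y + z) x.
have h3 := Q_par (x - z) y; have h4 := Q_par (y - z) x.
have e1 : Q (x - z - y) = Q (y + z - x) by rewrite -QN !opprB addrA.
have e2 : Q (y - z - x) = Q (x + z - y) by rewrite -QN !opprB addrA.
have e3 : x + z + y = x + y + z by rewrite addrAC.
have e4 : y + z + x = x + y + z by rewrite addrC addrA.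
have e5 : x - z + y = x + y - z by rewrite addrAC.
have e6 : y - z + x = x + y - z by rewrite addrC addrA.
rewrite e1 e5 in h3; rewrite e2 e6 in h4; rewrite e3 in h1; rewrite e4 in h2.
by rewrite /polar; lra.
Qed.

Lemma polar0l y : polar 0 y = 0.
Proof. by rewrite /polar add0r sub0r QN subrr mulr0. Qed.

Lemma polarxx x : polar x x = Q x.
Proof.
have Q0 : Q 0 = 0.
  by have := QZ 0 0; rewrite scale0r ComplexField.Normc.normc0 expr0n mul0r.
rewrite /polar subrr Q0 subr0.
have -> : x + x = (2 : R)%:C%C *: x.
  have -> : (2 : R)%:C%C = 1 + 1 by apply: complex_eq => /=; lra.
  by rewrite scalerDl scale1r.
by rewrite QZ normcR ger0_norm //; lra.
Qed.

(** A crude bound, but it makes t |-> polar (t x) y bounded on |t| <= 1, which turns additivity into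
    real linearity. *)
Lemma polar_bound x y : `|polar x y| <= Q x + Q y.
Proof.
have := Q_par x y; have := Q_ge0 (x + y); have := Q_ge0 (x - y).
by rewrite /polar => *; rewrite ler_norml; apply/andP; split; lra.
Qed.

(** The deviation f t - t f 1 is additive and vanishes at the integers, so its values are those at
    fractional parts and are bounded; an additive function that is bounded everywhere is zero. *)
Lemma additive_bounded_linear (f : R -> R) (C : R) : {morph f : s t / s + t} ->
  (forall t, `|t| <= 1 -> `|f t| <= C) -> forall t, f t = t * f 1.
Proof.
move=> fD fC.
have f0 : f 0 = 0 by apply: (addrI (f 0)); rewrite -fD !addr0.
have fN t : f (- t) = - f t by apply/eqP; rewrite -addr_eq0 -fD addNr f0.
have fM n t : f (n%:R * t) = n%:R * f t.
  elim: n => [|n ih]; first by rewrite !mul0r f0.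
  by rewrite -natr1 !mulrDl !mul1r fD ih.
have fZ (z : int) : f z%:~R = z%:~R * f 1.
  case: z => n; first by rewrite -pmulrn; have := fM n 1; rewrite mulr1.
  by rewrite NegzE mulrNz fN -pmulrn mulNr; have := fM n.+1 1; rewrite mulr1 => ->.
have C0 : 0 <= C by rewrite (le_trans (normr_ge0 (f 0))) // fC // normr0.
move=> t; pose D := C + `|f 1|.
have gD s : `|f s - s * f 1| <= D.
  have -> : f s - s * f 1 = f (s - (Num.floor s)%:~R) - (s - (Num.floor s)%:~R) * f 1.
    by rewrite fD fN fZ; ring.
  have /andP[h1 h2] := floor_itv s.
  have h : `|s - (Num.floor s)%:~R| <= 1.
    by rewrite ger0_norm ?subr_ge0 // lerBlDl ltW // -intrD1.
  rewrite (le_trans (ler_normB _ _)) // lerD ?fC // normrM.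
  by rewrite -[leRHS]mul1r ler_wpM2r.
apply/eqP; rewrite -subr_eq0; apply/negPn/negP => n0.
set e := f t - t * f 1 in n0.
have e0 : 0 < `|e| by rewrite normr_gt0.
have [n hn] : exists n : nat, D < n%:R * `|e|.
  exists (Num.bound (D / `|e|)); rewrite -ltr_pdivrMr //.
  by apply: archi_boundP; rewrite divr_ge0 // addr_ge0.
have := gD (n%:R * t); rewrite fM -mulrA -mulrBr normrM normr_nat.
by rewrite leNgt hn.
Qed.

Lemma polarRl (t : R) x y : polar (t%:C%C *: x) y = t * polar x y.
Proof.
rewrite (@additive_bounded_linear (fun t => polar (t%:C%C *: x) y) (Q x + Q y)).
- by rewrite scale1r.
- by move=> s u; rewrite rmorphD /= scalerDl polarDl.
- move=> s s1; rewrite (le_trans (polar_bound _ _)) // lerD2r QZ normcR.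
  by rewrite ler_piMl // expr_le1.
Qed.

(** Write c = |c| u. The real factor comes out by [polarRl], and [Q] is invariant under the
    unimodular u, whose inverse is its conjugate. *)
Lemma polarZl c x y : polar (c *: x) y = polar x (conjc c *: y).
Proof.
have [->|c0] := eqVneq c 0.
  by rewrite conjc0 !scale0r polar0l polarC polar0l.
have n0 : normc c != 0.
  by apply: contra c0 => /eqP/ComplexField.Normc.eq0_normc ->.
pose u := ((normc c)^-1)%:C%C * c.
have cu : c = (normc c)%:C%C * u.
  by rewrite /u mulrA -rmorphM /= divff // mul1r.
have nu : normc u = 1.
  by rewrite ComplexField.Normc.normcM normcR ger0_norm ?invr_ge0 ?normc_ge0 // mulVf.
have uu : u * conjc u = 1.
  by apply: complex_eq; have := normc_sqrE u; rewrite nu expr1n !ReImE /= => h; [rewrite h|]; ring.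
have cc : conjc c = (normc c)%:C%C * conjc u.
  by rewrite {1}cu conjcM conjc_real.
have -> : polar (c *: x) y = normc c * polar (u *: x) y.
  by rewrite {1}cu -scalerA polarRl.
have -> : polar x (conjc c *: y) = normc c * polar x (conjc u *: y).
  by rewrite cc -scalerA polarC polarRl polarC.
congr (_ * _).
have h w : Q (u *: x + w) = Q (x + conjc u *: w).
  have -> : u *: x + w = u *: (x + conjc u *: w) by rewrite scalerDr scalerA uu scale1r.
  by rewrite QZ nu expr1n mul1r.
by rewrite /polar h (h (- y)) scalerN.
Qed.
End jordan_von_neumann.

Section kernel_space.
Variables (R : realType) (S : Type) (K : S -> S -> R[i]).
Implicit Types (c d e : seq (R[i] * S)) (h k : S -> R[i]^o) (a : R[i]).
Local Notation normc := (@ComplexField.Normc.normc R).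

(** By the reproducing property ([rdot_kvec]) this is the inner product of h with the combination of
    kernel functions coded by [c], antilinear in [c]. It involves finitely many values of h, hence
    is continuous under pointwise convergence. *)
Definition pairing c h : R[i] := \sum_(p <- c) conjc p.1 * h p.2.
Definition kfun c : S -> R[i]^o := fun s => \sum_(p <- c) p.1 * K s p.2.
Definition scale_comb a c := [seq (a * p.1, p.2) | p <- c].
Definition ksqr c := complex.Re (pairing c (kfun c)).
Definition positive_kernel := forall c, 0 <= pairing c (kfun c).

Lemma pairing_cat c d h : pairing (c ++ d) h = pairing c h + pairing d h.
Proof. by rewrite /pairing big_cat. Qed.
Lemma pairingD c h k : pairing c (h + k) = pairing c h + pairing c k.
Proof. by rewrite /pairing -big_split /=; apply: eq_bigr => p _; rewrite mulrDr. Qed.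
Lemma pairingZ c a h : pairing c (a *: h) = a * pairing c h.
Proof. by rewrite /pairing big_distrr /=; apply: eq_bigr => p _; rewrite mulrCA. Qed.
Lemma pairingB c h k : pairing c (h - k) = pairing c h - pairing c k.
Proof. by rewrite -scaleN1r pairingD pairingZ mulN1r. Qed.
Lemma pairing_scale a c h : pairing (scale_comb a c) h = conjc a * pairing c h.
Proof.
rewrite /pairing big_map big_distrr /=; apply: eq_bigr => p _.
by rewrite conjcM mulrA.
Qed.
Lemma kfun_cat c d : kfun (c ++ d) = kfun c + kfun d.
Proof. by apply/funext => s; rewrite /kfun big_cat. Qed.
Lemma kfun_scale a c : kfun (scale_comb a c) = a *: kfun c.
Proof.
apply/funext => s; rewrite /kfun big_map /= [RHS]big_distrr /=.
by apply: eq_bigr => p _; rewrite mulrA.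
Qed.

Hypothesis K0 : positive_kernel.

Lemma kernel_herm s t : K t s = conjc (K s t).
Proof.
have h a b : 0 <= conjc a * (a * K s s + b * K s t) + conjc b * (a * K t s + b * K t t).
  have := K0 [:: (a, s); (b, t)].
  by rewrite /pairing /kfun !big_cons !big_nil /= !addr0.
(* The coefficients (1, 0), (0, 1), (1, 1) and (1, i) already force Hermitian symmetry. *)
have := h 1 0; have := h 0 1; have := h 1 1; have := h 1 'i%C.
rewrite !ge0C => /andP[/eqP + _] /andP[/eqP + _] /andP[/eqP + _] /andP[/eqP + _].
by rewrite !ReImE /= => h1 h2 h3 h4; apply: complex_eq; rewrite !ReImE; lra.
Qed.

Lemma pairing_herm c d : pairing c (kfun d) = conjc (pairing d (kfun c)).
Proof.
rewrite /pairing conjc_sum /=.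
under eq_bigr do rewrite /kfun big_distrr.
under [RHS]eq_bigr do rewrite conjcM conjcK /kfun conjc_sum big_distrr.
rewrite /= exchange_big /=; apply: eq_bigr => p _; apply: eq_bigr => q _.
by rewrite conjcM -kernel_herm mulrCA.
Qed.

Lemma ksqr_ge0 c : 0 <= ksqr c.
Proof. by have := K0 c; rewrite ge0C => /andP[]. Qed.
Lemma ksqr_cat c d : ksqr (c ++ d) = ksqr c + 2 * complex.Re (pairing c (kfun d)) + ksqr d.
Proof.
rewrite /ksqr kfun_cat pairing_cat !pairingD (pairing_herm d c) !ReImE; lra.
Qed.
Lemma ksqr_scale a c : ksqr (scale_comb a c) = normc a ^+ 2 * ksqr c.
Proof.
rewrite /ksqr kfun_scale pairing_scale pairingZ normc_sqrE !ReImE; ring.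
Qed.

(* [rkhs_set] is the reproducing kernel Hilbert space of K as a set of functions
   on S, complete without any completion or quotient: the squared norm of h is
   the supremum over finite combinations c of 2 Re <c, h> - |c|^2. *)
Definition kvals h := [set 2 * complex.Re (pairing c h) - ksqr c | c in [set: seq (R[i] * S)]].
Definition rkhs_bound h (M : R) := forall c, 2 * complex.Re (pairing c h) - ksqr c <= M.
Definition rkhs_set h := exists M, rkhs_bound h M.
Definition rkhs_sqr h := sup (kvals h).

Lemma ksqr_nil : ksqr [::] = 0. Proof. by rewrite /ksqr /pairing big_nil. Qed.
Lemma pairing_nil h : pairing [::] h = 0. Proof. by rewrite /pairing big_nil. Qed.

Lemma rkhs_sqr_le h M : rkhs_bound h M -> rkhs_sqr h <= M.
Proof.
move=> hM; apply: ge_sup; first by exists (2 * complex.Re (pairing [::] h) - ksqr [::]); exists [::].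
by move=> _ [c _ <-].
Qed.
Lemma rkhs_sqr_ub h : rkhs_set h -> rkhs_bound h (rkhs_sqr h).
Proof.
move=> [M hM] c; apply: ub_le_sup; last by exists c.
by exists M => _ [d _ <-].
Qed.
Lemma rkhs_sqr_ge0 h : rkhs_set h -> 0 <= rkhs_sqr h.
Proof.
move=> /rkhs_sqr_ub /(_ [::]).
by rewrite pairing_nil ksqr_nil mulr0 subr0.
Qed.

(** If c tests h + k and d tests h - k, then (c + d) / 2 tests h and (c - d) / 2 tests k, and the
    norm of finite combinations obeys the parallelogram law. *)
Lemma rkhs_par_le h k : rkhs_set h -> rkhs_set k -> forall c d,
  (2 * complex.Re (pairing c (h + k)) - ksqr c) + (2 * complex.Re (pairing d (h - k)) - ksqr d)
  <= 2 * rkhs_sqr h + 2 * rkhs_sqr k.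
Proof.
move=> /rkhs_sqr_ub hh /rkhs_sqr_ub hk c d.
pose a : R[i] := (2^-1)%:C%C.
have na : normc a ^+ 2 = 4^-1 by rewrite normcR ger0_norm ?invr_ge0 //; lra.
have := hh (scale_comb a (c ++ d)); have := hk (scale_comb a (c ++ scale_comb (-1) d)).
rewrite !pairing_scale !ksqr_scale !pairing_cat !ksqr_cat !ksqr_scale kfun_scale.
rewrite !pairing_scale pairingB pairingD pairingZ na.
rewrite normcN ComplexField.Normc.normc1 expr1n /a !ReImE /=; lra.
Qed.

Lemma rkhsD h k : rkhs_set h -> rkhs_set k -> rkhs_set (h + k).
Proof.
move=> hh hk; exists (2 * rkhs_sqr h + 2 * rkhs_sqr k) => c.
have := rkhs_par_le hh hk c [::].
by rewrite pairing_nil ksqr_nil; lra.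
Qed.

Lemma rkhs_scale_bound h a M : rkhs_bound h M -> rkhs_bound (a *: h) (normc a ^+ 2 * M).
Proof.
move=> hM c; rewrite pairingZ; have [->|a0] := eqVneq a 0.
  by rewrite mul0r ComplexField.Normc.normc0 expr0n mul0r mulr0 sub0r oppr_le0 ksqr_ge0.
have n0 : normc a != 0.
  by apply: contra a0 => /eqP/ComplexField.Normc.eq0_normc ->.
have := hM (scale_comb a^-1 c).
rewrite pairing_scale ksqr_scale ComplexField.Normc.normcV.
have np : 0 < normc a ^+ 2 by rewrite exprn_gt0 // lt_neqAle eq_sym n0 normc_ge0.
rewrite -(ler_pM2l np); apply: le_trans; rewrite mulrBr.
rewrite [X in _ <= _ - X]mulrA -exprMn divff // expr1n mul1r lerB //.
have -> : complex.Re (a * pairing c h) =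
    complex.Re ((normc a ^+ 2)%:C%C * (conjc a^-1 * pairing c h)).
  congr complex.Re; rewrite mulrA; congr (_ * _).
  rewrite conjc_inv; apply: (mulIf (x := conjc a)); first by rewrite conjc_eq0.
  rewrite -mulrA mulVf ?conjc_eq0 // mulr1.
  by apply: complex_eq; rewrite normc_sqrE !ReImE /=; ring.
by rewrite ReRM mulrCA.
Qed.

Lemma rkhsZ h a : rkhs_set h -> rkhs_set (a *: h).
Proof. by move=> [M hM]; exists (normc a ^+ 2 * M); exact: rkhs_scale_bound. Qed.

Lemma rkhs_sqrZ h a : rkhs_set h -> rkhs_sqr (a *: h) = normc a ^+ 2 * rkhs_sqr h.
Proof.
move=> hh; have le b k : rkhs_set k -> rkhs_sqr (b *: k) <= normc b ^+ 2 * rkhs_sqr k.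
  by move=> hk; apply: rkhs_sqr_le; apply: rkhs_scale_bound; exact: rkhs_sqr_ub.
apply/eqP; rewrite eq_le le //=; have [->|a0] := eqVneq a 0.
  by rewrite ComplexField.Normc.normc0 expr0n mul0r rkhs_sqr_ge0 //; exact: rkhsZ.
have n0 : normc a != 0.
  by apply: contra a0 => /eqP/ComplexField.Normc.eq0_normc ->.
have := le a^-1 _ (rkhsZ a hh); rewrite scalerA mulVf // scale1r.
have np : 0 < normc a ^+ 2 by rewrite exprn_gt0 // lt_neqAle eq_sym n0 normc_ge0.
rewrite -(ler_pM2l np) => /le_trans; apply.
by rewrite ComplexField.Normc.normcV mulrA -exprMn divff // expr1n mul1r.
Qed.

Lemma rkhsN h : rkhs_set h -> rkhs_set (- h).
Proof. by rewrite -scaleN1r; exact: rkhsZ. Qed.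

Lemma rkhs_par h k : rkhs_set h -> rkhs_set k ->
  rkhs_sqr (h + k) + rkhs_sqr (h - k) = 2 * rkhs_sqr h + 2 * rkhs_sqr k.
Proof.
have le h' k' : rkhs_set h' -> rkhs_set k' ->
    rkhs_sqr (h' + k') + rkhs_sqr (h' - k') <= 2 * rkhs_sqr h' + 2 * rkhs_sqr k'.
  move=> hh hk; rewrite -lerBrDr; apply: rkhs_sqr_le => c.
  rewrite lerBrDr -lerBrDl; apply: rkhs_sqr_le => d; rewrite lerBrDl.
  exact: rkhs_par_le.
move=> hh hk; apply/eqP; rewrite eq_le le //=.
(* The reverse inequality is the same one for h + k and h - k, whose sum and difference are 2 h and
   2 k. *)
have := le _ _ (rkhsD hh hk) (rkhsD hh (rkhsN hk)).
have two (h' : S -> R[i]^o) : h' + h' = (2 : R)%:C%C *: h'.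
  have -> : (2 : R)%:C%C = 1 + 1 by apply: complex_eq => /=; lra.
  by rewrite scalerDl scale1r.
have -> : h + k + (h - k) = h + h by rewrite addrACA subrr addr0.
have -> : h + k - (h - k) = k + k by rewrite opprB addrC addrA subrK.
by rewrite !two !rkhs_sqrZ // normcR ger0_norm //; lra.
Qed.

(** Completing the square: testing [kfun c + h] with d amounts to testing h with d - c. *)
Lemma rkhs_kfun_add c h : rkhs_set h ->
  rkhs_bound (kfun c + h) (ksqr c + 2 * complex.Re (pairing c h) + rkhs_sqr h).
Proof.
move=> /rkhs_sqr_ub hh d; have := hh (d ++ scale_comb (-1) c).
rewrite pairing_cat ksqr_cat ksqr_scale kfun_scale pairing_scale pairingD pairingZ.
by rewrite normcN ComplexField.Normc.normc1 expr1n !ReImE /=; lra.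
Qed.

Lemma rkhs0 : rkhs_set 0.
Proof.
exists 0 => c; rewrite -(scale0r 0) pairingZ mul0r mulr0 sub0r oppr_le0.
exact: ksqr_ge0.
Qed.

Lemma rkhs_kfun c : rkhs_set (kfun c).
Proof. by rewrite -[kfun c]addr0; eexists; apply: rkhs_kfun_add; exact: rkhs0. Qed.

(** The expansion of the squared norm of a sum; polarized, it becomes the reproducing property. For
    the lower bound, [c ++ d] is tested for every d. *)
Lemma rkhs_sqr_kfun_add c h : rkhs_set h ->
  rkhs_sqr (kfun c + h) = ksqr c + 2 * complex.Re (pairing c h) + rkhs_sqr h.
Proof.
move=> hh; apply/eqP; rewrite eq_le rkhs_sqr_le //=; last exact: rkhs_kfun_add.
rewrite -lerBrDl; apply: rkhs_sqr_le => d; rewrite lerBrDl.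
have := rkhs_sqr_ub (rkhsD (rkhs_kfun c) hh) (c ++ d).
rewrite ksqr_cat pairing_cat !pairingD !ReImE (pairing_herm d c) !ReImE -/(ksqr c); lra.
Qed.

(** By the expansion above, the squared distance from h to [kfun c] is the amount by which c misses
    the supremum that defines the squared norm of h. *)
Lemma rkhs_dense h (e : R) : rkhs_set h -> 0 < e ->
  exists c, rkhs_sqr (h - kfun c) <= e.
Proof.
move=> hh e0.
have hs : has_sup (kvals h).
  split; first by exists (2 * complex.Re (pairing [::] h) - ksqr [::]); exists [::].
  by case: hh => M hM; exists M => _ [c _ <-].
have [_ [c _ <-] hc] := sup_adherent e0 hs.
exists c; have := rkhs_sqr_kfun_add (scale_comb (-1) c) hh.
rewrite kfun_scale scaleN1r addrC => ->.
rewrite ksqr_scale pairing_scale normcN ComplexField.Normc.normc1 expr1n !ReImE /=.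
by move: hc; rewrite -/(rkhs_sqr h); lra.
Qed.
End kernel_space.

Lemma real_cauchy_cvg (R : realType) (u : nat -> R) :
  (forall e, 0 < e -> exists N, forall m n, (N <= m)%N -> (N <= n)%N -> `|u m - u n| < e) ->
  exists l : R, u n @[n --> \oo] --> l.
Proof.
move=> cu; suff : cvgn u by exists (limn u).
apply/cauchy_cvgP/cauchy_exP => e e0; have [N hN] := cu e e0.
by exists (u N), N => // n /= Nn; apply: hN.
Qed.

Lemma adjoint_on_dense (R : realType) (H : hilbert R) (D : set H) (f f' : H -> H) (C : R) :
  (forall x e, 0 < e -> exists2 d, D d & hnorm (x - d) <= e) ->
  {morph f : x y / x - y} ->
  (forall x, hnorm (f x) <= C * hnorm x) ->
  (forall d y, D d -> hdot (f d) y = hdot d (f' y)) ->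
  forall x y, hdot (f x) y = hdot x (f' y).
Proof.
move=> dense fB fC adj x y.
apply/eqP; rewrite -subr_eq0 -normr_eq0 eq_le normr_ge0 andbT.
apply/ler_addgt0Pr => e e0; rewrite add0r.
pose E := `|C| * hnorm y + hnorm (f' y) + 1.
have E0 : 0 < E by rewrite ltr_wpDl // addr_ge0 ?mulr_ge0 ?hnorm_ge0.
have [d Dd hd] := dense x _ (divr_gt0 e0 E0).
have -> : hdot (f x) y - hdot x (f' y) = hdot (f (x - d)) y - hdot (x - d) (f' y).
  by rewrite fB !hdotBl (adj d) // opprB addrA subrK.
rewrite (le_trans (ler_normB _ _)) //.
apply: (@le_trans _ _ (`|C| * (e / E) * hnorm y + e / E * hnorm (f' y))).
  rewrite lerD // (le_trans (cauchy_schwarz _ _)) // ler_wpM2r ?hnorm_ge0 //.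
  rewrite (le_trans (fC _)) // (le_trans (ler_wpM2r (hnorm_ge0 _) (ler_norm _))) //.
  by rewrite ler_wpM2l.
have -> : `|C| * (e / E) * hnorm y + e / E * hnorm (f' y) =
  e * (`|C| * hnorm y + hnorm (f' y)) / E by ring.
by rewrite ler_pdivrMr // ler_wpM2l ?(ltW e0) // lerDl.
Qed.

(** * The kernel space as a Hilbert space, and its multiplication operators *)

Section rkhs.
Variables (R : realType) (S : Type) (K : S -> S -> R[i]).
Hypothesis K0 : positive_kernel K.
Local Notation normc := (@ComplexField.Normc.normc R).

(** The positivity proof is a parameter because closure under addition depends on it, and the
    submodule instance is attached to this predicate. *)
Definition rkhs_pred of positive_kernel K : {pred (S -> R[i]^o)} :=
  [pred h | `[< rkhs_set K h >]].

Lemma rkhs_pred_closed : submod_closed (rkhs_pred K0).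
Proof.
have inP h : (h \in rkhs_pred K0) = `[< rkhs_set K h >] by [].
split=> [|a h k]; rewrite !inP; first by apply/asboolP; apply: rkhs0.
move=> /asboolP hh /asboolP hk; apply/asboolP.
by apply: rkhsD => //; exact: rkhsZ.
Qed.
HB.instance Definition _ :=
  GRing.isSubmodClosed.Build R[i] (S -> R[i]^o) (rkhs_pred K0) rkhs_pred_closed.

Record rkhs := Rkhs { rkhs_val :> S -> R[i]^o; _ : rkhs_val \in rkhs_pred K0 }.
HB.instance Definition _ := [isSub of rkhs for rkhs_val].
HB.instance Definition _ := [Choice of rkhs by <:].
HB.instance Definition _ := [SubChoice_isSubLmodule of rkhs by <:].

Lemma rkhsP (h : rkhs) : rkhs_set K h.
Proof. by case: h => h /= /asboolP. Qed.

Definition to_rkhs (h : S -> R[i]^o) (hh : rkhs_set K h) : rkhs :=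
  @Rkhs h (introT (asboolP _) hh).

Definition kvec c : rkhs := to_rkhs (rkhs_kfun K0 c).

Definition rdot (h k : rkhs) := polar (fun h : rkhs => rkhs_sqr K h) h k.

Lemma rsqr_ge0 (h : rkhs) : 0 <= rkhs_sqr K h.
Proof. exact/rkhs_sqr_ge0/rkhsP. Qed.
Lemma rsqrZ c (h : rkhs) : rkhs_sqr K (c *: h : rkhs) = normc c ^+ 2 * rkhs_sqr K h.
Proof. by rewrite -rkhs_sqrZ //; exact: rkhsP. Qed.
Lemma rsqr_par (h k : rkhs) : rkhs_sqr K (h + k : rkhs) + rkhs_sqr K (h - k : rkhs) =
  2 * rkhs_sqr K h + 2 * rkhs_sqr K k.
Proof. by rewrite -rkhs_par //; exact: rkhsP. Qed.

Lemma rdotxx h : rdot h h = rkhs_sqr K h.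
Proof. exact: (polarxx rsqrZ). Qed.

Lemma rdot_kvec c h : rdot (kvec c) h = complex.Re (pairing c h).
Proof.
rewrite /rdot /polar.
have -> : rkhs_sqr K (kvec c + h : rkhs) = ksqr K c + 2 * complex.Re (pairing c h) + rkhs_sqr K h.
  by rewrite -rkhs_sqr_kfun_add //; exact: rkhsP.
have -> : rkhs_sqr K (kvec c - h : rkhs) = ksqr K c - 2 * complex.Re (pairing c h) + rkhs_sqr K h.
  have := rkhs_sqr_kfun_add K0 c (rkhsP (- h)).
  have -> : rkhs_sqr K (- h : rkhs) = rkhs_sqr K h by rewrite (QN rsqrZ).
  by move=> ->; rewrite -[rkhs_val (- h)]/(- (h : S -> R[i]^o)) -scaleN1r pairingZ mulN1r ReN mulrN.
by lra.
Qed.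

Lemma rdot_ge0 h : 0 <= rdot h h.
Proof. by rewrite rdotxx rsqr_ge0. Qed.

Lemma quadratic_disc (r a b : R) : 0 <= a ->
  (forall t, 2 * t * r <= t ^+ 2 * a + b) -> r ^+ 2 <= a * b.
Proof.
move=> a0 h; have [az|an] := eqVneq a 0.
  have [->|rn] := eqVneq r 0; first by rewrite expr0n az mul0r.
  (* For a = 0 this choice of t would give b + 1 <= b. *)
  have := h ((b + 1) / (2 * r)); rewrite az mulr0 add0r.
  have -> : 2 * ((b + 1) / (2 * r)) * r = b + 1 by field.
  by rewrite gerDl ler10.
have ap : 0 < a by rewrite lt_neqAle eq_sym an.
have := h (r / a).
have -> : 2 * (r / a) * r = 2 * r ^+ 2 / a by field.
have -> : (r / a) ^+ 2 * a = r ^+ 2 / a by field.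
have : r ^+ 2 / a * a = r ^+ 2 by field.
set q := r ^+ 2 / a => hq; rewrite -mulrA -/q => hh.
by rewrite -hq mulrC ler_pM2l //; lra.
Qed.

(** Cauchy-Schwarz against a kernel combination, from the defining supremum restricted to the real
    multiples t c. *)
Lemma pairing_sqr_le c (h : rkhs) : complex.Re (pairing c h) ^+ 2 <= ksqr K c * rkhs_sqr K h.
Proof.
apply: quadratic_disc; first exact: ksqr_ge0.
move=> t; have := rkhs_sqr_ub (rkhsP h) (scale_comb t%:C%C c).
rewrite pairing_scale ksqr_scale // normcR conjc_real ReRM.
by rewrite real_normK ?num_real //; lra.
Qed.

Lemma Re_pairing1 (h : S -> R[i]^o) s : complex.Re (pairing [:: (1, s)] h) = complex.Re (h s).
Proof. by rewrite /pairing big_seq1 /= !ReImE /=; lra. Qed.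
Lemma Re_pairingi (h : S -> R[i]^o) s : complex.Re (pairing [:: ('i%C, s)] h) = complex.Im (h s).
Proof. by rewrite /pairing big_seq1 /= !ReImE /=; lra. Qed.

Lemma rdot_eq0 h : rdot h h = 0 -> h = 0.
Proof.
rewrite rdotxx => h0; apply: val_inj; apply/funext => s /=.
have z c : complex.Re (pairing c h) = 0.
  by have := pairing_sqr_le c h; rewrite h0 mulr0 => h1; apply/eqP; rewrite -sqrf_eq0 eq_le h1 sqr_ge0.
by apply: complex_eq; rewrite -1?Re_pairing1 -1?Re_pairingi z.
Qed.

(** The limit is the pointwise one. Every condition in [rkhs_bound] involves finitely many values,
    so it passes to pointwise limits: the norm is lower semicontinuous, and a Cauchy estimate
    becomes an estimate for the distance to the limit. *)
Lemma rkhs_complete (s : nat -> rkhs) :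
  (forall e : R, 0 < e -> exists N, forall m n, (N <= m)%N -> (N <= n)%N ->
     rdot (s m - s n) (s m - s n) < e) ->
  exists l, forall e : R, 0 < e -> exists N, forall n, (N <= n)%N ->
     rdot (s n - l) (s n - l) < e.
Proof.
move=> cs.
have cP c : exists l : R, complex.Re (pairing c (s n)) @[n --> \oo] --> l.
  apply: real_cauchy_cvg => e e0.
  have c0 : 0 < ksqr K c + 1 by rewrite ltr_wpDl ?ksqr_ge0.
  have [|N hN] := cs (e ^+ 2 / (ksqr K c + 1)).
    by rewrite divr_gt0 // exprn_gt0.
  exists N => m n Nm Nn.
  rewrite -(@ltr_pXn2r _ 2) ?nnegrE ?(ltW e0) // real_normK ?num_real //.
  have -> : complex.Re (pairing c (s m)) - complex.Re (pairing c (s n)) =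
      complex.Re (pairing c (s m - s n : rkhs)).
    by rewrite -[rkhs_val (s m - s n)]/((s m : S -> R[i]^o) - (s n : S -> R[i]^o)) pairingB !ReImE.
  apply: le_lt_trans (pairing_sqr_le _ _) _.
  have := hN m n Nm Nn; rewrite rdotxx ltr_pdivlMr // mulrC; apply: le_lt_trans.
  by rewrite ler_wpM2r ?rsqr_ge0 // lerDl.
pose L c := sval (cid (cP c)).
have LP c : complex.Re (pairing c (s n)) @[n --> \oo] --> L c by rewrite /L; case: cid.
(* Pairing with (1, t) and with (i, t) gives the real and the imaginary part of the value at t. *)
pose l : S -> R[i]^o := fun t => Complex (L [:: (1, t)]) (L [:: ('i%C, t)]).
have lP c : complex.Re (pairing c (s n)) @[n --> \oo] --> complex.Re (pairing c l).
  elim: c => [|[a t] c ih].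
    by rewrite /pairing big_nil; under eq_fun do rewrite big_nil; exact: cvg_cst.
  rewrite /pairing big_cons /= -/(pairing c l) !ReImE.
  under eq_fun do rewrite big_cons /= -/(pairing c _) !ReImE.
  apply: cvgD ih; apply: cvgB; apply: cvgMr => //=.
    by have := LP [:: (1, t)]; under eq_fun do rewrite Re_pairing1.
  by have := LP [:: ('i%C, t)]; under eq_fun do rewrite Re_pairingi.
have close e : 0 < e -> exists N, forall n, (N <= n)%N ->
    rkhs_bound K ((s n : S -> R[i]^o) - l) e.
  move=> e0; have [N hN] := cs e e0; exists N => n Nn c.
  have h : 2 * complex.Re (pairing c (s n)) - 2 * complex.Re (pairing c (s m)) - ksqr K c
      @[m --> \oo] --> 2 * complex.Re (pairing c (s n)) - 2 * complex.Re (pairing c l) - ksqr K c.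
    by apply: cvgB (cvg_cst _); apply: cvgB (cvg_cst _) _; apply: cvgMr; exact: lP.
  rewrite pairingB ReD ReN mulrDr mulrN.
  rewrite -(cvg_lim _ h) //; apply: limr_le; first by apply/cvg_ex; eexists; exact: h.
  exists N => // m /= Nm; have := hN n m Nn Nm; rewrite rdotxx => hh.
  apply: le_trans (ltW hh); have := rkhs_sqr_ub (rkhsP (s n - s m)) c.
  by rewrite -[rkhs_val (s n - s m)]/((s n : S -> R[i]^o) - (s m : S -> R[i]^o)) pairingB ReD ReN mulrDr mulrN.
have lin : rkhs_set K l.
  have [N /(_ N (leqnn N)) hN] := close 1 ltr01.
  have -> : l = (s N : S -> R[i]^o) - ((s N : S -> R[i]^o) - l) by rewrite opprB addrC subrK.
  by apply: rkhsD => //; [exact: rkhsP | apply: rkhsN => //; exists 1].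
exists (to_rkhs lin) => e e0; have [|N hN] := close (e / 2); first by rewrite divr_gt0.
exists N => n Nn; rewrite rdotxx; apply: (@le_lt_trans _ _ (e / 2)).
  exact/rkhs_sqr_le/hN.
by rewrite ltr_pdivrMr // ltr_pMr // ltr1n.
Qed.

Hypothesis K_neq0 : exists s, K s s <> 0.

Lemma rkhs_nontrivial : exists x : rkhs, x <> 0.
Proof.
have [s Ks] := K_neq0; exists (kvec [:: (1, s)]) => h; apply: Ks.
have := congr1 (fun h : rkhs => h s) h.
by rewrite /= /kfun big_seq1 mul1r.
Qed.

Definition rkhs_hilbert : hilbert R := @Hilbert R rkhs rdot
  (polarC rsqrZ) (polarDl rsqrZ rsqr_par) (polarRl rsqr_ge0 rsqrZ rsqr_par)
  (polarZl rsqr_ge0 rsqrZ rsqr_par) rdot_ge0 rdot_eq0 rkhs_complete rkhs_nontrivial.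

Local Notation H := rkhs_hilbert.

Lemma rkhs_hnorm (h : H) : hnorm h ^+ 2 = rkhs_sqr K (h : rkhs).
Proof. by rewrite sqr_hnorm -rdotxx. Qed.

Lemma kvec_dense (h : H) (e : R) : 0 < e -> exists c, hnorm (h - kvec c : H) <= e.
Proof.
move=> e0; have [|c hc] := rkhs_dense K0 (e := e ^+ 2) (rkhsP (h : rkhs)).
  by rewrite exprn_gt0.
exists c; rewrite -(@ler_pXn2r _ 2) ?nnegrE ?hnorm_ge0 ?(ltW e0) //.
by rewrite rkhs_hnorm.
Qed.

Section multiplication.
Variable w : S -> R[i].
Hypothesis wK : forall s t, K s t <> 0 -> w s = w t.
Implicit Types (c d : seq (R[i] * S)).

Definition mul_comb (w : S -> R[i]) c := [seq (w p.2 * p.1, p.2) | p <- c].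
Definition mul_fun (w : S -> R[i]) (h : S -> R[i]^o) : S -> R[i]^o := fun s => w s * h s.

Lemma pairing_mul v c h : pairing (mul_comb v c) h = pairing c (mul_fun (fun s => conjc (v s)) h).
Proof.
rewrite /pairing big_map; apply: eq_bigr => p _ /=.
by rewrite conjcM mulrA (mulrC (conjc p.1)).
Qed.

(** Where [K s t] is nonzero, w takes the same value at s and t, so the weight can be moved from the
    argument to the coefficients. *)
Lemma kfun_mul c : kfun K (mul_comb w c) = mul_fun w (kfun K c).
Proof.
apply/funext => s; rewrite /kfun /mul_fun big_map mulr_sumr; apply: eq_bigr => p _ /=.
have [->|/eqP/wK ->] := eqVneq (K s p.2) 0; first by rewrite !mulr0.
by rewrite mulrA.
Qed.

End multiplication.

Lemma ksqr_mul (w : S -> R[i]) c : (forall s t, K s t <> 0 -> w s = w t) ->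
  ksqr K (mul_comb w c) = complex.Re (pairing c (mul_fun (fun s => (normc (w s) ^+ 2)%:C%C) (kfun K c))).
Proof.
move=> wK; rewrite /ksqr kfun_mul // pairing_mul; congr (complex.Re (pairing c _)).
apply/funext => s; rewrite /mul_fun mulrA; congr (_ * _).
by apply: complex_eq; rewrite normc_sqrE !ReImE /=; ring.
Qed.

(* M^2 - |w|^2 = |v|^2 for another function v that is constant on the classes
   of K, so the defect is the norm of a combination. *)
Lemma ksqr_mul_le (w : S -> R[i]) M c : (forall s t, K s t <> 0 -> w s = w t) ->
  (forall s, normc (w s) <= M) -> ksqr K (mul_comb w c) <= M ^+ 2 * ksqr K c.
Proof.
move=> wK wM; pose v s : R[i] := (Num.sqrt (M ^+ 2 - normc (w s) ^+ 2))%:C%C.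
have vK s t : K s t <> 0 -> v s = v t by move=> /wK h; rewrite /v h.
have := ksqr_ge0 K0 (mul_comb v c); rewrite !ksqr_mul // => v0.
rewrite -subr_ge0; suff -> : M ^+ 2 * ksqr K c = complex.Re (pairing c (mul_fun (fun s => (normc (w s) ^+ 2)%:C%C) (kfun K c))) + complex.Re (pairing c (mul_fun (fun s => (normc (v s) ^+ 2)%:C%C) (kfun K c))) by rewrite addrC addKr.
rewrite -ReD -pairingD /ksqr -ReRM -pairingZ; congr (complex.Re (pairing c _)).
apply/funext => s; rewrite /mul_fun.
transitivity (((normc (w s) ^+ 2)%:C%C + (normc (v s) ^+ 2)%:C%C) * kfun K c s); last by rewrite mulrDl.
have vs : normc (v s) ^+ 2 = M ^+ 2 - normc (w s) ^+ 2.
  rewrite normcR real_normK ?num_real // sqr_sqrtr //.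
  by rewrite subr_ge0 ler_pXn2r ?nnegrE ?normc_ge0 // (le_trans (normc_ge0 (w s))).
by rewrite vs; congr (_ * _); apply: complex_eq; rewrite /= ?addr0 // addrC subrK.
Qed.

Lemma rkhs_mul_bound (w : S -> R[i]) M B h : (forall s t, K s t <> 0 -> w s = w t) ->
  0 < M -> (forall s, normc (w s) <= M) ->
  rkhs_bound K h B -> rkhs_bound K (mul_fun w h) (M ^+ 2 * B).
Proof.
move=> wK M0 wM hB c; pose w' s := conjc (w s).
have wK' s t : K s t <> 0 -> w' s = w' t by move=> /wK h'; rewrite /w' h'.
have wM' s : normc (w' s) <= M by rewrite normcJ.
have -> : pairing c (mul_fun w h) = pairing (mul_comb w' c) h.
  by rewrite pairing_mul; congr pairing; apply/funext => s; rewrite /mul_fun conjcK.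
have := ksqr_mul_le c wK' wM'.
(* Dividing the combination by M^2 leaves, once the inequality is multiplied by M^2, the quadratic
   term |w' c|^2 / M^2, which is at most |c|^2. *)
have := hB (scale_comb (M ^- 2)%:C%C (mul_comb w' c)).
rewrite pairing_scale conjc_real ReRM ksqr_scale // normcR ger0_norm; last first.
  by rewrite invr_ge0 exprn_ge0 // ltW.
set r := complex.Re _; set k := ksqr K (mul_comb _ _) => h1 h2.
have m0 : 0 < M ^+ 2 by rewrite exprn_gt0.
have e1 : M ^+ 2 * (2 * (M ^- 2 * r) - (M ^- 2) ^+ 2 * k) = 2 * r - k / M ^+ 2.
  by have : M != 0 by [rewrite gt_eqF]; move=> ?; field.
have := ler_wpM2l (ltW m0) h1; rewrite e1; apply: le_trans; rewrite lerB //.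
by rewrite ler_pdivrMr // mulrC.
Qed.

Section multiplication_operator.
Variable w : S -> R[i].
Hypothesis wK : forall s t, K s t <> 0 -> w s = w t.
Hypothesis wb : exists M, forall s, normc (w s) <= M.

Lemma mul_bound_pos : exists2 M, 0 < M & forall s, normc (w s) <= M.
Proof.
case: wb => M hM; exists (`|M| + 1) => [|s]; first by rewrite ltr_wpDl.
by rewrite (le_trans (hM s)) // (le_trans (ler_norm _)) // lerDl.
Qed.

Lemma rkhs_mul_subproof (h : rkhs) : rkhs_set K (mul_fun w h).
Proof.
have [M M0 wM] := mul_bound_pos; have [B hB] := rkhsP h.
by exists (M ^+ 2 * B); exact: rkhs_mul_bound.
Qed.
Definition rkhs_mul (h : H) : H := to_rkhs (rkhs_mul_subproof h).
End multiplication_operator.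

(** On kernel combinations adjointness is [pairing_mul]; boundedness and density extend it to the
    whole space. *)
Lemma rkhs_mul_operator w wK wb w' wK' wb' :
  (forall s, w' s = conjc (w s)) ->
  is_operator (@rkhs_mul w wK wb) (@rkhs_mul w' wK' wb').
Proof.
move=> ww'; have [M M0 wM] := mul_bound_pos wb.
have lB v vK vb : {morph @rkhs_mul v vK vb : x y / x - y}.
  by move=> x y; apply: val_inj; apply/funext => s; apply: mulrBr.
have bM x : hnorm (rkhs_mul wK wb x) <= M * hnorm x.
  rewrite -(@ler_pXn2r _ 2) ?nnegrE ?mulr_ge0 ?hnorm_ge0 ?(ltW M0) //.
  rewrite exprMn !rkhs_hnorm; apply: rkhs_sqr_le; apply: rkhs_mul_bound => //.
  exact/rkhs_sqr_ub/rkhsP.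
split; last by exists M.
- apply: (@adjoint_on_dense _ H [set (kvec c : H) | c in [set: seq (R[i] * S)]]
    (rkhs_mul wK wb) (rkhs_mul wK' wb') M) => //.
    by move=> x e e0; have [c hc] := kvec_dense x e0; exists (kvec c) => //; exists c.
  move=> _ y [c _ <-].
  have -> : rkhs_mul wK wb (kvec c) = kvec (mul_comb w c).
    by apply: val_inj => /=; rewrite kfun_mul.
  rewrite [LHS]rdot_kvec [RHS]rdot_kvec pairing_mul; congr (complex.Re (pairing c _)).
  by apply/funext => s; rewrite /mul_fun /= /mul_fun ww'.
- by move=> a x; apply: val_inj; apply/funext => s; apply: mulrCA.
Qed.

End rkhs.

(** * States from positive definite functions *)

Section complex_topology.
Variable R : realType.

Lemma norm_normc (z : R[i]) : `|z| = (ComplexField.Normc.normc z)%:C%C.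
Proof. by rewrite normc_def normcEE. Qed.

Lemma Re_continuous : continuous (@complex.Re R : R[i]^o -> R).
Proof.
move=> z; have FF : Filter (nbhs (z : R[i]^o)) by exact: nbhs_filter.
apply/(@cvgrPdist_lt R R _ _ FF) => e e0.
have zz : t @[t --> (z : R[i]^o)] --> (z : R[i]^o) by exact: cvg_id.
have e0' : 0 < (e%:C)%C by rewrite ltcR.
move/(@cvgrPdist_lt R[i] R[i]^o _ _ FF): zz => /(_ _ e0'); apply: filterS => t /=.
by rewrite -ReN -ReD norm_normc ltcR; apply: le_lt_trans; exact: Re_le_normc.
Qed.

Lemma Im_continuous : continuous (@complex.Im R : R[i]^o -> R).
Proof.
move=> z; have FF : Filter (nbhs (z : R[i]^o)) by exact: nbhs_filter.
apply/(@cvgrPdist_lt R R _ _ FF) => e e0.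
have zz : t @[t --> (z : R[i]^o)] --> (z : R[i]^o) by exact: cvg_id.
have e0' : 0 < (e%:C)%C by rewrite ltcR.
move/(@cvgrPdist_lt R[i] R[i]^o _ _ FF): zz => /(_ _ e0'); apply: filterS => t /=.
by rewrite -ImN -ImD norm_normc ltcR; apply: le_lt_trans; exact: Im_le_normc.
Qed.

Variable X : ptopologicalType.
Implicit Types f : CX R X.

Lemma Re_CX_continuous f : continuous (fun x => complex.Re (f x)).
Proof.
by move=> x; apply: continuous_comp; [exact: CX_continuous|exact: Re_continuous].
Qed.
Lemma Im_CX_continuous f : continuous (fun x => complex.Im (f x)).
Proof.
by move=> x; apply: continuous_comp; [exact: CX_continuous|exact: Im_continuous].
Qed.

Hypothesis cX : compact [set: X].

Lemma compact_continuous_bounded (h : X -> R) : continuous h ->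
  exists M, forall x, `|h x| <= M.
Proof.
move=> ch; have [||c _ hc] := @compact_EVT_max X R (fun x => `|h x|) setT _ cX.
- by exists point.
- by apply: continuous_subspaceT => x; apply: continuous_comp (ch x) _; exact: norm_continuous.
- by exists `|h c| => x; apply: hc; rewrite inE.
Qed.

Lemma CX_bounded f : exists M, forall x, ComplexField.Normc.normc (f x) <= M.
Proof.
have [M hM] := compact_continuous_bounded (@Re_CX_continuous f).
have [N hN] := compact_continuous_bounded (@Im_CX_continuous f).
by exists (M + N) => x; rewrite (le_trans (normc_le _)) // lerD.
Qed.
End complex_topology.

(** The inner product of i x with x is purely imaginary, and [hdot] records real parts. *)
Lemma hdot_i (R : realType) (H : hilbert R) (x : H) : hdot ('i%C *: x) x = 0.
Proof.
have : hdot ('i%C *: x) x = - hdot ('i%C *: x) x.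
  rewrite {1}hdotZl.
  have -> : (conjc 'i)%C = - 'i%C :> R[i] by apply: complex_eq => /=; rewrite ?oppr0.
  by rewrite scaleNr hdotNr hdotC.
by move=> h; lra.
Qed.

Section gns.
Variables (R : realType) (G : groupType) (p : G -> R[i]).
(** Invariant under simultaneous left translation of s and t, so that the left translations become
    unitary. *)
Definition group_kernel (s t : G) : R[i] := p (s^-1 * t)%g.
Local Notation K := group_kernel.
Hypothesis pd : positive_kernel group_kernel.
Hypothesis p1 : p 1%g = 1.

Lemma group_kernel_neq0 : exists s, K s s <> 0.
Proof.
exists 1%g; rewrite /group_kernel mulVg p1 => h.
by have := oner_neq0 R[i]; rewrite h eqxx.
Qed.

Definition gns_space := rkhs_hilbert pd group_kernel_neq0.
Local Notation H := gns_space.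

Definition translate_comb (g : G) (c : seq (R[i] * G)) := [seq (q.1, (g * q.2)%g) | q <- c].
Definition shift (g : G) (h : G -> R[i]^o) : G -> R[i]^o := fun s => h (g^-1 * s)%g.

Lemma pairing_shift g c h : pairing c (shift g h) = pairing (translate_comb g^-1 c) h.
Proof. by rewrite /pairing big_map. Qed.

Lemma ksqr_translate g c : ksqr K (translate_comb g c) = ksqr K c.
Proof.
rewrite /ksqr {1}/pairing big_map; congr complex.Re; apply: eq_bigr => q _ /=.
congr (_ * _); rewrite /kfun big_map; apply: eq_bigr => r _ /=.
by rewrite /group_kernel invgM mulgA -(mulgA _ g^-1%g) mulVg mulg1.
Qed.

Lemma rkhs_bound_shift g h M : rkhs_bound K h M -> rkhs_bound K (shift g h) M.
Proof. by move=> hM c; rewrite pairing_shift -(ksqr_translate g^-1). Qed.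

Lemma shift_subproof g (h : rkhs pd) : rkhs_set K (shift g h).
Proof. by have [M hM] := rkhsP h; exists M; exact: rkhs_bound_shift. Qed.
Definition shift_fun g (h : H) : H := to_rkhs pd (shift_subproof g h).

Lemma shift_funK g : cancel (shift_fun g) (shift_fun g^-1).
Proof.
move=> h; apply: val_inj; apply/funext => s /=.
by rewrite /shift /= /shift invgK mulgA mulVg mul1g.
Qed.

Lemma rkhs_sqr_shift g (h : H) : rkhs_sqr K (shift_fun g h : rkhs pd) = rkhs_sqr K (h : rkhs pd).
Proof.
have le a (k : H) : rkhs_sqr K (shift_fun a k : rkhs pd) <= rkhs_sqr K (k : rkhs pd).
  by apply: rkhs_sqr_le; apply: rkhs_bound_shift; exact/rkhs_sqr_ub/rkhsP.
by apply/eqP; rewrite eq_le le -{1}(shift_funK g h) le.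
Qed.

Lemma shift_funD g : {morph shift_fun g : x y / x + y}.
Proof. by move=> x y; apply: val_inj. Qed.
Lemma shift_funN g : {morph shift_fun g : x / - x}.
Proof. by move=> x; apply: val_inj. Qed.

(** A translation is an invertible isometry, so polarization identifies its inverse with its
    adjoint. *)
Lemma shift_operator g : is_operator (shift_fun g) (shift_fun g^-1).
Proof.
have sK : cancel (shift_fun g^-1) (shift_fun g).
  by move=> h; have := shift_funK g^-1 h; rewrite invgK.
split=> [x y|c x|].
- rewrite [LHS]/(rdot _ _) [RHS]/(rdot _ _) /rdot /polar.
  have e1 : shift_fun g x + y = shift_fun g (x + shift_fun g^-1 y) by rewrite shift_funD sK.
  have e2 : shift_fun g x - y = shift_fun g (x - shift_fun g^-1 y) by rewrite shift_funD shift_funN sK.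
  congr (_ * (_ - _)).
    by rewrite [X in rkhs_sqr K (rkhs_val X)]e1 rkhs_sqr_shift.
  by rewrite [X in rkhs_sqr K (rkhs_val X)]e2 rkhs_sqr_shift.
- by apply: val_inj.
- exists 1 => x; rewrite mul1r -(@ler_pXn2r _ 2) ?nnegrE ?hnorm_ge0 //.
  by rewrite !rkhs_hnorm rkhs_sqr_shift.
Qed.

Definition shift_op g : operator H := Operator (shift_operator g).

Lemma op_rkhs_eq (S T : operator H) :
  (forall (h : rkhs pd) s, (S h : rkhs pd) s = (T h : rkhs pd) s) -> S = T.
Proof. by move=> ST; apply: op_eqP => h; apply: val_inj; apply/funext => s; exact: ST. Qed.

Lemma shift_op_unitary : unitary_rep shift_op.
Proof.
split=> [|g h|g|g]; apply: op_rkhs_eq => k s /=; rewrite /shift /= ?/shift.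
- by rewrite invg1 mul1g.
- by rewrite invgM mulgA.
- by rewrite invgK mulgA mulVg mul1g.
- by rewrite invgK mulgA mulgV mul1g.
Qed.

Definition cyclic_vector : H := kvec pd [:: (1, 1%g)].
(** By the reproducing property, evaluation at the unit of G is the inner product with the cyclic
    vector; unlike [hdot], it yields the full complex value. *)
Definition vector_state_fun (S : operator H) : R[i] := (S cyclic_vector : rkhs pd) 1%g.

Lemma vector_state_linear : scalar vector_state_fun.
Proof. by []. Qed.
HB.instance Definition _ := GRing.isLinear.Build R[i] (operator H) R[i] *%R
  vector_state_fun vector_state_linear.
Definition vector_state : {scalar (operator H)} := vector_state_fun.

Lemma cyclic_vectorE g : (cyclic_vector : rkhs pd) g = p g^-1%g.
Proof. by rewrite /= /kfun big_seq1 mul1r /group_kernel mulg1. Qed.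

Lemma vector_state_ge0 S : 0 <= vector_state (star S * S).
Proof.
set w : H := op_adj S (S cyclic_vector).
(* The real part is the squared norm of [S cyclic_vector], and the imaginary part vanishes by
   [hdot_i]. *)
rewrite ge0C -[vector_state _]/((w : rkhs pd) 1%g) -Re_pairing1 -Re_pairingi.
rewrite -!rdot_kvec.
have -> : rdot (kvec pd [:: (1, 1%g)]) w = hdot (S cyclic_vector) (S cyclic_vector).
  by rewrite op_adjE.
have -> : kvec pd [:: ('i%C, 1%g)] = ('i%C *: cyclic_vector : H).
  by apply: val_inj; rewrite /= -kfun_scale /scale_comb /= mulr1.
have -> : rdot ('i%C *: cyclic_vector : H) w = hdot (S ('i%C *: cyclic_vector)) (S cyclic_vector).
  by rewrite op_adjE.
by rewrite opZ hdot_i eqxx hdot_ge0.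
Qed.

Lemma vector_state_is_state : is_state vector_state.
Proof.
split; first exact: vector_state_ge0.
by rewrite -[LHS]/((cyclic_vector : rkhs pd) 1%g) cyclic_vectorE invg1.
Qed.

Lemma vector_state_shift g : vector_state (shift_op g) = p g.
Proof.
by rewrite -[LHS]/((cyclic_vector : rkhs pd) (g^-1 * 1)%g) cyclic_vectorE mulg1 invgK.
Qed.

Lemma state_comp (A D : starAlgType R) (w : {scalar D}) (pi : {lrmorphism A -> D}) :
  is_star_hom pi -> is_state w -> exists2 v : {scalar A}, is_state v & forall a, v a = w (pi a).
Proof.
move=> spi [w0 w1]; exists (w \o pi : {scalar A}) => //.
by split=> [a|] /=; [rewrite rmorphM /= spi w0 | rewrite rmorph1 w1].
Qed.

Lemma positive_definite_state (A : cstarAlgType R) (lam : G -> A) :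
  is_full_group_cstar lam ->
  exists2 w : {scalar A}, is_state w & forall g, w (lam g) = p g.
Proof.
move=> [_ _ /(_ _ _ shift_op_unitary)[pi [spi pil]]].
have [w sw we] := state_comp spi vector_state_is_state.
by exists w => // g; rewrite we pil vector_state_shift.
Qed.
End gns.

(** * Representation of the crossed product on functions along the orbit of a point *)

Section orbit_representation.
Variables (R : realType) (G : groupType) (X : ptopologicalType) (al : caction G X).
Variables (p : G -> R[i]) (x : X).
Hypothesis pd : positive_kernel (group_kernel p).
Hypothesis p1 : p 1%g = 1.
Hypothesis cX : compact [set: X].
Hypothesis p_stab : forall g, p g <> 0 -> al g x = x.
Local Notation H := (gns_space pd p1).

Definition orbit_weight (f : CX R X) (s : G) : R[i] := f (al s x).

(* The only place where the support condition enters: f must be constant along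
   the classes of the kernel for multiplication by it to be adjointable. *)
Lemma orbit_weightK f s t : group_kernel p s t <> 0 -> orbit_weight f s = orbit_weight f t.
Proof.
move=> /p_stab h; rewrite /orbit_weight; congr (CX_fun f _).
by rewrite -[in LHS]h -actM mulgA mulgV mul1g.
Qed.

Lemma orbit_weight_bounded f : exists M, forall s, ComplexField.Normc.normc (orbit_weight f s) <= M.
Proof. by have [M hM] := CX_bounded cX f; exists M => s; exact: hM. Qed.

Definition orbit_op (f : CX R X) : operator H := Operator (rkhs_mul_operator pd
  (group_kernel_neq0 p1) (orbit_weightK f) (orbit_weight_bounded f)
  (orbit_weightK (star f)) (orbit_weight_bounded (star f)) (fun s => erefl)).

Lemma orbit_op_linear : linear orbit_op.
Proof.
move=> c f h; apply: op_rkhs_eq => k s.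
by rewrite -[LHS]/((c * f (al s x) + h (al s x)) * k s) mulrDl -mulrA.
Qed.
HB.instance Definition _ := GRing.isLinear.Build R[i] (CX R X) (operator H) *:%R
  orbit_op orbit_op_linear.
Lemma orbit_op_monoid : monoid_morphism orbit_op.
Proof.
split; first by apply: op_rkhs_eq => k s; apply: mul1r.
by move=> f h; apply: op_rkhs_eq => k s; rewrite /= /mul_fun /orbit_weight /= /mul_fun /= mulrA.
Qed.
HB.instance Definition _ := GRing.isMonoidMorphism.Build (CX R X) (operator H)
  orbit_op orbit_op_monoid.

Lemma orbit_covariant : covariant_rep al (orbit_op : {lrmorphism CX R X -> operator H})
  (@shift_op R G p pd p1).
Proof.
split; last 1 first.
- move=> g f; apply: op_rkhs_eq => k s /=.
  rewrite /shift /= /mul_fun /orbit_weight /= /shift invgK mulgA mulgV mul1g.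
  by rewrite actM.
- by move=> f; apply: op_eqP.
- exact: shift_op_unitary.
Qed.

Lemma orbit_state (B : cstarAlgType R) (iota : {lrmorphism CX R X -> B}) (u : G -> B) :
  is_full_crossed_product al iota u ->
  exists2 w : {scalar B}, is_state w & forall f g, w (iota f * u g) = f x * p g.
Proof.
move=> [_ _ /(_ _ _ _ orbit_covariant)[pi [spi pif piu]]].
have [w sw we] := state_comp spi (vector_state_is_state pd p1).
exists w => // f g; rewrite we rmorphM /= pif piu.
rewrite -[LHS]/(f (al 1%g x) * vector_state pd p1 (shift_op pd p1 g)).
by rewrite act1 vector_state_shift.
Qed.
End orbit_representation.

(** * The Riesz representation theorem *)

Record positive_functional (R : realType) (X : topologicalType) := PositiveFunctional {
  pf_fun :> (X -> R) -> R;
  pfD : forall f g : X -> R, continuous f -> continuous g -> pf_fun (f + g) = pf_fun f + pf_fun g;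
  pfZ : forall (t : R) (f : X -> R), continuous f -> pf_fun (fun x => t * f x) = t * pf_fun f;
  pf_ge0 : forall f : X -> R, continuous f -> (forall x, 0 <= f x) -> 0 <= pf_fun f }.

Section continuous_real_functions.
Variables (R : realType) (X : topologicalType).
Implicit Types f g : X -> R.

Lemma cont_cst (a : R) : continuous (fun _ : X => a).
Proof. by move=> x; exact: cvg_cst. Qed.
Lemma contD f g : continuous f -> continuous g -> continuous (f + g).
Proof. by move=> cf cg x; apply: cvgD; [exact: cf|exact: cg]. Qed.
Lemma contB f g : continuous f -> continuous g -> continuous (f - g).
Proof. by move=> cf cg x; apply: cvgB; [exact: cf|exact: cg]. Qed.
Lemma contM f g : continuous f -> continuous g -> continuous (fun x => f x * g x).
Proof. by move=> cf cg x; apply: cvgM; [exact: cf|exact: cg]. Qed.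
Lemma cont_min f g : continuous f -> continuous g -> continuous (fun x => Num.min (f x) (g x)).
Proof. by move=> cf cg x; exact: (continuous_min (cf x) (cg x)). Qed.
Lemma cont_sum (F : nat -> X -> R) n : (forall k, continuous (F k)) ->
  continuous (\sum_(k < n) F k).
Proof.
move=> cF; elim: n => [|n ih]; first by rewrite big_ord0; exact: cont_cst.
by rewrite big_ord_recr; exact: contD.
Qed.

Variable L : positive_functional R X.

Lemma pfB f g : continuous f -> continuous g -> L (f - g) = L f - L g.
Proof.
move=> cf cg; have := pfD L (contB cf cg) cg; rewrite subrK => ->.
by rewrite addrK.
Qed.
Lemma pf_le f g : continuous f -> continuous g -> (forall x, f x <= g x) -> L f <= L g.
Proof.
move=> cf cg fg; rewrite -subr_ge0 -pfB //; apply: pf_ge0; first exact: contB.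
by move=> x; rewrite subr_ge0.
Qed.
Lemma pf0 : L 0 = 0.
Proof.
have c0 : continuous (0 : X -> R) by exact: cont_cst.
by apply: (addrI (L 0)); rewrite -pfD // !addr0.
Qed.
Lemma pf_sum (F : nat -> X -> R) n : (forall k, continuous (F k)) ->
  L (\sum_(k < n) F k) = \sum_(k < n) L (F k).
Proof.
move=> cF; elim: n => [|n ih]; first by rewrite !big_ord0 pf0.
by rewrite !big_ord_recr /= pfD ?ih //; exact: cont_sum.
Qed.

(** A bound m for the Daniell upper integral of the indicator of A: an increasing sequence of
    continuous functions stands for its lower semicontinuous supremum, except that the value 1 has
    to be reached at a finite stage. *)
Definition covers (A : set X) (m : R) := exists F : nat -> X -> R,
  [/\ forall n, continuous (F n), forall n x, 0 <= F n x,
      forall n x, F n x <= F n.+1 x,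
      forall x, A x -> exists n, 1 <= F n x
    & forall n, L (F n) <= m].

Definition riesz_value (A : set X) : R := inf [set m | covers A m].
Definition riesz_outer (A : set X) : \bar R := (riesz_value A)%:E.

Lemma homo_seq (F : nat -> X -> R) x m n : (forall n x, F n x <= F n.+1 x) -> (m <= n)%N -> F m x <= F n x.
Proof. by move=> iF mn; apply: (@homo_leq _ (fun n => F n x) (fun a b => a <= b)) => //; exact: le_trans. Qed.

Lemma covers_ge0 A m : covers A m -> 0 <= m.
Proof. by move=> [F [cF F0 _ _ /(_ 0%N)]]; apply: le_trans; exact: pf_ge0. Qed.
Lemma covers_one A : covers A (L (cst 1)).
Proof.
exists (fun _ => cst 1); split=> //; first by move=> _; exact: cont_cst.
by move=> x _; exists 0%N.
Qed.
Lemma covers_has_inf A : has_inf [set m | covers A m].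
Proof.
split; first by exists (L (cst 1)); exact: covers_one.
by exists 0 => m /covers_ge0.
Qed.
Lemma riesz_value_le A m : covers A m -> riesz_value A <= m.
Proof. by move=> c; apply: ge_inf => //; case: (covers_has_inf A). Qed.
Lemma riesz_value_ge0 A : 0 <= riesz_value A.
Proof.
apply: lb_le_inf => [|m /covers_ge0 //]; by case: (covers_has_inf A).
Qed.
Lemma riesz_value_adherent A e : 0 < e -> exists2 m, covers A m & m < riesz_value A + e.
Proof. by move=> e0; exact: inf_adherent e0 (covers_has_inf A). Qed.
Lemma covers_mono A B m : A `<=` B -> covers B m -> covers A m.
Proof. by move=> AB [F [? ? ? h ?]]; exists F; split=> // x /AB; exact: h. Qed.
Lemma riesz_value_mono A B : A `<=` B -> riesz_value A <= riesz_value B.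
Proof.
move=> AB; apply: lb_le_inf; first by case: (covers_has_inf B).
by move=> m /(covers_mono AB); exact: riesz_value_le.
Qed.

Lemma riesz_value0 : riesz_value set0 = 0.
Proof.
apply/eqP; rewrite eq_le riesz_value_ge0 andbT; apply: riesz_value_le.
exists (fun _ => 0); split=> //; first by move=> _; exact: cont_cst.
by move=> _; rewrite pf0.
Qed.

Lemma covers_bigcup (A : nat -> set X) (m : nat -> R) M :
  (forall k, covers (A k) (m k)) -> (forall n, \sum_(k < n) m k <= M) ->
  covers (\bigcup_k A k) M.
Proof.
move=> /choice[F hF] mM.
have cF k n : continuous (F k n) by case: (hF k).
have F0 k n x : 0 <= F k n x by case: (hF k).
have iF k n x : F k n x <= F k n.+1 x by case: (hF k).
have sE n x : (\sum_(k < n) F k n) x = \sum_(k < n) F k n x by rewrite fct_sumE.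
exists (fun n => \sum_(k < n) F k n); split=> [n|n x|n x|x [k _ Akx]|n].
- exact: (@cont_sum (fun k => F k n)).
- by rewrite sE sumr_ge0.
- by rewrite !sE big_ord_recr /= -[leLHS]addr0 lerD // ler_sum.
- have [n hn] : exists n, 1 <= F k n x by case: (hF k) => _ _ _ /(_ x Akx).
  (* The index must exceed k for the k-th summand to be present, and reach n for that summand to be
     at least 1. *)
  exists (maxn n k.+1); rewrite sE.
  have kn : (k < maxn n k.+1)%N by rewrite leq_maxr.
  rewrite (bigD1 (Ordinal kn)) //= -[leLHS]addr0 lerD ?sumr_ge0 //.
  by rewrite (le_trans hn) // homo_seq // leq_maxl.
- rewrite (@pf_sum (fun k => F k n)) //; apply: le_trans (mM n).
  by apply: ler_sum => k _; case: (hF k).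
Qed.

Lemma riesz_outer0 : riesz_outer set0 = 0%E.
Proof. by rewrite /riesz_outer riesz_value0. Qed.
Lemma riesz_outer_ge0 A : (0 <= riesz_outer A)%E.
Proof. by rewrite lee_fin riesz_value_ge0. Qed.
Lemma riesz_outer_mono : {homo riesz_outer : A B / A `<=` B >-> (A <= B)%E}.
Proof. by move=> A B AB; rewrite lee_fin riesz_value_mono. Qed.

Lemma riesz_outer_sigma_subadditive : sigma_subadditive riesz_outer.
Proof.
move=> A.
have S0 : (0 <= \sum_(i <oo) riesz_outer (A i))%E.
  by apply: nneseries_ge0 => n _ _; exact: riesz_outer_ge0.
case E : (\sum_(i <oo) riesz_outer (A i))%E S0 => [M||] // M0; last by rewrite leey.
rewrite lee_fin; apply/ler_addgt0Pr => e e0.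
have h k : exists m, covers (A k) m /\ m < riesz_value (A k) + e / (2 ^ k.+1)%:R.
  have [|m hm lm] := @riesz_value_adherent (A k) (e / (2 ^ k.+1)%:R).
    by rewrite divr_gt0 // ltr0n expn_gt0.
  by exists m.
have /choice[m hm] := h.
apply: riesz_value_le; apply: (@covers_bigcup _ m) => [k|n]; first by case: (hm k).
apply: (@le_trans _ _ (\sum_(k < n) riesz_value (A k) + \sum_(k < n) e / (2 ^ k.+1)%:R)).
  by rewrite -big_split; apply: ler_sum => k _; apply/ltW; case: (hm k).
rewrite lerD //.
  rewrite -lee_fin -E -sumEFin.
  rewrite -(big_mkord xpredT (fun k => riesz_outer (A k))).
  by apply: nneseries_lim_ge => k _ _; exact: riesz_outer_ge0.
have -> : \sum_(k < n) e / (2 ^ k.+1)%:R = e * (1 - (2 ^- n)).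
  elim: n => [|n ih]; first by rewrite big_ord0 expr0 invr1 subrr mulr0.
  rewrite big_ord_recr /= ih natrX exprS; have : (2 : R) ^+ n != 0 by rewrite expf_neq0.
  by move=> ?; field.
by rewrite ler_piMr ?(ltW e0) // gerBl invr_ge0 exprn_ge0.
Qed.

HB.instance Definition _ := isOuterMeasure.Build R X riesz_outer
  riesz_outer0 riesz_outer_ge0 riesz_outer_mono riesz_outer_sigma_subadditive.

(** A cover F of E splits into F chi, which covers the part of E in U, and F (1 - chi), which covers
    the part outside U because chi vanishes there; the costs add up to that of F. *)
Lemma riesz_caratheodory (U : set X) (chi : nat -> X -> R) :
  (forall n, continuous (chi n)) -> (forall n x, 0 <= chi n x <= 1) ->
  (forall n x, chi n x <= chi n.+1 x) -> (forall n x, ~ U x -> chi n x = 0) ->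
  (forall x, U x -> exists n, 1 <= chi n x) ->
  riesz_outer.-caratheodory U.
Proof.
move=> cc c01 ic c0 c1; apply: le_caratheodory_measurable => E.
rewrite -EFinD lee_fin.
suff h m : covers E m -> riesz_value (E `&` U) + riesz_value (E `&` ~` U) <= m.
  by apply: lb_le_inf => [|m /h //]; case: (covers_has_inf E).
move=> [F [cF F0 iF F1 Fm]].
have cFc n k : continuous (fun x => F n x * chi k x) by exact: contM.
pose a := sup [set L (fun x => F n x * chi n x) | n in [set: nat]].
have chi1 n x : chi n x <= 1 by case/andP: (c01 n x).
have chi0 n x : 0 <= chi n x by case/andP: (c01 n x).
have hs : has_sup [set L (fun x => F n x * chi n x) | n in [set: nat]].
  split; first by exists (L (fun x => F 0%N x * chi 0%N x)); exists 0%N.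
  exists m => _ [n _ <-]; apply: le_trans (Fm n); apply: pf_le => // x.
  by rewrite ler_piMr.
have EU : riesz_value (E `&` U) <= a.
  apply: riesz_value_le; exists (fun n x => F n x * chi n x); split=> //.
  - by move=> n x; rewrite mulr_ge0.
  - by move=> n x; rewrite ler_pM.
  - move=> x [Ex Ux]; have [n hn] := F1 x Ex; have [k hk] := c1 x Ux.
    exists (maxn n k); rewrite -[leLHS]mulr1 ler_pM //.
      by rewrite (le_trans hn) // homo_seq // leq_maxl.
    by rewrite (le_trans hk) // homo_seq // leq_maxr.
  - by move=> n; apply: ub_le_sup; [case: hs | exists n].
have gap n k x : (F n - (fun x => F n x * chi k x)) x = F n x * (1 - chi k x).
  by rewrite mulrBr mulr1.
(* Here chi is frozen at one index k, since F n (1 - chi n) need not increase with n. A k at which L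
   (F k chi k) is within e of its supremum [a] loses at most e. *)
have ED e : 0 < e -> riesz_value (E `&` ~` U) <= m - a + e.
  move=> e0; have [_ [k _ <-] hk] := sup_adherent e0 hs.
  apply: riesz_value_le; exists (fun n => F n - (fun x => F n x * chi k x)); split.
  - by move=> n; apply: contB.
  - by move=> n x; rewrite gap mulr_ge0 // subr_ge0.
  - by move=> n x; rewrite !gap ler_wpM2r // subr_ge0.
  - move=> x [Ex Ux]; have [n hn] := F1 x Ex; exists n.
    by rewrite gap c0 // subr0 mulr1.
  - move=> n; pose N := maxn n k.
    apply: (@le_trans _ _ (L (F N - (fun x => F N x * chi k x)))).
      apply: pf_le; [exact: contB|exact: contB|move=> x].
      by rewrite !gap ler_wpM2r ?subr_ge0 // homo_seq // leq_maxl.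
    rewrite pfB //.
    have h1 : L (fun x => F k x * chi k x) <= L (fun x => F N x * chi k x).
      by apply: pf_le => // x; rewrite ler_wpM2r // homo_seq // leq_maxr.
    by have := Fm N; move: hk h1; rewrite -/a; lra.
apply/ler_addgt0Pr => e e0; have := ED e e0; have := EU; lra.
Qed.

Hypothesis cX : compact [set: X].

Lemma dini (F : nat -> X -> R) (t : R) : (forall n, continuous (F n)) ->
  (forall n x, F n x <= F n.+1 x) -> (forall x, exists n, t < F n x) ->
  exists n, forall x, t < F n x.
Proof.
move=> cF iF Ft.
have /compact_near_coveringP/(_ nat \oo (fun n x => t < F n x) _) := cX.
move=> h; have /h [N _ hN] : forall x, [set: X] x -> \forall x' \near x & i \near \oo, t < F i x'.
  move=> x _; have [n hn] := Ft x.
  exists ([set x' | t < F n x'], [set i | (n <= i)%N]) => /=.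
    split; last by exists n.
    exact: (cvgr_gt _ (cF n x) _ hn).
  by move=> [x' i] /= [h1 h2]; rewrite (lt_le_trans h1) // homo_seq.
exists N => x; exact: (hN N (leqnn N) x).
Qed.

(** By Dini's argument, a cover of the compact space exceeds 1 - d everywhere at some finite stage,
    so it cannot cost much less than L 1. *)
Lemma riesz_valueT : riesz_value setT = L (cst 1).
Proof.
have c1 : continuous (cst 1 : X -> R) by exact: cont_cst.
have L1 : 0 <= L (cst 1) by apply: pf_ge0.
apply/eqP; rewrite eq_le riesz_value_le /=; last exact: covers_one.
apply: lb_le_inf => [|m [F [cF F0 iF F1 Fm]]]; first by case: (covers_has_inf setT).
apply/ler_addgt0Pr => e e0.
have C0 : 0 < L (cst 1) + 1 by rewrite ltr_wpDl.
pose d := e / (L (cst 1) + 1); have d0 : 0 < d by rewrite divr_gt0.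
have [x|n hn] := @dini F (1 - d) cF iF.
  by have [n hn] := F1 x I; exists n; rewrite (lt_le_trans _ hn) // ltrBlDr ltrDl.
have := Fm n; have : L (fun x => (1 - d) * (cst 1 : X -> R) x) <= L (F n).
  apply: pf_le => [||x]; [by apply: contM => //; exact: cont_cst|exact: cF|].
  by rewrite /cst mulr1 ltW.
rewrite pfZ // => h1 h2; have : d * L (cst 1) <= e.
  by rewrite /d mulrAC ler_pdivrMr // ler_wpM2l ?(ltW e0) // lerDl.
by rewrite mulrBl mul1r in h1; lra.
Qed.
End continuous_real_functions.

Section borel.
Variables (R : realType) (X : ptopologicalType).

Lemma borel_open (U : set X) : open U -> measurable (U : set (borel X)).
Proof. by move=> oU; apply: sub_sigma_algebra. Qed.

Lemma continuous_borel_measurable (f : X -> R) : continuous f ->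
  measurable_fun [set: borel X] (f : borel X -> R).
Proof.
move=> /continuousP cf; apply: (measurability _ (RGenOpens.measurableE R)).
move=> _ [_ [a [b ->] <-]]; rewrite setTI; apply: borel_open.
exact/cf/interval_open.
Qed.
End borel.

(** * Bump functions and separating sequences from a metric *)

Section metric_bump.
Variables (R : realType) (X : pmetricType R).

Implicit Types (U : set X) (x y z : X).

(** The distance to the complement of U. For U = X this is the infimum of an empty set, so
    nonemptiness of the complement is assumed where it matters and U = X is treated apart. *)
Definition gap U x : R := inf [set mdist x y | y in ~` U].

Lemma gap_has_lbound (U : set X) (x : X) : has_lbound [set mdist x y | y in ~` U].
Proof. by exists 0 => _ [y _ <-]; exact: mdist_ge0. Qed.

Lemma gap_lipschitz U x y : ~` U !=set0 -> gap U x <= mdist x y + gap U y.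
Proof.
move=> [z Uz]; rewrite -lerBlDl; apply: lb_le_inf; first by exists (mdist y z); exists z.
move=> _ [w Uw <-]; rewrite lerBlDl; apply: le_trans (metric_triangle x y w).
by apply: ge_inf; [exact: gap_has_lbound|exists w].
Qed.

Lemma gap_continuous U : ~` U !=set0 -> continuous (gap U).
Proof.
move=> U0 x; apply/cvgrPdist_lt => e e0.
have := nbhsx_ballx x e e0; apply: filterS => y; rewrite ballEmdist /= => xy.
rewrite (le_lt_trans _ xy) // ler_norml; apply/andP; split.
  by have := gap_lipschitz y x U0; rewrite metric_sym; lra.
by have := gap_lipschitz x y U0; lra.
Qed.

Lemma gap_eq0 U x : ~ U x -> gap U x = 0.
Proof.
move=> Ux; apply/eqP; rewrite eq_le; apply/andP; split.
  by rewrite -(mdistxx x); apply: ge_inf; [exact: gap_has_lbound|exists x].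
by apply: lb_le_inf; [exists (mdist x x); exists x|move=> _ [y _ <-]; exact: mdist_ge0].
Qed.

Lemma gap_gt0 U x : ~` U !=set0 -> open U -> U x -> 0 < gap U x.
Proof.
move=> [z Uz] oU Ux.
have /nbhs_ballP[e /= e0 eU] := open_nbhs_nbhs (conj oU Ux).
apply: (lt_le_trans e0); apply: lb_le_inf; first by exists (mdist x z); exists z.
move=> _ [y Uy <-]; rewrite leNgt; apply/negP => xy; apply: Uy; apply: eU.
by rewrite ballEmdist.
Qed.

Lemma open_bump (U : set X) : open U -> exists chi : nat -> X -> R,
  [/\ forall n, continuous (chi n), forall n x, 0 <= chi n x <= 1,
      forall n x, chi n x <= chi n.+1 x, forall n x, ~ U x -> chi n x = 0
    & forall x, U x -> exists n, 1 <= chi n x].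
Proof.
move=> oU; have [U0|/set0P/negP/negPn/eqP U0] := pselect (~` U !=set0); last first.
  have UT x : U x by apply: contrapT => Ux; have : (~` U) x by []; rewrite U0.
  exists (fun _ => cst 1); split=> //.
  - by move=> _; exact: cont_cst.
  - by move=> n x; rewrite /cst ler01 lexx.
  - by move=> x _; exists 0%N.
have g0 x : 0 <= gap U x.
  by case: (U0) => z Uz; apply: lb_le_inf; [exists (mdist x z); exists z|move=> _ [y _ <-]; exact: mdist_ge0].
exists (fun n x => Num.min (n%:R * gap U x) 1); split=> [n|n x|n x|n x Ux|x Ux].
- by apply: cont_min; [apply: contM; [exact: cont_cst|exact: gap_continuous]|exact: cont_cst].
- by rewrite ge_min lexx orbT le_min ler01 mulr_ge0.
- by rewrite le_min ge_min ler_wpM2r ?ler_nat //= ge_min lexx orbT.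
- rewrite gap_eq0 //.
  by rewrite mulr0 min_l.
- have gp := gap_gt0 U0 oU Ux.
  exists (Num.bound (gap U x)^-1); rewrite le_min lexx andbT.
  by rewrite -ler_pdivrMr // div1r ltW // archi_boundP // invr_ge0 ltW.
Qed.

(** Distances to the complements of a countable base: a basic neighbourhood of x contained in a ball
    that excludes y has positive gap at x and zero gap at y. *)
Lemma separating_sequence : compact [set: X] -> exists k : nat -> X -> R,
  (forall n, continuous (k n)) /\ forall x y, (forall n, k n x = k n y) -> x = y.
Proof.
move=> cX; have [B cB [oB bB]] := @compact_second_countable R X cX.
have /pcard_injP[e] := cB.
pose bump U : X -> R := match pselect (~` U !=set0) with
  left _ => gap U | right _ => cst 0 end.
have bc U : continuous (bump U).
  by rewrite /bump; case: pselect => [U0|_]; [exact: gap_continuous|exact: cont_cst].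
pose V n := xget set0 [set U | B U /\ e U = n].
exists (fun n => bump (V n)); split=> [n|x y kxy]; first exact: bc.
apply: contrapT => xy.
have d0 : 0 < mdist x y by rewrite mdist_gt0; apply/eqP.
have [U [BU Ux] Uball] := bB x _ (nbhsx_ballx x _ d0).
have Uy : ~ U y by move=> /Uball; rewrite ballEmdist /= ltxx.
have VU : V (e U) = U.
  have [BV eV] := @xgetPex _ set0 [set W | B W /\ e W = e U] (ex_intro _ U (conj BU erefl)).
  by apply: p => //; rewrite inE.
have U0 : ~` U !=set0 by exists y.
have := kxy (e U); rewrite VU /bump; case: pselect => // _.
by rewrite (gap_eq0 Uy) => h; have := gap_gt0 U0 (oB _ BU) Ux; rewrite h ltxx.
Qed.
End metric_bump.

Section riesz_measure.
Variables (R : realType) (X : pmetricType R) (L : positive_functional R X).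
Local Notation T := (borel X).

Lemma borel_caratheodory (A : set T) : measurable A -> (riesz_outer L).-caratheodory A.
Proof.
apply: smallest_sub; last first.
  by move=> U /open_bump[chi [a b c d e]]; exact: (riesz_caratheodory L a b c d e).
split.
- exact: caratheodory_measurable_set0.
- by move=> B mB; rewrite setTD; exact: caratheodory_measurable_setC.
- by move=> F mF; exact: caratheodory_measurable_bigcup.
Qed.

Definition riesz_measure (A : set T) : \bar R := riesz_outer L A.

Lemma riesz_measure_semi_sigma_additive : semi_sigma_additive riesz_measure.
Proof.
move=> F mF tF mUF.
apply: (@caratheodory_measure_sigma_additive R X (riesz_outer L) F) => //.
  by move=> i; exact: borel_caratheodory.
exact: borel_caratheodory.
Qed.

HB.instance Definition _ := isMeasure.Build _ T R riesz_measure
  (riesz_outer0 L) (riesz_outer_ge0 L) riesz_measure_semi_sigma_additive.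

Lemma riesz_measure_fin : fin_num_fun riesz_measure.
Proof. by []. Qed.
HB.instance Definition _ := @Measure_isFinite.Build _ T R riesz_measure riesz_measure_fin.

Lemma riesz_measure_le (A : set T) m : covers L A m -> fine (riesz_measure A) <= m.
Proof. exact: riesz_value_le. Qed.
End riesz_measure.

Section bounded_measurable.
Context d (T : measurableType d) (R : realType) (mu : {finite_measure set T -> \bar R}).
Implicit Types f g : T -> R.

Definition intg f := mu.-integrable [set: T] (EFin \o f).

Lemma bounded_intg f M : measurable_fun [set: T] f -> (forall x, `|f x| <= M) -> intg f.
Proof.
move=> mf fM; apply: measurable_bounded_integrable => //.
  by rewrite -ge0_fin_numE ?fin_num_measure.
exists M; split; first exact: num_real.
by move=> y My x _ /=; rewrite (le_trans (fM x)) // ltW.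
Qed.
Lemma intg_cst (a : R) : intg (cst a).
Proof. by apply: (@bounded_intg _ `|a|). Qed.
Lemma intgD f g : intg f -> intg g -> intg (fun x => f x + g x).
Proof. by move=> hf hg; have := integrableD measurableT hf hg. Qed.
Lemma intgB f g : intg f -> intg g -> intg (fun x => f x - g x).
Proof. by move=> hf hg; have := integrableB measurableT hf hg. Qed.
Lemma intgZ (a : R) f : intg f -> intg (fun x => a * f x).
Proof. by move=> hf; have := integrableZl measurableT a hf. Qed.
Lemma intg_sum (I : Type) (r : seq I) (F : I -> T -> R) :
  (forall i, intg (F i)) -> intg (fun x => \sum_(i <- r) F i x).
Proof.
move=> hF; elim: r => [|i r ih].
  by under eq_fun do rewrite big_nil; exact: intg_cst.
by under eq_fun do rewrite big_cons; exact: intgD.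
Qed.
Lemma intgM f g M : intg f -> measurable_fun [set: T] g -> (forall x, `|g x| <= M) ->
  intg (fun x => g x * f x).
Proof.
move=> hf mg gM.
have bg : [bounded g x | x in [set: T]].
  exists M; split; first exact: num_real.
  by move=> y My x _ /=; rewrite (le_trans (gM x)) // ltW.
by have := integrableMr measurableT mg bg hf.
Qed.
Lemma intg_indic (A : set T) : measurable A -> intg (\1_A : T -> R).
Proof.
move=> mA; apply: (@bounded_intg _ 1); first exact: measurable_indic.
by move=> x; rewrite indicE; case: (_ \in _); rewrite ?normr1 // normr0 ler01.
Qed.

Lemma Rintegral_indic (A : set T) : measurable A -> Rintegral mu setT (\1_A) = fine (mu A).
Proof. by move=> mA; rewrite /Rintegral integral_indic // setIT. Qed.

Lemma Rintegral_sum (I : Type) (r : seq I) (F : I -> T -> R) :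
  (forall i, intg (F i)) ->
  Rintegral mu setT (fun x => \sum_(i <- r) F i x) = \sum_(i <- r) Rintegral mu setT (F i).
Proof.
move=> hF; elim: r => [|i r ih].
  rewrite big_nil; under eq_fun do rewrite big_nil.
  by rewrite Rintegral_cst // mul0r.
rewrite big_cons; under eq_fun do rewrite big_cons.
by rewrite RintegralD // ?ih //; [exact: hF|exact: intg_sum].
Qed.
End bounded_measurable.

Section riesz_integral.
Variables (R : realType) (X : pmetricType R) (L : positive_functional R X).
Hypothesis cX : compact [set: X].
Local Notation T := (borel X).
Local Notation mu := (riesz_measure L : {finite_measure set T -> \bar R}).
Local Notation I f := (Rintegral mu setT f).

Lemma riesz_measureT : fine (mu setT) = L (cst 1).
Proof. exact: riesz_valueT. Qed.

Lemma continuous_intg (f : X -> R) : continuous f -> intg mu (f : T -> R).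
Proof.
move=> cf; have [M hM] := compact_continuous_bounded cX cf.
exact: bounded_intg (continuous_borel_measurable cf) hM.
Qed.

(** A layer-cake count of n f. Its level sets S k satisfy n f <= 1 + sum of their indicators, and
    the truncations satisfy F (k+1) - F k >= 1 on S k, which bounds the measure of S k. Telescoping
    gives n I(f) <= n L f + L 1, where the error does not grow with n. *)
Lemma riesz_integral_le01 (f : X -> R) : continuous f -> (forall x, 0 <= f x <= 1) ->
  I f <= L f.
Proof.
move=> cf f01.
have f0 x : 0 <= f x by case/andP: (f01 x).
have f1 x : f x <= 1 by case/andP: (f01 x).
have L1 : 0 <= L (cst 1) by apply: pf_ge0; [exact: cont_cst|].
suff h n : (0 < n)%N -> n%:R * I f <= n%:R * L f + L (cst 1).
  apply/ler_addgt0Pr => e e0.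
  pose n := (Num.bound (L (cst 1) / e)).+1.
  have n0 : 0 < n%:R :> R by rewrite ltr0n.
  rewrite -(ler_pM2l n0) (le_trans (h n _)) // mulrDr lerD2l.
  rewrite -ler_pdivrMr // (le_trans (ltW (archi_boundP _))) ?divr_ge0 ?(ltW e0) //.
  by rewrite ler_nat.
move=> n0; pose t x := n%:R * f x.
have ct : continuous t by apply: contM => //; exact: cont_cst.
pose F (k : nat) x := Num.min (t x) k%:R.
have cF k : continuous (F k) by apply: cont_min => //; exact: cont_cst.
pose S k : set T := [set x | k.+1%:R <= t x].
have mS k : measurable (S k).
  have -> : S k = ~` [set x | t x < k.+1%:R].
    by apply/seteqP; split=> x; rewrite /S /= leNgt => /negP.
  have /continuousP h := ct; apply: measurableC.
  have oS : open [set x : X | t x < k.+1%:R] by exact: (h _ (@open_lt R k.+1%:R)).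
  exact: (borel_open oS).
have Sle k : fine (mu (S k)) <= L (F k.+1) - L (F k).
  rewrite -pfB //; apply: riesz_measure_le; exists (fun _ => F k.+1 - F k); split=> //.
  - by move=> _; exact: contB.
  - by move=> _ x; rewrite subr_ge0 /F le_min !ge_min lexx /= ler_nat leqnSn orbT.
  - move=> x Sx; exists 0%N; have -> : (F k.+1 - F k) x = F k.+1 x - F k x by [].
    rewrite /F min_r // min_r; first by rewrite -natr1 addrAC subrr add0r.
    by rewrite (le_trans _ Sx) // ler_nat.
have sumS : \sum_(k < n) fine (mu (S k)) <= n%:R * L f.
  apply: (@le_trans _ _ (\sum_(k < n) (L (F k.+1) - L (F k)))); first exact: ler_sum.
  rewrite -(big_mkord xpredT (fun k => L (F k.+1) - L (F k))) telescope_sumr // -pfZ //.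
  have -> : F n = t by apply/funext => x; rewrite /F min_l // /t ler_piMr.
  have -> : F 0%N = 0.
    by apply/funext => x; rewrite /F min_r // /t mulr_ge0.
  by rewrite pf0 subr0.
have tle x : t x <= 1 + \sum_(k < n) \1_(S k) x.
  have tE : t x = \sum_(0 <= k < n) (F k.+1 x - F k x).
    rewrite telescope_sumr // /F min_l; last by rewrite /t ler_piMr.
    by rewrite min_r ?subr0 // /t mulr_ge0.
  rewrite tE; case: (n) n0 => // m _; rewrite big_nat_recl // -(big_mkord xpredT (fun k => \1_(S k) x)) big_nat_recr //=.
  apply: lerD; first by rewrite /F lerBlDr ge_min lerDl le_min mulr_ge0 //= lexx orbT.
  rewrite -[leLHS]addr0; apply: lerD; last by rewrite indicE ler0n.
  apply: ler_sum => k _; rewrite indicE.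
  have [h|h] := leP (k.+1%:R) (t x).
    rewrite (mem_set (h : S k x)) /F lerBlDr ge_min; apply/orP; right.
    by rewrite min_r // -natr1 addrC.
  rewrite memNset; last by move=> h'; move: (lt_le_trans h h'); rewrite ltxx.
  rewrite /F !min_l ?subrr //; apply/ltW => //.
  by rewrite (lt_le_trans h) // ler_nat.
have mi k : intg mu (\1_(S k) : T -> R) by exact: intg_indic.
rewrite -RintegralZl //; last exact: continuous_intg.
apply: (@le_trans _ _ (I (fun x => 1 + \sum_(k < n) \1_(S k) x))).
  apply: le_Rintegral => //.
  - exact: continuous_intg.
  - by apply: intgD; [exact: intg_cst|exact: intg_sum].
  - by move=> x _; exact: tle.
rewrite RintegralD //; [|exact: intg_cst|exact: intg_sum].
rewrite Rintegral_cst // mul1r riesz_measureT Rintegral_sum // addrC lerD2r.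
apply: le_trans sumS; apply: ler_sum => k _.
by rewrite Rintegral_indic.
Qed.

(** The inequality for g and for 1 - g, together with equality of the total masses, forces equality;
    an affine change brings f into [0, 1]. *)
Lemma riesz_integral (f : X -> R) : continuous f -> I f = L f.
Proof.
move=> cf; have [M hM] := compact_continuous_bounded cX cf.
have M0 : 0 <= M by rewrite (le_trans (normr_ge0 (f point))).
(* The summand 1 keeps the denominator positive when M = 0. *)
pose a : R := (M + M + 1)^-1.
have a0 : 0 < a by rewrite invr_gt0 ltr_wpDl // addr_ge0.
pose g x := a * (f + cst M) x.
have cfM : continuous (f + cst M) by apply: contD => //; exact: cont_cst.
have cg : continuous g by apply: contM => //; exact: cont_cst.
have g01 x : 0 <= g x <= 1.
  have := hM x; rewrite ler_norml => /andP[h1 h2].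
  have e : (f + cst M) x = f x + M by [].
  rewrite /g e; apply/andP; split; first by apply: mulr_ge0; [exact: ltW|lra].
  rewrite mulrC ler_pdivrMr ?mul1r; first by lra.
  by rewrite ltr_wpDl // addr_ge0.
have h1 := riesz_integral_le01 cg g01.
have c1 : continuous (cst 1 : X -> R) by exact: cont_cst.
have cg' : continuous (cst 1 - g) by exact: contB.
have h2 : I (cst 1 - g) <= L (cst 1 - g).
  apply: riesz_integral_le01 => // x; have /andP[g0 g1] := g01 x.
  by rewrite subr_ge0 g1 /= lerBlDr lerDl.
have e : I g = L g.
  apply/eqP; rewrite eq_le h1 /=; move: h2.
  rewrite pfB // [leLHS]RintegralB //; [|exact: continuous_intg|exact: continuous_intg].
  by rewrite Rintegral_cst // mul1r riesz_measureT; lra.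
move: e; rewrite /g [LHS]RintegralZl //; last exact: continuous_intg.
rewrite pfZ // => /(mulfI (lt0r_neq0 a0)).
rewrite pfD //; last exact: cont_cst.
rewrite [LHS]RintegralD //; [|exact: continuous_intg|exact: intg_cst].
rewrite Rintegral_cst // riesz_measureT.
have -> : L (cst M) = M * L (cst 1).
  by rewrite -pfZ //; congr pf_fun; apply/funext => x; rewrite /cst mulr1.
exact: addIr.
Qed.

Lemma riesz_probability : L (cst 1) = 1 ->
  exists P : probability T R, (forall A, P A = mu A) /\
    forall f : X -> R, continuous f -> Rintegral P setT f = L f.
Proof.
move=> L1; have h : riesz_measure L setT = 1%E.
  by rewrite -[LHS]/((fine (mu setT))%:E) riesz_measureT L1.
pose P : probability T R := HB.pack (riesz_measure L)
  (Measure_isProbability.Build _ T R (riesz_measure L) h).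
by exists P; split=> // f; exact: riesz_integral.
Qed.
End riesz_integral.

(** * Densities of dominated functionals *)

Section dominated_limit.
Context d (T : measurableType d) (R : realType) (mu : {finite_measure set T -> \bar R}).

Lemma Rintegral_lim0 (f : nat -> T -> R) (g h : T -> R) : intg mu h ->
  (forall n, intg mu (f n)) -> (forall n x, `|f n x| <= `|h x|) ->
  (forall x, f n x @[n --> \oo] --> g x) ->
  (forall n, Rintegral mu setT (f n) = 0) -> Rintegral mu setT g = 0.
Proof.
move=> hi fi fh fg f0.
have mf n : measurable_fun [set: T] (f n) by apply/measurable_EFinP; exact: measurable_int (fi n).
have mg : measurable_fun [set: T] g by apply: (measurable_fun_cvg mf) => x _; exact: fg.
have [|||||_ _ cv] := @dominated_convergence _ _ _ mu setT measurableT
    (fun n => EFin \o f n) (EFin \o g) (fun x => (`|h x|)%:E).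
- by move=> n; apply/measurable_EFinP.
- exact/measurable_EFinP.
- by apply: aeW => x _; apply: cvg_EFin; [exact: nearW|exact: fg].
- exact: integrable_norm.
- by apply: aeW => x n _; rewrite lee_fin.
have e n : (\int[mu]_x (EFin \o f n) x = 0)%E.
  have fn : (\int[mu]_x (EFin \o f n) x)%E \is a fin_num.
    by apply: integrable_fin_num => //; exact: fi.
  by rewrite -(fineK fn); exact: (congr1 EFin (f0 n)).
have := cvg_lim _ cv; under eq_fun do rewrite e.
by rewrite lim_cst // => /(_ (@ereal_hausdorff _)) h0; rewrite /Rintegral -h0.
Qed.

Lemma intg_measurable (f : T -> R) : intg mu f -> measurable_fun [set: T] f.
Proof. by move=> fi; apply/measurable_EFinP; exact: measurable_int fi. Qed.
End dominated_limit.

Section density_uniqueness.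
Variables (R : realType) (X : pmetricType R).
Local Notation T := (borel X).
Variable mu : {finite_measure set T -> \bar R}.

Lemma indic_mul_intg (A : set T) (h : T -> R) : measurable A -> intg mu h ->
  intg mu (fun x => \1_A x * h x).
Proof.
move=> mA hi; apply: (@intgM _ _ _ _ _ _ 1) => //.
by move=> x; rewrite indicE; case: (_ \in _); rewrite ?normr1 // normr0 ler01.
Qed.

Lemma indic_mul_le (A : set T) (h : T -> R) x : `|\1_A x * h x| <= `|h x|.
Proof.
rewrite normrM ler_piMl // indicE; case: (_ \in _); rewrite ?normr1 //.
by rewrite normr0 ler01.
Qed.

(** The Borel sets over which h integrates to zero form a lambda-system. It contains the open sets,
    whose indicators are pointwise limits of continuous functions, and these are stable under
    intersection. *)
Lemma density_eq0 (h : T -> R) : intg mu h ->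
  (forall f : X -> R, continuous f -> (forall x, 0 <= f x <= 1) ->
     Rintegral mu setT (fun x => f x * h x) = 0) ->
  {ae mu, forall x, h x = 0}.
Proof.
move=> hi hf.
pose H := [set A : set T | measurable A /\ Rintegral mu setT (fun x => \1_A x * h x) = 0].
have HT : H setT.
  split=> //; rewrite -(hf (cst 1)) //; first last.
  - by move=> x; rewrite /cst ler01 lexx.
  - exact: cont_cst.
  by congr Rintegral; apply/funext => x; rewrite indicT.
have lH : lambda_system setT H.
  split=> //.
  - move=> A B BA [mA A0] [mB B0]; split; first exact: measurableD.
    have -> : (fun x => \1_(A `\` B) x * h x) = (fun x => \1_A x * h x - \1_B x * h x).
      apply/funext => x; rewrite -mulrBl; congr (_ * _).
      rewrite !indicE; have [Bx|Bx] := pselect (B x).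
        rewrite (mem_set Bx) (mem_set (BA _ Bx)) memNset ?subrr //.
        by move=> [].
      rewrite (memNset Bx) subr0; have [Ax|Ax] := pselect (A x).
        by rewrite !mem_set.
      by rewrite !memNset // => -[].
    by rewrite RintegralB ?A0 ?B0 ?subrr //; exact: indic_mul_intg.
  - move=> F ndF HF; split; first by apply: bigcupT_measurable => i; case: (HF i).
    apply: (@Rintegral_lim0 _ _ _ mu (fun n x => \1_(F n) x * h x) _ h) => //.
    + by move=> n; apply: indic_mul_intg => //; case: (HF n).
    + by move=> n x; exact: indic_mul_le.
    + move=> x; apply: cvgMl; have [[k _ Fkx]|Fx] := pselect ((\bigcup_i F i) x).
        apply: cvg_near_cst; exists k => // n /= kn.
        have Fnx : F n x by have /subsetPset := ndF _ _ kn; exact.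
        by rewrite !indicE (mem_set Fnx) mem_set //; exists k.
      apply: cvg_near_cst; apply: nearW => n; rewrite !indicE !memNset // => Fnx.
      by apply: Fx; exists n.
    + by move=> n; case: (HF n).
have oH : @open X `<=` H.
  move=> U oU; split; first exact: borel_open.
  have [chi [cc c01 ic c0 c1]] := open_bump oU.
  have ci n x : `|chi n x| <= 1.
    by have /andP[h0 h1] := c01 n x; rewrite ger0_norm.
  apply: (@Rintegral_lim0 _ _ _ mu (fun n x => chi n x * h x) _ h) => //.
  + by move=> n; apply: (@intgM _ _ _ _ _ _ 1) => //; exact: continuous_borel_measurable.
  + by move=> n x; rewrite normrM ler_piMl.
  + move=> x; apply: cvgMl; have [Ux|Ux] := pselect (U x).
      have [k hk] := c1 x Ux; apply: cvg_near_cst; exists k => // n /= kn.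
      rewrite indicE mem_set //; apply/eqP; rewrite eq_le (le_trans (ler_norm _) (ci _ _)) /=.
      by rewrite (le_trans hk) // (@homo_seq R X chi x).
    by apply: cvg_near_cst; apply: nearW => n; rewrite indicE memNset // c0.
  + by move=> n; exact: hf.
have mH (A : set T) : measurable A -> H A.
  apply: (lambda_system_subset _ lH oH) => //.
  by move=> U V oU oV; exact: openI.
have := @integral_ae_eq _ T R mu setT measurableT (cst 0%E) (EFin \o h) hi (measurable_cst _).
have hh : forall E : set T, E `<=` setT -> measurable E ->
   (\int[mu]_(x in E) (EFin \o h) x)%E = (\int[mu]_(x in E) cst 0 x)%E.
  move=> E _ mE; rewrite integral0 -[LHS]fineK; last first.
    by apply: integrable_fin_num => //; apply: integrableS hi.
  congr EFin; have [_ <-] := mH E mE.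
  rewrite -[LHS]/(Rintegral mu E h) Rintegral_mkcond; congr Rintegral.
  apply/funext => x; rewrite patchE indicE; case: ifP => _; by rewrite ?mul1r ?mul0r.
by move=> /(_ hh); apply: filterS => x /(_ I) [].
Qed.
End density_uniqueness.

Section density_existence.
Variables (R : realType) (X : pmetricType R) (L L' : positive_functional R X).
Local Notation T := (borel X).
Hypothesis cX : compact [set: X].
Variables (P : probability T R) (C : R).
Hypothesis PE : forall A, P A = riesz_measure L A.
Hypothesis L'L : forall f : X -> R, continuous f -> (forall x, 0 <= f x) -> L' f <= C * L f.

(** A set of measure zero has covers of arbitrarily small cost for [L], and the same covers cost at
    most a fixed multiple of that for [L']. *)
Lemma riesz_dominates : riesz_measure L' `<< P.
Proof.
move=> N nN A mA AN; have A0 := nN A mA AN.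
have C1 : 0 < `|C| + 1 by rewrite ltr_wpDl.
have h : riesz_value L A = 0 by have := A0; rewrite PE => -[].
rewrite /riesz_measure /riesz_outer; congr EFin.
apply/eqP; rewrite eq_le riesz_value_ge0 andbT; apply/ler_addgt0Pr => e e0; rewrite add0r.
have [m [F [cF F0 iF F1 Fm]] hm] := @riesz_value_adherent _ _ L A (e / (`|C| + 1)) (divr_gt0 e0 C1).
rewrite h add0r in hm.
apply: (@le_trans _ _ ((`|C| + 1) * m)); last by rewrite mulrC -ler_pdivlMr // ltW.
apply: riesz_value_le; exists F; split=> // n.
have m0 : 0 <= L (F n) by exact: pf_ge0.
rewrite (le_trans (L'L (cF n) (F0 n))) // (@le_trans _ _ (`|C| * L (F n))) //.
  by rewrite ler_wpM2r // ler_norm.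
by rewrite ler_pM // ?Fm // lerDl.
Qed.

Lemma density_exists : exists h : T -> R, [/\ forall x, 0 <= h x, intg P h &
  forall f : X -> R, continuous f -> Rintegral P setT (fun x => f x * h x) = L' f].
Proof.
pose nu := (riesz_measure L' : {finite_measure set T -> \bar R}).
have dom : nu `<< P := riesz_dominates.
pose h0 := Radon_Nikodym_SigmaFinite.f nu P.
have fin x : h0 x \is a fin_num by exact: Radon_Nikodym_SigmaFinite.f_fin_num.
pose h x := fine (h0 x).
have hE : EFin \o h = h0 by apply/funext => x; rewrite /= fineK.
have hi : intg P h by rewrite /intg hE; exact: Radon_Nikodym_SigmaFinite.f_integrable.
(* The change of variables concerns nonnegative integrands; a bounded f is reduced to this case by
   adding the constant M. *)
have ge0 (f : X -> R) : continuous f -> (forall x, 0 <= f x) ->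
    Rintegral P setT (fun x => f x * h x) = L' f.
  move=> cf f0; rewrite -(riesz_integral _ cX cf) /Rintegral; congr fine.
  rewrite -(Radon_Nikodym_SigmaFinite.change_of_variables dom) //.
  - by apply: eq_integral => x _; rewrite -/h0 -hE.
  - by apply: measurableT_comp => //; exact: continuous_borel_measurable.
exists h; split=> //.
  by move=> x; rewrite fine_ge0 //; exact: Radon_Nikodym_SigmaFinite.f_ge0.
move=> f cf; have [M hM] := compact_continuous_bounded cX cf.
have cM : continuous (cst M : X -> R) by exact: cont_cst.
have M0 : 0 <= M by rewrite (le_trans (normr_ge0 (f point))).
have cfM : continuous (f + cst M) by exact: contD.
have := ge0 _ cfM; rewrite pfD // -(ge0 _ cM) //.
have -> : (fun x => (f + cst M) x * h x) = (fun x => f x * h x + cst M x * h x).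
  by apply/funext => x; rewrite -mulrDl.
rewrite RintegralD //.
- move=> /(_ _)/addIr; apply => x; have := hM x; rewrite ler_norml => /andP[+ _].
  by rewrite -[(f + cst M) x]/(f x + M); lra.
- exact: intgM hi (continuous_borel_measurable cf) hM.
- by apply: (@intgM _ _ _ _ _ _ `|M| hi (measurable_cst _)).
Qed.
End density_existence.

(** * Integrals of fields of states *)

Section scalar_of_function.
Variables (R : realType) (A : lmodType R[i]) (f : A -> R[i]).
(** The linearity proof is a dummy argument that lets the linear structure be declared on this
    function. *)
Definition scalar_fun (_ : scalar f) := f.
Hypothesis fl : scalar f.
HB.instance Definition _ := GRing.isLinear.Build R[i] A R[i] *%R (scalar_fun fl) fl.
Definition mk_scalar : {scalar A} := scalar_fun fl.
End scalar_of_function.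

Section polarization.
Variables (R : realType) (A : starAlgType R).
Implicit Types a : A.

Definition shifted_square a (c : R[i]) : A := star (a + c%:A) * (a + c%:A).

Lemma shifted_squareE a c :
  shifted_square a c = (star a * a + (conjc c * c)%:A) + (c *: star a + conjc c *: a).
Proof.
rewrite /shifted_square starD starZ star1 mulrDl !mulrDr.
rewrite -!scalerAl -!scalerAr !mul1r !mulr1 scalerA.
by rewrite [conjc c *: a + _]addrC addrACA.
Qed.

(** Expresses any element through squares of its translates by scalars. It is applied in the group
    algebra, to obtain densities, and in C(X), to obtain continuity. *)
Lemma polarization a :
  4%:R *: a = (shifted_square a 1 - shifted_square a (-1)) +
    'i%C *: (shifted_square a 'i%C - shifted_square a (- 'i%C)).
Proof.
have e1 : conjc (1 : R[i]) = 1 by apply: complex_eq; rewrite /= ?oppr0.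
have e2 : conjc (- 1 : R[i]) = - 1 by apply: complex_eq; rewrite /= ?oppr0.
have e3 : conjc ('i%C : R[i]) = - 'i%C by apply: complex_eq; rewrite /= ?oppr0.
have e4 : conjc (- 'i%C : R[i]) = 'i%C by rewrite -e3 conjcK.
have ii : 'i%C * 'i%C = - 1 :> R[i] by rewrite -expr2 sqr_i.
rewrite !shifted_squareE e1 e2 e3 e4 !mulrNN mulNr mulrN !mulr1.
have h (s t x y : A) : s + t + x - (s + t + y) = x - y.
  by rewrite opprD addrACA subrr add0r.
rewrite !h !scaleN1r !scale1r !scaleNr.
set b := star a.
have -> : b + a - (- b - a) = (b + a) + (b + a) by rewrite opprD !opprK.
have -> : 'i%C *: ('i%C *: b - 'i%C *: a - (- ('i%C *: b) + 'i%C *: a)) = (a - b) + (a - b).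
  by rewrite opprD opprK -scalerBr -scalerDr scalerA ii scaleN1r opprD opprB.
have e : b + a + (a - b) = a + a by rewrite addrC addrA subrK.
by rewrite addrACA !e scaler_nat -[4%N]/((2 + 2)%N) mulrnDr mulr2n.
Qed.
End polarization.

Section complex_integration.
Variables (R : realType) (X : pmetricType R).
Local Notation T := (borel X).
Variable P : probability T R.
Local Notation CI := (complex_integral P).
Local Notation normc := (@ComplexField.Normc.normc R).
Implicit Types (E F : X -> R[i]) (c : R[i]).

Definition cintg E := intg P (fun x : T => complex.Re (E x)) /\ intg P (fun x : T => complex.Im (E x)).
Definition cmeas E := measurable_fun [set: T] (fun x : T => complex.Re (E x)) /\
  measurable_fun [set: T] (fun x : T => complex.Im (E x)).

Lemma cmeas_bounded E M : cmeas E -> (forall x, normc (E x) <= M) -> cintg E.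
Proof.
move=> [m1 m2] EM; split; apply: (@bounded_intg _ _ _ _ _ M) => // x;
  apply: le_trans (EM x); [exact: Re_le_normc|exact: Im_le_normc].
Qed.

Lemma cintgD E F : cintg E -> cintg F -> cintg (fun x => E x + F x).
Proof.
move=> [a b] [c d]; split.
  by under eq_fun do rewrite ReD; exact: intgD.
by under eq_fun do rewrite ImD; exact: intgD.
Qed.
Lemma cintgM f E M : cmeas f -> (forall x, normc (f x) <= M) -> cintg E ->
  cintg (fun x => f x * E x).
Proof.
move=> [m1 m2] fM [a b].
have h1 x : `|complex.Re (f x)| <= M by apply: le_trans (fM x); exact: Re_le_normc.
have h2 x : `|complex.Im (f x)| <= M by apply: le_trans (fM x); exact: Im_le_normc.
split.
  by under eq_fun do rewrite ReM; apply: intgB; [exact: intgM m1 h1|exact: intgM m2 h2].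
by under eq_fun do rewrite ImM; apply: intgD; [exact: intgM m1 h1|exact: intgM m2 h2].
Qed.
Lemma cintgZ c E : cintg E -> cintg (fun x => c * E x).
Proof. by apply: (@cintgM (fun=> c) E (normc c)) => //; split; exact: measurable_cst. Qed.
Lemma cintg_cst c : cintg (fun=> c).
Proof. by apply: (@cmeas_bounded _ (normc c)) => //; split; exact: measurable_cst. Qed.

Lemma CID E F : cintg E -> cintg F -> CI (fun x => E x + F x) = CI E + CI F.
Proof.
move=> [a b] [c d]; apply: complex_eq; rewrite ?ReD ?ImD /=.
  by under eq_fun do rewrite ReD; rewrite RintegralD.
by under eq_fun do rewrite ImD; rewrite RintegralD.
Qed.
Lemma CIZ c E : cintg E -> CI (fun x => c * E x) = c * CI E.
Proof.
move=> [a b]; apply: complex_eq; rewrite ?ReM ?ImM /=.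
  under eq_fun do rewrite ReM.
  by rewrite RintegralB ?RintegralZl //; exact: intgZ.
under eq_fun do rewrite ImM.
by rewrite RintegralD ?RintegralZl //; exact: intgZ.
Qed.
Lemma CIB E F : cintg E -> cintg F -> CI (fun x => E x - F x) = CI E - CI F.
Proof.
move=> hE hF; under eq_fun do rewrite -mulN1r.
by rewrite CID ?CIZ ?mulN1r //; exact: cintgZ.
Qed.
Lemma Rintegral_cstP (r : R) : Rintegral P setT (fun=> r) = r.
Proof.
have PT : fine (P setT) = 1 by exact: (congr1 fine (@probability_setT _ _ _ P)).
by rewrite Rintegral_cst // -[RHS]mulr1; congr (_ * _).
Qed.
Lemma CI_cst c : CI (fun=> c) = c.
Proof.
by apply: complex_eq => /=; rewrite Rintegral_cstP.
Qed.
Lemma cintg_sum (I : Type) (r : seq I) (F : I -> X -> R[i]) :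
  (forall i, cintg (F i)) -> cintg (fun x => \sum_(i <- r) F i x).
Proof.
move=> hF; elim: r => [|i r ih].
  by under eq_fun do rewrite big_nil; exact: cintg_cst.
by under eq_fun do rewrite big_cons; exact: cintgD.
Qed.
Lemma CI_sum (I : Type) (r : seq I) (F : I -> X -> R[i]) :
  (forall i, cintg (F i)) -> CI (fun x => \sum_(i <- r) F i x) = \sum_(i <- r) CI (F i).
Proof.
move=> hF; elim: r => [|i r ih].
  by rewrite big_nil; under eq_fun do rewrite big_nil; exact: CI_cst.
have -> : (fun x => \sum_(j <- i :: r) F j x) = (fun x => F i x + \sum_(j <- r) F j x).
  by apply/funext => x; rewrite big_cons.
by rewrite big_cons CID ?ih //; exact: cintg_sum.
Qed.
(** Real and imaginary parts are estimated separately, whence the factor 2; the bound serves only to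
    prove Lipschitz continuity. *)
Lemma CI_bound E M : cmeas E -> (forall x, normc (E x) <= M) -> normc (CI E) <= 2 * M.
Proof.
move=> mE EM; have [a b] := cmeas_bounded mE EM.
rewrite (le_trans (normc_le _)) //= mulr_natl mulr2n.
have h (f : T -> R) : intg P f -> (forall x, `|f x| <= M) -> `|Rintegral P setT f| <= M.
  move=> fi fM; rewrite (le_trans (le_normr_Rintegral _ fi)) //.
  have := @le_Rintegral _ _ _ P setT (fun x => `|f x|) (cst M) measurableT
    (integrable_norm fi) (intg_cst P M) (fun x _ => fM x).
  by rewrite -[X in _ <= X -> _]/(Rintegral P setT (fun=> M)) Rintegral_cstP.
by apply: lerD; apply: h => // x; apply: le_trans (EM x); [exact: Re_le_normc|exact: Im_le_normc].
Qed.
Lemma CI_ge0 E : (forall x, 0 <= E x) -> 0 <= CI E.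
Proof.
move=> E0; rewrite ge0C /=; apply/andP; split.
  have -> : (fun x => complex.Im (E x)) = cst 0.
    by apply/funext => x; have := E0 x; rewrite ge0C => /andP[/eqP].
  by rewrite Rintegral_cst // mul0r.
by apply: Rintegral_ge0 => x _; have := E0 x; rewrite ge0C => /andP[].
Qed.
Lemma CI_ae E F : cintg E -> cintg F -> {ae P, forall x, E x = F x} -> CI E = CI F.
Proof.
move=> [a b] [c d] EF; apply: complex_eq => /=; congr fine; apply: ae_eq_integral => //;
  do ?[exact: measurable_int a|exact: measurable_int b|exact: measurable_int c|exact: measurable_int d];
  by case: EF => N [mN PN NEF]; exists N; split=> // x /= h; apply: NEF => /= e; apply: h => _; rewrite e.
Qed.
Lemma CX_cmeas (f : CX R X) : cmeas f.
Proof.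
split; apply: continuous_borel_measurable; [exact: Re_CX_continuous|exact: Im_CX_continuous].
Qed.
Lemma cmeas_lim E (F : nat -> X -> R[i]) :
  (forall n, cmeas (F n)) -> (forall n x, normc (F n x - E x) <= n.+1%:R^-1) -> cmeas E.
Proof.
move=> mF FE.
have cv (f : nat -> X -> R) (g : X -> R) : (forall n x, `|f n x - g x| <= n.+1%:R^-1) ->
    forall x, f n x @[n --> \oo] --> g x.
  move=> fg x; apply/cvgrPdist_le => e e0.
  have /cvgrPdist_le/(_ e e0)[N _ hN] := @cvg_harmonic R.
  exists N => // n Nn; rewrite distrC (le_trans (fg n x)) //.
  by have := hN n Nn; rewrite /= sub0r normrN ger0_norm.
split.
  apply: (@measurable_fun_cvg _ T R setT (fun n (x : T) => complex.Re (F n x)) (fun x : T => complex.Re (E x))) => [n|x _]; first by case: (mF n).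
  apply: (cv (fun n x => complex.Re (F n x)) (fun x => complex.Re (E x))) => n y.
  by rewrite -ReN -ReD (le_trans (Re_le_normc _)).
apply: (@measurable_fun_cvg _ T R setT (fun n (x : T) => complex.Im (F n x)) (fun x : T => complex.Im (E x))) => [n|x _]; first by case: (mF n).
apply: (cv (fun n x => complex.Im (F n x)) (fun x => complex.Im (E x))) => n y.
by rewrite -ImN -ImD (le_trans (Im_le_normc _)).
Qed.
Lemma cmeasD E F : cmeas E -> cmeas F -> cmeas (fun x => E x + F x).
Proof.
move=> [a b] [c d]; split.
  by under eq_fun do rewrite ReD; exact: measurable_funD.
by under eq_fun do rewrite ImD; exact: measurable_funD.
Qed.
Lemma cmeasM E F : cmeas E -> cmeas F -> cmeas (fun x => E x * F x).
Proof.
move=> [a b] [c d]; split.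
  by under eq_fun do rewrite ReM; apply: measurable_funB; exact: measurable_funM.
by under eq_fun do rewrite ImM; apply: measurable_funD; exact: measurable_funM.
Qed.
Lemma cmeas_sum (I : Type) (r : seq I) (F : I -> X -> R[i]) :
  (forall i, cmeas (F i)) -> cmeas (fun x => \sum_(i <- r) F i x).
Proof.
move=> hF; elim: r => [|i r ih].
  by under eq_fun do rewrite big_nil; split; exact: measurable_cst.
by under eq_fun do rewrite big_cons; exact: cmeasD.
Qed.
Lemma cmeas_cst c : cmeas (fun=> c).
Proof. by split; exact: measurable_cst. Qed.

Lemma indic_cmeas (B : set T) : measurable B -> cmeas (fun x => \1_B x : R[i]).
Proof.
move=> mB; have -> : (fun x => \1_B x : R[i]) = (fun x => (\1_B x : R)%:C%C).
  by apply/funext => x; rewrite !indicE; case: (_ \in _); rewrite ?rmorph0 ?rmorph1.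
by split; [exact: measurable_indic|exact: measurable_cst].
Qed.

Section state_integral.
Variables (A : cstarAlgType R) (S : set A) (psi : X -> {scalar A}).
Hypothesis dS : norm_dense (linear_span S).
Hypothesis psi_state : forall x, is_state (psi x).
Hypothesis psi_meas : forall s, S s -> cmeas (fun x => psi x s).

(** States are contractive, so approximating [a] in norm by the span of S approximates the field
    uniformly in x. *)
Lemma state_field_meas a : cmeas (fun x => psi x a).
Proof.
have h n : exists s, linear_span S s /\ cnorm (a - s) < n.+1%:R^-1.
  by have [|s Ss hs] := dS a (e := n.+1%:R^-1); [rewrite invr_gt0|exists s].
have /choice[s hs] := h.
apply: (@cmeas_lim _ (fun n x => psi x (s n))) => n => [|x].
  have [[m [c [t [St ->]]]] _] := hs n.
  have -> : (fun x => psi x (\sum_(i < m) c i *: t i)) = (fun x => \sum_(i < m) c i * psi x (t i)).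
    by apply/funext => x; rewrite linear_sum /=; apply: eq_bigr => i _; rewrite linearZ.
  apply: cmeas_sum => i; apply: cmeasM; [exact: cmeas_cst|exact: psi_meas].
rewrite -linearB (le_trans (state_bound _ (psi_state x))) // cnorm_distC ltW //.
by case: (hs n).
Qed.

Lemma state_field_intg a : cintg (fun x => psi x a).
Proof.
apply: (cmeas_bounded (state_field_meas a)) => x.
exact: state_bound (psi_state x).
Qed.

Lemma state_integral : exists2 w : {scalar A}, is_state w &
  forall a, w a = CI (fun x => psi x a).
Proof.
have lw : scalar (fun a => CI (fun x => psi x a)).
  move=> c a b; under eq_fun do rewrite linearP.
  by rewrite CID ?CIZ //; [exact: state_field_intg|apply: cintgZ; exact: state_field_intg|exact: state_field_intg].
exists (mk_scalar lw) => //; split=> [a|]; first by apply: CI_ge0 => x; case: (psi_state x).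
rewrite -[LHS]/(CI _); under eq_fun do rewrite (psi_state _).2.
exact: CI_cst.
Qed.
End state_integral.
End complex_integration.

Section real_functions_in_CX.
Variables (R : realType) (X : ptopologicalType).
Implicit Types f g : X -> R.

Lemma real_complex_continuous f : continuous f -> continuous (fun x => (f x)%:C%C : R[i]^o).
Proof.
move=> cf x; have FF : Filter (nbhs x) by exact: nbhs_filter.
apply/(@cvgrPdist_lt R[i] R[i]^o _ _ FF) => e e0.
have eE : e = (complex.Re e)%:C%C.
  by apply: complex_eq => //=; move: e0; rewrite ltcE => /andP[/eqP].
have e0' : 0 < complex.Re e by move: e0; rewrite ltcE => /andP[].
have /(@cvgrPdist_lt R R _ _ FF)/(_ _ e0') := cf x; apply: filterS => t h.
by rewrite eE norm_normc -rmorphB ltcR normcR.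
Qed.

Lemma CX_addE (f g : CX R X) x : CX_fun (f + g) x = f x + g x. Proof. by []. Qed.
Lemma CX_mulE (f g : CX R X) x : CX_fun (f * g) x = f x * g x. Proof. by []. Qed.
Lemma CX_scaleE c (f : CX R X) x : CX_fun (c *: f) x = c * f x. Proof. by []. Qed.
Lemma CX_starE (f : CX R X) x : CX_fun (star f) x = conjc (f x). Proof. by []. Qed.
Lemma CX_oneE x : CX_fun (1 : CX R X) x = 1. Proof. by []. Qed.

(** A discontinuous function is sent to 0, so that [cplx] is total, as the functionals of the Riesz
    theorem are. *)
Lemma cplx_subproof f : {h : CX R X | continuous f -> forall x, h x = (f x)%:C%C}.
Proof.
have [cf|nf] := pselect (continuous f); last by exists 0.
by exists (toCX (real_complex_continuous cf)).
Qed.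

Definition cplx f : CX R X := sval (cplx_subproof f).

Lemma cplxE f x : continuous f -> cplx f x = (f x)%:C%C.
Proof. by move=> cf; rewrite /cplx; case: cplx_subproof => h /= ->. Qed.

Lemma cplxD f g : continuous f -> continuous g -> cplx (f + g) = cplx f + cplx g.
Proof.
move=> cf cg; apply: CX_eqP => x.
rewrite CX_addE (cplxE x cf) (cplxE x cg) (cplxE x (contD cf cg)).
exact: rmorphD.
Qed.

Lemma cplxZ (t : R) f : continuous f -> cplx (fun x => t * f x) = t%:C%C *: cplx f.
Proof.
move=> cf; apply: CX_eqP => x; have ct : continuous (fun x => t * f x).
  by apply: contM => //; exact: cont_cst.
by rewrite CX_scaleE (cplxE x cf) (cplxE x ct) rmorphM.
Qed.

Lemma cplx1 : cplx (cst 1) = 1.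
Proof. by apply: CX_eqP => x; rewrite (cplxE x (@cont_cst R X 1)) CX_oneE. Qed.

Lemma cplx_square f : continuous f -> (forall x, 0 <= f x) ->
  exists k : CX R X, cplx f = star k * k.
Proof.
move=> cf f0; exists (cplx (fun x => Num.sqrt (f x))); apply: CX_eqP => x.
have cs : continuous (fun x => Num.sqrt (f x)).
  by move=> y; apply: continuous_comp (cf y) _; exact: sqrt_continuous.
rewrite CX_mulE CX_starE (cplxE x cf) (cplxE x cs) conjc_real -rmorphM /=.
by rewrite -expr2 sqr_sqrtr.
Qed.

Lemma CX_ReIm (f : CX R X) : f = cplx (fun x => complex.Re (f x)) +
  'i%C *: cplx (fun x => complex.Im (f x)).
Proof.
apply: CX_eqP => x; rewrite CX_addE CX_scaleE (cplxE x (@Re_CX_continuous _ _ f)).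
by rewrite (cplxE x (@Im_CX_continuous _ _ f)) -complexE.
Qed.
End real_functions_in_CX.

Lemma CX_integral_eq0 (R : realType) (X : pmetricType R) (P : probability (borel X) R)
    (E : X -> R[i]) : cintg P E ->
  (forall f : X -> R, continuous f -> complex_integral P (fun x => (f x)%:C%C * E x) = 0) ->
  {ae P, forall x : borel X, E x = 0}.
Proof.
move=> [h1 h2] z; have := density_eq0 h1; have := density_eq0 h2.
have e1 (f : X -> R) : continuous f -> (forall x, 0 <= f x <= 1) ->
    Rintegral P setT (fun x => f x * complex.Re (E x)) = 0.
  move=> cf _; have := congr1 (@complex.Re R) (z f cf).
  by rewrite /=; under eq_fun do rewrite ReRM.
have e2 (f : X -> R) : continuous f -> (forall x, 0 <= f x <= 1) ->
    Rintegral P setT (fun x => f x * complex.Im (E x)) = 0.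
  move=> cf _; have := congr1 (@complex.Im R) (z f cf).
  by rewrite /=; under eq_fun do rewrite ImRM.
move=> /(_ e2) r2 /(_ e1) r1.
by move: r1 r2; apply: filterS2 => x r1 r2; apply: complex_eq.
Qed.

(** * Densities of a positive form on C(X) and a C*-algebra *)

Section densities.
Variables (R : realType) (X : pmetricType R) (A : cstarAlgType R).
Hypothesis cX : compact [set: X].
Variable Psi : CX R X -> {scalar A}.
Hypothesis Psi_lin : forall a, scalar (fun f => Psi f a).
Hypothesis Psi_pos : forall k a, 0 <= Psi (star k * k) (star a * a).
Hypothesis Psi1 : Psi 1 1 = 1.
Local Notation T := (borel X).

Lemma PsiD f g a : Psi (f + g) a = Psi f a + Psi g a.
Proof. by have := Psi_lin a 1 f g; rewrite scale1r mul1r. Qed.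
Lemma Psi0 a : Psi 0 a = 0.
Proof. by apply: (addrI (Psi 0 a)); rewrite -PsiD !addr0. Qed.
Lemma PsiZ c f a : Psi (c *: f) a = c * Psi f a.
Proof. by have := Psi_lin a c f 0; rewrite !addr0 Psi0 addr0. Qed.

Lemma Psi_real_ge0 (f : X -> R) (a : A) : continuous f -> (forall x, 0 <= f x) ->
  0 <= Psi (cplx f) (star a * a).
Proof. by move=> cf /(cplx_square cf)[k ->]. Qed.

(** Adding a constant makes f nonnegative, and nonnegative elements of [R[i]] are real. *)
Lemma Psi_real_Im (f : X -> R) (a : A) : continuous f -> complex.Im (Psi (cplx f) (star a * a)) = 0.
Proof.
move=> cf; have [M hM] := compact_continuous_bounded cX cf.
have cM : continuous (cst M : X -> R) by exact: cont_cst.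
have M0 : 0 <= M by rewrite (le_trans (normr_ge0 (f point))).
have cfM : continuous (f + cst M) by exact: contD.
have h0 x : 0 <= (f + cst M) x.
  have := hM x; rewrite ler_norml => /andP[+ _].
  by rewrite -[(f + cst M) x]/(f x + M); lra.
have := Psi_real_ge0 a cfM h0; have := @Psi_real_ge0 (cst M) a cM (fun _ => M0).
rewrite cplxD // PsiD !ge0C ImD => /andP[/eqP-> _] /andP[/eqP + _].
by rewrite addr0.
Qed.

Definition Psi_real (a : A) (f : X -> R) : R := complex.Re (Psi (cplx f) (star a * a)).

Lemma Psi_realD (a : A) (f g : X -> R) : continuous f -> continuous g ->
  Psi_real a (f + g) = Psi_real a f + Psi_real a g.
Proof. by move=> cf cg; rewrite /Psi_real cplxD // PsiD ReD. Qed.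
Lemma Psi_realZ (a : A) (t : R) (f : X -> R) : continuous f ->
  Psi_real a (fun x => t * f x) = t * Psi_real a f.
Proof. by move=> cf; rewrite /Psi_real cplxZ // PsiZ ReRM. Qed.
Lemma Psi_real_pos (a : A) (f : X -> R) : continuous f -> (forall x, 0 <= f x) ->
  0 <= Psi_real a f.
Proof. by move=> cf f0; have := Psi_real_ge0 a cf f0; rewrite ge0C => /andP[]. Qed.

Definition Psi_functional (a : A) : positive_functional R X :=
  PositiveFunctional (Psi_realD a) (Psi_realZ a) (Psi_real_pos a).

(** For f = star k k the functional a |-> Psi f a is positive, hence bounded by its value at 1 times
    the norm. This is the domination behind the Radon-Nikodym derivative. *)
Lemma Psi_functional_le (a : A) (f : X -> R) : continuous f -> (forall x, 0 <= f x) ->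
  Psi_functional a f <= cnorm (star a * a) * Psi_functional 1 f.
Proof.
move=> cf f0; have [k kE] := cplx_square cf f0.
rewrite /= /Psi_real kE star1 mulr1 mulrC.
apply: le_trans (positive_bound (w := Psi (star k * k)) _ _); last by move=> b; exact: Psi_pos.
by rewrite (le_trans (ler_norm _)) // Re_le_normc.
Qed.

Lemma Psi_probability : exists P : probability T R,
  (forall B, P B = riesz_measure (Psi_functional 1) B) /\
  forall f : X -> R, continuous f -> Rintegral P setT f = Psi_functional 1 f.
Proof.
by apply: riesz_probability => //; rewrite /= /Psi_real cplx1 star1 mulr1 Psi1.
Qed.

Variable P : probability T R.
Hypothesis PE : forall B, P B = riesz_measure (Psi_functional 1) B.
Hypothesis PI : forall f : X -> R, continuous f -> Rintegral P setT f = Psi_functional 1 f.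
Local Notation CI := (complex_integral P).

(** Tested on real functions, the domain of the Riesz functionals; [is_density_CX] passes to complex
    ones. *)
Definition is_density (a : A) (E : X -> R[i]) := cintg P E /\
  forall f : X -> R, continuous f -> Psi (cplx f) a = CI (fun x => (f x)%:C%C * E x).

Lemma real_cmeas (f : X -> R) : continuous f -> cmeas (fun x => (f x)%:C%C).
Proof.
move=> cf; split; first exact: continuous_borel_measurable.
exact: measurable_cst.
Qed.

Lemma cintg_real_mul (f : X -> R) E : continuous f -> cintg P E ->
  cintg P (fun x => (f x)%:C%C * E x).
Proof.
move=> cf; have [M hM] := compact_continuous_bounded cX cf.
by apply: cintgM (real_cmeas cf) _ => x; rewrite normcR; exact: hM.
Qed.

Lemma is_densityD a b E F : is_density a E -> is_density b F ->
  is_density (a + b) (fun x => E x + F x).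
Proof.
move=> [iE dE] [iF dF]; split; first exact: cintgD.
move=> f cf; rewrite linearD /= dE // dF // -CID; [|exact: cintg_real_mul|exact: cintg_real_mul].
by congr complex_integral; apply/funext => x; rewrite mulrDr.
Qed.

Lemma is_densityZ c a E : is_density a E -> is_density (c *: a) (fun x => c * E x).
Proof.
move=> [iE dE]; split; first exact: cintgZ.
move=> f cf; rewrite linearZ /= dE // -CIZ; last exact: cintg_real_mul.
by congr complex_integral; apply/funext => x; rewrite mulrCA.
Qed.

Lemma is_density0 : is_density 0 (fun=> 0).
Proof.
split; first exact: cintg_cst.
move=> f cf; rewrite linear0; under eq_fun do rewrite mulr0.
by rewrite CI_cst.
Qed.

Lemma is_density_sum (I : Type) (r : seq I) (a : I -> A) (E : I -> X -> R[i]) :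
  (forall i, is_density (a i) (E i)) ->
  is_density (\sum_(i <- r) a i) (fun x => \sum_(i <- r) E i x).
Proof.
move=> h; elim: r => [|i r ih].
  by rewrite big_nil; under eq_fun do rewrite big_nil; exact: is_density0.
have -> : (fun x => \sum_(j <- i :: r) E j x) = (fun x => E i x + \sum_(j <- r) E j x).
  by apply/funext => x; rewrite big_cons.
by rewrite big_cons; exact: is_densityD.
Qed.

Lemma is_density_square a : exists h : X -> R, (forall x, 0 <= h x) /\
  is_density (star a * a) (fun x => (h x)%:C%C).
Proof.
have [h [h0 ih hE]] := @density_exists _ _ _ _ cX P _ PE (@Psi_functional_le a).
exists h; split=> //; split.
  by split=> //; exact: intg_cst.
move=> f cf; apply: complex_eq.
  rewrite -[LHS]/(Psi_functional a f) -hE //=; congr Rintegral.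
  by apply/funext => x; rewrite mul0r subr0.
rewrite Psi_real_Im //.
rewrite -[RHS]/(Rintegral P setT (fun x => complex.Im ((f x)%:C%C * (h x)%:C%C))).
have -> : (fun x => complex.Im ((f x)%:C%C * (h x)%:C%C)) = (fun=> 0).
  by apply/funext => x; rewrite ImRM mulr0.
by rewrite Rintegral_cstP.
Qed.

(** Polarization reduces the claim to squares, where the functional is positive and dominated. *)
Lemma is_density_ex a : exists E, is_density a E.
Proof.
have [h1 [_ d1]] := is_density_square (a + 1%:A).
have [h2 [_ d2]] := is_density_square (a + (- 1)%:A).
have [h3 [_ d3]] := is_density_square (a + 'i%C%:A).
have [h4 [_ d4]] := is_density_square (a + (- 'i%C)%:A).
have aE : a = (4%:R : R[i])^-1 *: ((shifted_square a 1 - shifted_square a (-1)) +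
    'i%C *: (shifted_square a 'i%C - shifted_square a (- 'i%C))).
  by rewrite -polarization scalerA mulVf ?scale1r // pnatr_eq0.
eexists; rewrite aE; apply: is_densityZ; apply: is_densityD; last apply: is_densityZ.
  by rewrite -scaleN1r; apply: is_densityD d1 (is_densityZ (-1) d2).
by rewrite -scaleN1r; apply: is_densityD d3 (is_densityZ (-1) d4).
Qed.

Lemma is_density_unique a E F : is_density a E -> is_density a F ->
  {ae P, forall x : T, E x = F x}.
Proof.
move=> [iE dE] [iF dF].
have z (f : X -> R) : continuous f -> CI (fun x => (f x)%:C%C * (E x + -1 * F x)) = 0.
  move=> cf.
  have -> : (fun x => (f x)%:C%C * (E x + -1 * F x)) = (fun x => (f x)%:C%C * E x - (f x)%:C%C * F x).
    by apply/funext => x; rewrite mulN1r mulrBr.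
  by rewrite CIB ?dE -?dE -?dF ?subrr //; exact: cintg_real_mul.
have := CX_integral_eq0 (cintgD iE (cintgZ (-1) iF)) z; apply: filterS => x h.
by apply/eqP; rewrite -subr_eq0 -mulN1r; apply/eqP.
Qed.

Lemma is_density_CX a E (f : CX R X) : is_density a E -> Psi f a = CI (fun x => f x * E x).
Proof.
move=> [iE dE]; have c1 := @Re_CX_continuous R X f; have c2 := @Im_CX_continuous R X f.
rewrite {1}(CX_ReIm f) PsiD PsiZ !dE // -CIZ; last exact: cintg_real_mul.
rewrite -CID; [|exact: cintg_real_mul|by apply: cintgZ; exact: cintg_real_mul].
congr complex_integral; apply/funext => x.
by rewrite mulrA -mulrDl -complexE.
Qed.
End densities.

(** * Disintegration *)

Section complex_limits.
Variable R : realType.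
Implicit Types (z w : nat -> R[i]) (k l : R[i]).

Definition ccvg z l := (complex.Re (z n) @[n --> \oo] --> complex.Re l) /\
  (complex.Im (z n) @[n --> \oo] --> complex.Im l).

Lemma ccvg_cst l : ccvg (fun=> l) l.
Proof. by split; exact: cvg_cst. Qed.
Lemma ccvgD z w k l : ccvg z k -> ccvg w l -> ccvg (fun n => z n + w n) (k + l).
Proof.
move=> [a b] [c d]; split; rewrite !ReImE.
  by under eq_fun do rewrite ReD; exact: cvgD.
by under eq_fun do rewrite ImD; exact: cvgD.
Qed.
Lemma ccvgM z w k l : ccvg z k -> ccvg w l -> ccvg (fun n => z n * w n) (k * l).
Proof.
move=> [a b] [c d]; split; rewrite !ReImE.
  by under eq_fun do rewrite ReM; apply: cvgB; exact: cvgM.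
by under eq_fun do rewrite ImM; apply: cvgD; exact: cvgM.
Qed.
Lemma ccvgJ z l : ccvg z l -> ccvg (fun n => conjc (z n)) (conjc l).
Proof.
move=> [a b]; split; rewrite !ReImE.
  by under eq_fun do rewrite ReJ.
by under eq_fun do rewrite ImJ; exact: cvgN.
Qed.
Lemma ccvg_sum (I : Type) (r : seq I) (z : I -> nat -> R[i]) (l : I -> R[i]) :
  (forall i, ccvg (z i) (l i)) -> ccvg (fun n => \sum_(i <- r) z i n) (\sum_(i <- r) l i).
Proof.
move=> h; elim: r => [|i r ih].
  rewrite big_nil; have -> : (fun n => \sum_(i <- [::]) z i n) = (fun=> 0).
    by apply/funext => n; rewrite big_nil.
  exact: ccvg_cst.
rewrite big_cons; have -> : (fun n => \sum_(j <- i :: r) z j n) = (fun n => z i n + \sum_(j <- r) z j n).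
  by apply/funext => n; rewrite big_cons.
exact: ccvgD.
Qed.
Lemma ccvg_ge0 z l : (forall n, 0 <= z n) -> ccvg z l -> 0 <= l.
Proof.
move=> z0 [a b]; rewrite ge0C; apply/andP; split.
  have e : (fun n => complex.Im (z n)) = (fun=> 0).
    by apply/funext => n; have := z0 n; rewrite ge0C => /andP[/eqP].
  by move: b; rewrite e => /cvg_lim <- //; rewrite lim_cst.
rewrite -(cvg_lim _ a) //; apply: limr_ge; first by apply/cvg_ex; eexists; exact: a.
by apply: nearW => n; have := z0 n; rewrite ge0C => /andP[].
Qed.

Lemma ratr_approx (x : R) : exists q : nat -> rat, (ratr (q n) : R) @[n --> \oo] --> x.
Proof.
have h n : exists q : rat, `|x - ratr q| <= n.+1%:R^-1.
  have [|q] := @rat_in_itvoo R x (x + n.+1%:R^-1).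
    by rewrite ltrDl invr_gt0.
  rewrite in_itv /= => /andP[h1 h2]; exists q; rewrite distrC ger0_norm ?subr_ge0 ?ltW //.
  by rewrite ltrBlDl.
have /choice[q hq] := h; exists q; apply/cvgrPdist_le => e e0.
have /cvgrPdist_le/(_ e e0)[N _ hN] := @cvg_harmonic R.
exists N => // n Nn; rewrite (le_trans (hq n)) //.
by have := hN n Nn; rewrite /= sub0r normrN ger0_norm.
Qed.

Variables (G : Type) (enum : nat -> G).
Hypothesis enum_surj : forall g, exists n, enum n = g.

Definition rational_comb (t : seq (rat * rat * nat)) : seq (R[i] * G) :=
  [seq (Complex (ratr q.1.1) (ratr q.1.2), enum q.2) | q <- t].

(* Reduces positive definiteness to countably many conditions, so that it can be
   obtained almost everywhere. *)
Lemma positive_kernel_rational (K : G -> G -> R[i]) :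
  (forall t, 0 <= pairing (rational_comb t) (kfun K (rational_comb t))) ->
  positive_kernel K.
Proof.
move=> K0 c.
have h (p : R[i] * G) : exists q : nat -> rat * rat * nat,
    ccvg (fun n => Complex (ratr (q n).1.1) (ratr (q n).1.2)) p.1 /\ forall n, enum (q n).2 = p.2.
  have [q1 h1] := ratr_approx (complex.Re p.1); have [q2 h2] := ratr_approx (complex.Im p.1).
  by have [k hk] := enum_surj p.2; exists (fun n => (q1 n, q2 n, k)).
have /choice[q hq] := h.
pose C n := rational_comb [seq q p n | p <- c].
apply: (@ccvg_ge0 (fun n => pairing (C n) (kfun K (C n)))) => // [n|]; first exact: K0.
have -> : (fun n => pairing (C n) (kfun K (C n))) = (fun n => \sum_(p <- c)
    (conjc (Complex (ratr (q p n).1.1) (ratr (q p n).1.2)) *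
     \sum_(r <- c) (Complex (ratr (q r n).1.1) (ratr (q r n).1.2) * K p.2 r.2))).
  apply/funext => n; rewrite /pairing /C /rational_comb !big_map; apply: eq_bigr => p _ /=.
  congr (_ * _); rewrite /kfun !big_map; apply: eq_bigr => r _ /=.
  by rewrite (hq p).2 (hq r).2.
apply: ccvg_sum => p; apply: ccvgM; first by apply: ccvgJ; case: (hq p).
by apply: ccvg_sum => r; apply: ccvgM; [case: (hq r)|exact: ccvg_cst].
Qed.
End complex_limits.

Lemma countable_enum (G : choiceType) (g0 : G) : countable [set: G] ->
  exists enum : nat -> G, forall g, exists n, enum n = g.
Proof.
move=> /pcard_injP[f]; exists (fun n => xget g0 [set g | f g = n]) => g.
exists (f g); apply: p; rewrite ?inE //.
(* The enumeration inverts an injection into the naturals; numbers outside its range are sent to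
   [g0]. *)
exact: (@xgetPex _ g0 [set h | f h = f g] (ex_intro _ g erefl)).
Qed.

Section lipschitz.
Variables (R : realType) (A : cstarAlgType R).
Local Notation normc := (@ComplexField.Normc.normc R).
Definition lipschitz (v : A -> R[i]) :=
  exists C, forall a b, normc (v a - v b) <= C * cnorm (a - b).
Lemma lipschitzD v w : lipschitz v -> lipschitz w -> lipschitz (fun a => v a + w a).
Proof.
move=> [C hC] [D hD]; exists (C + D) => a b.
rewrite opprD addrACA mulrDl (le_trans (le_normcD _ _)) // lerD //.
Qed.
Lemma lipschitzZ (c : R[i]) v : lipschitz v -> lipschitz (fun a => c * v a).
Proof.
move=> [C hC]; exists (normc c * C) => a b.
by rewrite -mulrBr ComplexField.Normc.normcM -mulrA ler_wpM2l ?normc_ge0.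
Qed.
Lemma lipschitz_positive (w : {scalar A}) : (forall a, 0 <= w (star a * a)) -> lipschitz w.
Proof. by move=> w0; exists (complex.Re (w 1)) => a b; exact: positive_dist. Qed.
Lemma lipschitz_eq (S : set A) (v w : A -> R[i]) : norm_dense (linear_span S) ->
  lipschitz v -> lipschitz w -> (forall a, linear_span S a -> v a = w a) -> v =1 w.
Proof.
move=> dS [C hC] [D hD]; have Cn (x y : R) a b : x <= `|C| + `|D| -> y <= x * cnorm (a - b) :> R ->
    y <= (`|C| + `|D|) * cnorm (a - b).
  by move=> h1 h2; rewrite (le_trans h2) // ler_wpM2r ?cnorm_ge0.
apply: (norm_dense_eq dS (C := `|C| + `|D|)) => a b.
  by apply: Cn (hC a b); rewrite (le_trans (ler_norm _)) // lerDl.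
by apply: Cn (hD a b); rewrite (le_trans (ler_norm _)) // lerDr.
Qed.
End lipschitz.

Section disintegration.
Variables (R : realType) (G : groupType) (X : pmetricType R) (A : cstarAlgType R) (lam : G -> A).
Hypothesis cG : countable [set: G].
Hypothesis cX : compact [set: X].
Hypothesis hA : is_full_group_cstar lam.
Variable Psi : CX R X -> {scalar A}.
Hypothesis Psi_lin : forall a, scalar (fun f => Psi f a).
Hypothesis Psi_pos : forall k a, 0 <= Psi (star k * k) (star a * a).
Hypothesis Psi1 : Psi 1 1 = 1.
Local Notation T := (borel X).

Lemma lam_star g h : star (lam g) * lam h = lam (g^-1 * h)%g.
Proof.
have [[l1 lM ls _] _ _] := hA.
have -> : lam h = lam g * lam (g^-1 * h)%g by rewrite -lM mulgA mulgV mul1g.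
by rewrite mulrA ls mul1r.
Qed.

(** For f = star k k this is the continuity of a positive functional; polarization in C(X) gives all
    f. *)
Lemma Psi_lipschitz f : lipschitz (Psi f).
Proof.
have sq k : lipschitz (Psi (star k * k)).
  by apply: lipschitz_positive => a; exact: Psi_pos.
have fE : f = (4%:R : R[i])^-1 *: ((shifted_square f 1 - shifted_square f (-1)) +
    'i%C *: (shifted_square f 'i%C - shifted_square f (- 'i%C))).
  by rewrite -polarization scalerA mulVf ?scale1r // pnatr_eq0.
have -> : (Psi f : A -> R[i]) = (fun a => (4%:R : R[i])^-1 *
    ((Psi (shifted_square f 1) a + -1 * Psi (shifted_square f (-1)) a) +
     'i%C * (Psi (shifted_square f 'i%C) a + -1 * Psi (shifted_square f (- 'i%C)) a))).
  apply/funext => a; rewrite {1}fE.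
  by rewrite -!(PsiZ Psi_lin) -!(PsiD Psi_lin) !scaleN1r -!(PsiZ Psi_lin) -!(PsiD Psi_lin) -(PsiZ Psi_lin).
by apply: lipschitzZ; apply: lipschitzD; last apply: lipschitzZ; apply: lipschitzD; try apply: lipschitzZ; exact: sq.
Qed.

Lemma Psi_one_state : is_state (Psi 1).
Proof.
split=> // a; have := Psi_pos 1 a.
by rewrite (_ : star 1 * 1 = 1 :> CX R X) // star1 mulr1.
Qed.

Lemma disintegration : exists (P : probability T R) (phi : X -> {scalar A}),
  [/\ forall x, is_state (phi x), forall a, cmeas (fun x => phi x a)
    & forall f a, Psi f a = complex_integral P (fun x => f x * phi x a)].
Proof.
have [P [PE PI]] := Psi_probability cX Psi_lin Psi_pos Psi1.
have [enum enumP] := countable_enum (1%g : G) cG.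
have [[l1 lM ls _] dA _] := hA.
pose dens := is_density Psi P.
have dex a : exists E, dens a E by exact: (is_density_ex cX PE).
pose p g : X -> R[i] := sval (cid (dex (lam g))).
have pd g : dens (lam g) (p g) by rewrite /p; case: cid.
pose K x := group_kernel (fun g => p g x).
pose comb (c : seq (R[i] * G)) : A := \sum_(q <- c) q.1 *: lam q.2.
have combd c : dens (star (comb c) * comb c) (fun x => pairing c (kfun (K x) c)).
  have -> : star (comb c) * comb c = \sum_(q <- c) conjc q.1 *: \sum_(r <- c) r.1 *: lam (q.2^-1 * r.2)%g.
    rewrite /comb star_sum mulr_suml; apply: eq_bigr => q _.
    rewrite starZ -scalerAl mulr_sumr; congr (_ *: _); apply: eq_bigr => r _.
    by rewrite -scalerAr lam_star.
  apply: is_density_sum => // q; apply: is_densityZ => //; apply: is_density_sum => // r.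
  by apply: is_densityZ => //; exact: pd.
(* The element [star (comb c) * comb c] has the quadratic form of the kernel as a density and, being
   a square, also a nonnegative one; the two agree almost everywhere. *)
have goodc c : {ae P, forall x : T, 0 <= pairing c (kfun (K x) c)}.
  have [h [h0 dh]] := is_density_square cX PE (comb c).
  have := is_density_unique cX (combd c) dh; apply: filterS => x ->.
  by rewrite ler0c.
have d1 : dens (lam 1%g) (fun=> 1).
  rewrite l1 -[X in dens X]mulr1 -{1}star1; split; first exact: cintg_cst.
  move=> f cf; rewrite star1 mulr1; apply: complex_eq.
    rewrite /= -[LHS]/(complex.Re (Psi (cplx f) 1)).
    have := PI f cf; rewrite /= /Psi_real star1 mulr1 => <-.
    by congr Rintegral; apply/funext => x; rewrite mulr1 mulr0 subr0.
  have := Psi_real_Im cX Psi_lin Psi_pos 1 cf; rewrite star1 mulr1 => ->.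
  rewrite -[RHS]/(Rintegral P setT (fun x => complex.Im ((f x)%:C%C * 1))).
  have -> : (fun x => complex.Im ((f x)%:C%C * 1)) = (fun=> 0).
    by apply/funext => x; rewrite mulr1.
  by rewrite Rintegral_cstP.
have good1 : {ae P, forall x : T, p 1%g x = 1} by have := is_density_unique cX (pd _) d1.
(* The conditions are indexed by codes of rational combinations; a number that codes nothing imposes
   none. *)
pose Q (n : nat) (x : T) := match @unpickle (seq (rat * rat * nat)) n with
  | Some t => 0 <= pairing (rational_comb R enum t) (kfun (K x) (rational_comb R enum t))
  | None => true end.
have goodQ : {ae P, forall x : T, forall n, Q n x}.
  apply: ae_foralln => n; rewrite /Q; case: (unpickle n) => [t|]; first exact: goodc.
  exact: aeW.
have : {ae P, forall x : T, p 1%g x = 1 /\ forall n, Q n x}.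
  by move: good1 goodQ; apply: filterS2.
case=> N [mN PN NP].
have st x : ~ N x -> exists w : {scalar A}, is_state w /\ forall g, w (lam g) = p g x.
  move=> Nx; have [px1 Qx] : p 1%g x = 1 /\ forall n, Q n x.
    by apply: contrapT => h; apply: Nx; apply: NP.
  have Kx : positive_kernel (group_kernel (fun g => p g x)).
    apply: (positive_kernel_rational enumP) => t.
    by have := Qx (pickle t); rewrite /Q pickleK.
  by have [w sw wE] := positive_definite_state Kx px1 hA; exists w.
(* On the null set N the constant state [Psi 1] is used, so that the field consists of states at
   every point and stays measurable. *)
pose phi x : {scalar A} := match pselect (N x) with
  | left _ => Psi 1
  | right Nx => sval (cid (st x Nx)) end.
have phis x : is_state (phi x).
  rewrite /phi; case: pselect => [_|Nx]; first exact: Psi_one_state.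
  by case: cid => w [].
have phiE g x : phi x (lam g) = \1_N x * Psi 1 (lam g) + \1_(~` N) x * p g x.
  rewrite /phi; case: pselect => [Nx|Nx].
    by rewrite !indicE mem_set // memNset ?mul1r ?mul0r ?addr0 // => /(_ Nx).
  case: cid => w /= [_ ->].
  by rewrite !indicE (memNset Nx) (@mem_set _ (~` N)) // mul1r mul0r add0r.
have pm g : cmeas (p g).
  by have [[h1 h2] _] := pd g; split; [exact: intg_measurable h1|exact: intg_measurable h2].
have phim a : cmeas (fun x => phi x a).
  apply: (state_field_meas dA phis) => _ [g _ <-].
  have -> : (fun x => phi x (lam g)) = (fun x => \1_N x * Psi 1 (lam g) + \1_(~` N) x * p g x).
    by apply/funext => x; exact: phiE.
  by apply: cmeasD; apply: cmeasM => //; apply: indic_cmeas => //; exact: measurableC.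
exists P, phi; split=> // f.
have [M hM] := CX_bounded cX f.
have fphi_int a : cintg P (fun x => f x * phi x a).
  apply: cintgM (CX_cmeas f) hM _.
  by apply: (@cmeas_bounded _ _ P _ (cnorm a) (phim a)) => x; exact: state_bound.
(* Both sides are Lipschitz in the element of A, so the identity has to be checked only on the span
   of the [lam g]. *)
apply: (lipschitz_eq dA (Psi_lipschitz f)).
  exists (2 * M) => a b; rewrite -CIB //.
  rewrite -mulrA; apply: CI_bound => [|x].
    have -> : (fun x => f x * phi x a - f x * phi x b) = (fun x => f x * phi x (a - b)).
      by apply/funext => x; rewrite -mulrBr linearB.
    by apply: cmeasM (CX_cmeas f) _.
  rewrite -mulrBr ComplexField.Normc.normcM ler_pM ?normc_ge0 //.
  by rewrite -linearB; exact: state_bound.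
have lamE g : Psi f (lam g) = complex_integral P (fun x => f x * phi x (lam g)).
  rewrite (is_density_CX cX Psi_lin f (pd g)); apply: CI_ae => //.
    by apply: cintgM (CX_cmeas f) hM _; case: (pd g).
  exists N; split=> // x /= h; apply: contrapT => Nx; apply: h.
  by rewrite phiE !indicE (memNset Nx) (@mem_set _ (~` N)) // mul1r mul0r add0r.
move=> _ [n [c [s [sl ->]]]]; rewrite linear_sum.
have -> : (fun x => f x * phi x (\sum_(i < n) c i *: s i)) =
    (fun x => \sum_(i < n) c i * (f x * phi x (s i))).
  apply/funext => x; rewrite linear_sum mulr_sumr; apply: eq_bigr => i _.
  by rewrite linearZ mulrCA.
rewrite CI_sum; last by move=> i; exact: cintgZ.
apply: eq_bigr => i _; rewrite linearZ /= CIZ //.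
by have [g _ <-] := sl i; rewrite lamE.
Qed.
End disintegration.

Lemma scalar_eq (R : realType) (A : lmodType R[i]) (v w : {scalar A}) : v =1 w -> v = w.
Proof.
case: v w => f cf [g cg] /= /funext fg; subst g; congr GRing.Linear.Pack.
case: cf cg => [a1 a2] [b1 b2].
case: a1 b1 => a1 [b1]; have ? : a1 = b1 by exact: Prop_irrelevance.
subst b1; case: a2 b2 => a2 [b2]; have ? : a2 = b2 by exact: Prop_irrelevance.
by subst b2.
Qed.

Lemma exists_choice (X Y : Type) (P : X -> Y -> Prop) :
  (forall x, exists y, P x y) -> exists f, forall x, P x (f x).
Proof. by move=> /choice[f]; exists f. Qed.

Lemma CX_mulC (R : realType) (X : ptopologicalType) (f g : CX R X) : f * g = g * f.
Proof. by apply: CX_eqP => x; rewrite !CX_mulE mulrC. Qed.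

(** * The correspondence *)

Section eval_hom.
Variables (R : realType) (X : ptopologicalType) (A : cstarAlgType R) (x : X).
Definition eval_hom (f : CX R X) : A := (f x : R[i])%:A.
Lemma eval_hom_linear : linear eval_hom.
Proof. by move=> c f g; rewrite /eval_hom CX_addE CX_scaleE scalerDl scalerA. Qed.
HB.instance Definition _ := GRing.isLinear.Build R[i] (CX R X) A *:%R eval_hom eval_hom_linear.
Lemma eval_hom_monoid : monoid_morphism eval_hom.
Proof.
split; first by rewrite /eval_hom CX_oneE scale1r.
by move=> f g; rewrite /eval_hom CX_mulE -scalerAl mul1r scalerA.
Qed.
HB.instance Definition _ := GRing.isMonoidMorphism.Build (CX R X) A eval_hom eval_hom_monoid.
Lemma eval_hom_star : is_star_hom (eval_hom : {lrmorphism CX R X -> A}).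
Proof. by move=> f; rewrite /= /eval_hom starZ star1 CX_starE. Qed.
End eval_hom.

Section tensor.
Variables (R : realType) (X : ptopologicalType) (A T : cstarAlgType R).
Variables (i1 : {lrmorphism CX R X -> T}) (i2 : {lrmorphism A -> T}).
Hypothesis hT : is_tensor_product i1 i2.

(** The slice at x turns a state of A into a state of T. Integrating these states over X produces
    [Phi] on all of T, with no extension from the algebraic tensor product. *)
Lemma tensor_slice (x : X) : exists2 pi : {lrmorphism T -> A}, is_star_hom pi &
  forall f a, pi (i1 f * i2 a) = (f x : R[i]) *: a.
Proof.
have [_ _ _ /(_ A (eval_hom A x) (idfun : {lrmorphism A -> A}))] := hT.
case=> [||f a|pi [spi p1 p2]].
- exact: eval_hom_star.
- by [].
- by rewrite /= /eval_hom -scalerAl -scalerAr mul1r mulr1.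
- exists pi => // f a; rewrite rmorphM /= p1 p2 /= /eval_hom.
  by rewrite -scalerAl mul1r.
Qed.
End tensor.

Section product_functional.
Variables (R : realType) (X : ptopologicalType) (A D : cstarAlgType R).
Variables (r1 : {lrmorphism CX R X -> D}) (r2 : {lrmorphism A -> D}) (w : {scalar D}).

Lemma product_scalar f : scalar (fun a => w (r1 f * r2 a)).
Proof. by move=> c a b; rewrite linearP mulrDr -scalerAr linearP. Qed.
(** Serves both sides of the correspondence, with [w] a state of the crossed product or of the
    tensor product. *)
Definition product_functional f : {scalar A} := mk_scalar (product_scalar f).
Lemma product_functionalE f a : product_functional f a = w (r1 f * r2 a).
Proof. by []. Qed.
Lemma product_functional_lin a : scalar (fun f => product_functional f a).
Proof.
by move=> c f g; rewrite !product_functionalE linearP mulrDl -scalerAl linearP.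
Qed.
Hypothesis ws : is_state w.
Hypothesis wc : forall k f a, w (r1 k * (r1 f * r2 a)) = w (r1 f * r2 a * r1 k).
Hypothesis s1 : is_star_hom r1.
Hypothesis s2 : is_star_hom r2.
(** Centrality moves the factor [star (r1 k)] to the right end, which makes the product a square
    [star y * y] with [y = r2 a * star (r1 k)]. *)
Lemma product_functional_pos k a : 0 <= product_functional (star k * k) (star a * a).
Proof.
rewrite product_functionalE rmorphM -mulrA wc rmorphM /= s1 s2.
have [w0 _] := ws; have := w0 (r2 a * star (r1 k)).
by rewrite starM starK !mulrA.
Qed.
Lemma product_functional1 : product_functional 1 1 = 1.
Proof. by rewrite product_functionalE !rmorph1 mulr1; case: ws. Qed.
End product_functional.

Section correspondence.
Variables (R : realType) (G : groupType) (X : pmetricType R) (al : caction G X).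
Variables (CG : cstarAlgType R) (lam : G -> CG).
Variables (B : cstarAlgType R) (iota : {lrmorphism CX R X -> B}) (u : G -> B).
Variable j : {lrmorphism CG -> B}.
Variables (T : cstarAlgType R) (i1 : {lrmorphism CX R X -> T}) (i2 : {lrmorphism CG -> T}).
Hypothesis cG : countable [set: G].
Hypothesis cX : compact [set: X].
Hypothesis hCG : is_full_group_cstar lam.
Hypothesis hB : is_full_crossed_product al iota u.
Hypothesis js : is_star_hom j.
Hypothesis ju : forall g, j (lam g) = u g.
Hypothesis hT : is_tensor_product i1 i2.
Implicit Types (phi : {scalar B}) (Phi : {scalar T}).

Definition corresponds phi Phi := forall f a, Phi (i1 f * i2 a) = phi (iota f * j a).

Lemma u_iota g k : u g * iota k = iota (translate al g k) * u g.
Proof.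
have [[_ [_ _ us _] cov] _ _] := hB.
by rewrite -cov -mulrA us mulr1.
Qed.

Lemma central_product phi : central_states iota phi ->
  forall k f a, phi (iota k * (iota f * j a)) = phi (iota f * j a * iota k).
Proof. by move=> [_ c] k f a; apply: c; exists k. Qed.

Lemma tensor_product_central Phi k f a : Phi (i1 k * (i1 f * i2 a)) = Phi (i1 f * i2 a * i1 k).
Proof.
have [_ com _ _] := hT.
by rewrite -[in RHS]mulrA -com !mulrA -!rmorphM CX_mulC.
Qed.

Lemma ae_stabilizer phi (P : probability (borel X) R) (psi : X -> {scalar CG}) :
  central_states iota phi -> (forall x, is_state (psi x)) ->
  (forall a, cmeas (fun x => psi x a)) ->
  (forall f a, phi (iota f * j a) = complex_integral P (fun x => f x * psi x a)) ->
  {ae P, forall x : borel X, forall g, ~ stabilizer al x g -> psi x (lam g) = 0}.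
Proof.
move=> cphi psis psim phiE.
have psi_int a : cintg P (fun x => psi x a).
  by apply: (@cmeas_bounded _ _ P _ (cnorm a) (psim a)) => x; exact: state_bound.
have fint (f : CX R X) a : cintg P (fun x => f x * psi x a).
  by have [M hM] := CX_bounded cX f; exact: cintgM (CX_cmeas f) hM (psi_int a).
have [k [kc ksep]] := separating_sequence cX.
have [enum enumP] := countable_enum (1%g : G) cG.
(* Moving k past u_g replaces it by its translate, so centrality equates the integrals of f k
   psi(lam g) and of f times the translate of k times psi(lam g), for every f. *)
have aek g n : {ae P, forall x : borel X,
    (cplx (k n) x - cplx (k n) (al g^-1%g x)) * psi x (lam g) = 0}.
  apply: CX_integral_eq0 => [|f cf].
    have -> : (fun x => (cplx (k n) x - cplx (k n) (al g^-1%g x)) * psi x (lam g)) =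
        (fun x => CX_fun (cplx (k n) + (-1) *: translate al g (cplx (k n)) : CX R X) x * psi x (lam g)).
      apply/funext => x; rewrite CX_addE CX_scaleE /= mulN1r.
      by [].
    exact: fint.
  have -> : (fun x => (f x)%:C%C * ((cplx (k n) x - cplx (k n) (al g^-1%g x)) * psi x (lam g))) =
      (fun x => CX_fun (cplx f * cplx (k n) : CX R X) x * psi x (lam g) -
        CX_fun (cplx f * translate al g (cplx (k n)) : CX R X) x * psi x (lam g)).
    apply/funext => x; have e (h : CX R X) : CX_fun (cplx f * h) x = (f x)%:C%C * h x.
      by rewrite -(cplxE x cf).
    by rewrite !e -mulrBl -mulrBr mulrA.
  rewrite CIB; [|exact: fint|exact: fint]; apply/eqP; rewrite subr_eq0; apply/eqP.
  rewrite -!phiE !ju !rmorphM /= -[in RHS]mulrA -u_iota mulrA -ju -(central_product cphi).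
  by rewrite mulrA -!rmorphM CX_mulC.
have aeall : {ae P, forall x : borel X, forall m n,
    (cplx (k n) x - cplx (k n) (al (enum m)^-1%g x)) * psi x (lam (enum m)) = 0}.
  by apply: ae_foralln => m; apply: ae_foralln => n; exact: aek.
apply: filterS aeall => x h g gx; have [m gE] := enumP g.
apply: contrapT => ne; apply: gx; rewrite /stabilizer /=.
(* Where [psi x (lam g)] is nonzero, all the functions [k n] agree at x and g^-1 x, and together
   they separate points. *)
have xg : x = al g^-1%g x.
  apply: ksep => n; have /eqP := h m n; rewrite gE mulf_eq0 => /orP[|/eqP //].
  rewrite !cplxE // subr_eq0 => /eqP; exact: complexI.
by rewrite {1}xg -actM mulgV act1.
Qed.

Lemma disintegrable_of_central phi : central_states iota phi ->
  exists2 Phi, stabilizer_supported_states al lam i1 i2 Phi & corresponds phi Phi.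
Proof.
move=> cphi; have [sphi _] := cphi.
have [[si _ _] _ _] := hB.
pose Psi := product_functional iota j phi.
have [P [psi [psis psim PsiE]]] := @disintegration R G X CG lam cG cX hCG Psi
  (product_functional_lin iota j phi)
  (product_functional_pos sphi (central_product cphi) si js)
  (product_functional1 iota j sphi).
have [pi hpi] := @exists_choice _ _ (fun x (p : {lrmorphism T -> CG}) =>
    is_star_hom p /\ forall f a, p (i1 f * i2 a) = (f x : R[i]) *: a)
  (fun x => let: ex_intro2 p sp pE := tensor_slice hT x in ex_intro _ p (conj sp pE)).
have om_ex x : exists w : {scalar T}, is_state w /\ forall t, w t = psi x (pi x t).
  by have [w sw wE] := state_comp (hpi x).1 (psis x); exists w.
have [om hom] := exists_choice om_ex.
have omE x f a : om x (i1 f * i2 a) = f x * psi x a.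
  by rewrite (hom x).2 (hpi x).2 linearZ.
have [_ _ dT _] := hT.
have oms x : is_state (om x) by case: (hom x).
have omm t : [set t | exists a b, t = i1 a * i2 b] t -> cmeas (fun x => om x t).
  move=> [f [a ->]]; have -> : (fun x => om x (i1 f * i2 a)) = (fun x => f x * psi x a).
    by apply/funext => x; exact: omE.
  exact: cmeasM (CX_cmeas f) (psim a).
have [Phi sPhi PhiE] := state_integral P dT oms omm.
have PhiP f a : Phi (i1 f * i2 a) = complex_integral P (fun x => f x * psi x a).
  by rewrite PhiE; congr complex_integral; apply/funext => x; exact: omE.
exists Phi; last by move=> f a; rewrite PhiP -PsiE.
split=> //; exists P, psi; split.
  split=> // f; rewrite -[i1 f]mulr1 -(rmorph1 i2) PhiP; congr complex_integral.
  by apply/funext => x; rewrite (psis x).2 mulr1.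
by apply: (ae_stabilizer cphi psis psim) => f a; rewrite -PsiE.
Qed.

Lemma state_positive_kernel (w : {scalar CG}) : is_state w ->
  positive_kernel (group_kernel (fun g => w (lam g))).
Proof.
move=> [w0 _] c; have := w0 (\sum_(q <- c) q.1 *: lam q.2).
congr (0 <= _); rewrite star_sum mulr_suml linear_sum; apply: eq_bigr => q _.
rewrite starZ -scalerAl linearZ mulr_sumr linear_sum /=; congr (_ * _).
by apply: eq_bigr => r _; rewrite -scalerAr linearZ /= (lam_star hCG).
Qed.

Lemma central_of_disintegrable Phi : stabilizer_supported_states al lam i1 i2 Phi ->
  exists2 phi, central_states iota phi & corresponds phi Phi.
Proof.
move=> [sPhi [P [psi [[_ psis psim PhiE] [N [mN PN NP]]]]]].
have [[s1 s2] com dT _] := hT.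
have [[si _ _] dB _] := hB.
have [[l1 _ _ _] dCG _] := hCG.
have stab x g : ~ N x -> psi x (lam g) <> 0 -> al g x = x.
  move=> Nx ne; apply: contrapT => gx; apply: Nx; apply: NP => /= h.
  by apply: ne; exact: h.
have st x : ~ N x -> exists2 w : {scalar B}, is_state w &
    forall f g, w (iota f * u g) = f x * psi x (lam g).
  move=> Nx; have [_ psi1] := psis x.
  by apply: (orbit_state (state_positive_kernel (psis x)) _ cX _ hB) => [|g]; [rewrite l1|exact: stab].
(* A null set is not the whole space, so some point lies outside N; its state serves as the default
   value over N. *)
have [x0 Nx0] : exists x0, ~ N x0.
  apply: contrapT => h; have NT : N = setT.
    by apply/seteqP; split=> // x _; apply: contrapT => Nx; apply: h; exists x.
  by have := probability_setT P; rewrite -NT PN => /eqP; rewrite eq_sym onee_eq0.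
have [w0 sw0 w0E] := st x0 Nx0.
have om_ex (x : X) : exists w : {scalar B}, is_state w /\
    ((~ N x -> forall f g, w (iota f * u g) = f x * psi x (lam g)) /\ (N x -> w = w0)).
  have [Nx|Nx] := pselect (N x); first by exists w0.
  by have [w sw wE] := st x Nx; exists w.
have [om hom] := exists_choice om_ex.
have oms x : is_state (om x) by case: (hom x).
have omE f g x : om x (iota f * u g) =
    \1_N x * w0 (iota f * u g) + \1_(~` N) x * (f x * psi x (lam g)).
  have [_ [h1 h2]] := hom x; rewrite !indicE; have [Nx|Nx] := pselect (N x).
    by rewrite (mem_set Nx) (@memNset _ (~` N)) ?h2 ?mul1r ?mul0r ?addr0 // => /(_ Nx).
  by rewrite (memNset Nx) (@mem_set _ (~` N)) // mul0r mul1r add0r h1.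
have omm b : [set b | exists f g, b = iota f * u g] b -> cmeas (fun x => om x b).
  move=> [f [g ->]].
  have -> : (fun x => om x (iota f * u g)) = (fun x =>
      \1_N x * w0 (iota f * u g) + \1_(~` N) x * (f x * psi x (lam g))).
    by apply/funext => x; exact: omE.
  apply: cmeasD; apply: cmeasM; try exact: cmeas_cst; try exact: indic_cmeas.
    by apply: indic_cmeas; exact: measurableC.
  by apply: cmeasM; [exact: CX_cmeas|exact: psim].
have [phi sphi phiE] := state_integral P dB oms omm.
have psi_int a : cintg P (fun x => psi x a).
  by apply: (@cmeas_bounded _ _ P _ (cnorm a) (psim a)) => x; exact: state_bound.
have fint (f : CX R X) a : cintg P (fun x => f x * psi x a).
  by have [M hM] := CX_bounded cX f; exact: cintgM (CX_cmeas f) hM (psi_int a).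
have phiu f g : phi (iota f * u g) = complex_integral P (fun x => f x * psi x (lam g)).
  rewrite phiE; apply: CI_ae => //; [by apply: (state_field_intg P dB oms omm)|exact: fint|].
  exists N; split=> // x /= h; apply: contrapT => Nx; apply: h.
  by rewrite (hom x).2.1.
have cphi : central_states iota phi.
  split=> // _ [k _ <-] b.
  (* Covers left and right multiplication by [iota k] at once; centrality is then a matter of the
     products [iota f * u g]. *)
  have bnd (b1 b2 : B) (v : B -> B) : (forall b b', v b - v b' = b1 * (b - b') * b2) ->
      lipschitz (fun b => phi (v b)).
    move=> vB; exists (cnorm b1 * cnorm b2) => c c'; rewrite -linearB vB.
    rewrite (le_trans (state_bound _ sphi)) // (le_trans (cnormM _ _)) // mulrAC.
    by rewrite ler_wpM2r ?cnorm_ge0 // cnormM.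
  move: b; apply: (lipschitz_eq dB).
  - by apply: (bnd (iota k) 1) => b b'; rewrite mulr1 mulrBr.
  - by apply: (bnd 1 (iota k)) => b b'; rewrite mul1r mulrBl.
  move=> _ [n [c [s [ss ->]]]]; rewrite mulr_sumr mulr_suml !linear_sum.
  apply: eq_bigr => i _; rewrite -scalerAr -scalerAl !linearZ /=; congr (_ * _).
  case: (ss i) => f [g ->].
  rewrite mulrA -rmorphM -[in RHS]mulrA u_iota mulrA -rmorphM !phiu.
  apply: CI_ae; [exact: fint|exact: fint|exists N; split=> // x /= h]; apply: contrapT => Nx; apply: h.
  change (k x * f x * psi x (lam g) = f x * k (al g^-1%g x) * psi x (lam g)).
  (* Either the value of the state vanishes, or g fixes x and then k takes the same value at x and
     g^-1 x. *)
  have [->|/eqP ne] := eqVneq (psi x (lam g)) 0; first by rewrite !mulr0.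
  have gx := stab x g Nx ne; congr (_ * _); rewrite mulrC; congr (_ * k _).
  by rewrite -[in RHS]gx -actM mulVg act1.
exists phi => // f.
(* Both sides are product functionals, hence Lipschitz in the element of the group algebra, and they
   agree on the [lam g]. *)
apply: (lipschitz_eq dCG).
- exact: (Psi_lipschitz (product_functional_lin i1 i2 Phi)
    (product_functional_pos sPhi (tensor_product_central Phi) s1 s2) f).
- exact: (Psi_lipschitz (product_functional_lin iota j phi)
    (product_functional_pos sphi (central_product cphi) si js) f).
move=> a; apply: (@eq_on_span _ _ _ (product_functional i1 i2 Phi f) (product_functional iota j phi f)).
by move=> _ [g _ <-]; rewrite !product_functionalE ju phiu -PhiE.
Qed.

Lemma corresponds_unique phi Phi Phi' : is_state Phi -> is_state Phi' ->
  corresponds phi Phi -> corresponds phi Phi' -> Phi = Phi'.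
Proof.
move=> [p0 p1] [q0 q1] h h'; have [_ _ dT _] := hT.
apply: scalar_eq; apply: (eq_positive dT) => //; first by rewrite p1 q1.
by move=> _ [f [a ->]]; rewrite h h'.
Qed.

Lemma corresponds_inj phi phi' Phi : is_state phi -> is_state phi' ->
  corresponds phi Phi -> corresponds phi' Phi -> phi = phi'.
Proof.
move=> [p0 p1] [q0 q1] h h'; have [_ dB _] := hB.
apply: scalar_eq; apply: (eq_positive dB) => //; first by rewrite p1 q1.
by move=> _ [f [g ->]]; rewrite -ju -h -h'.
Qed.
End correspondence.

Theorem theorem2 (R : realType) (G : groupType) (X : pmetricType R)
  (al : caction G X)
  (CG : cstarAlgType R) (lam : G -> CG)
  (B : cstarAlgType R) (iota : {lrmorphism CX R X -> B}) (u : G -> B)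
  (j : {lrmorphism CG -> B})
  (T : cstarAlgType R) (i1 : {lrmorphism CX R X -> T})
  (i2 : {lrmorphism CG -> T}) :
  countable [set: G] ->
  compact [set: X] ->
  is_full_group_cstar lam ->
  is_full_crossed_product al iota u ->
  is_star_hom j -> (forall g, j (lam g) = u g) ->
  is_tensor_product i1 i2 ->
  exists F : {scalar B} -> {scalar T},
    set_bij (central_states iota)
            (stabilizer_supported_states al lam i1 i2) F /\
    (forall (phi : {scalar B}) (Phi : {scalar T}),
       central_states iota phi -> is_state Phi ->
       (forall (f : CX R X) (a : CG), Phi (i1 f * i2 a) = phi (iota f * j a))
       <-> Phi = F phi).
Proof.
move=> cG cX hCG hB js ju hT.
have zero_scalar : scalar (fun _ : T => 0 : R[i]) by move=> c a b; rewrite mulr0 addr0.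
have [F FP] : exists F : {scalar B} -> {scalar T}, forall phi, central_states iota phi ->
    stabilizer_supported_states al lam i1 i2 (F phi) /\ corresponds iota j i1 i2 phi (F phi).
  apply: (@exists_choice _ _ (fun phi (Phi : {scalar T}) => central_states iota phi ->
    stabilizer_supported_states al lam i1 i2 Phi /\ corresponds iota j i1 i2 phi Phi)) => phi.
  (* The value of F outside the central states is arbitrary; the zero functional is taken. *)
  have [c|nc] := pselect (central_states iota phi); last by exists (mk_scalar zero_scalar).
  by have [Phi ? ?] := disintegrable_of_central cG cX hCG hB js ju hT c; exists Phi.
exists F; split; first split.
- by move=> phi /FP[].
- move=> phi phi'; rewrite !inE => c c' FE.
  have [[s _] [s' _]] := (c, c').
  have [_ h] := FP _ c; have [_ h'] := FP _ c'; rewrite -FE in h'.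
  exact: (corresponds_inj hB ju s s' h h').
- move=> Phi sPhi; have [phi c h] := central_of_disintegrable cX hCG hB js ju hT sPhi.
  exists phi => //; have [[sF _] h'] := FP _ c.
  by apply: (corresponds_unique hT sF _ h' h); case: sPhi.
- move=> phi Phi c sPhi; have [[sF _] h'] := FP _ c; split=> [h|-> //].
  exact: (corresponds_unique hT sPhi sF h h').
Qed.
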